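(* Let $J\in L_2(\mathbb{R})\cap C(\mathbb{R})$ satisfy: (H1) $J\ge0$; (H2) $\int_{-\infty}^{\infty}J(x)\,dx=1$; (H3) $J(x)=J(-x)$ for all $x\in\mathbb{R}$; (H4) $J$ is decreasing on $(0,\infty)$; (H5) $\hat J(\xi)\ge 0$ for all $\xi$; (H6) $\frac{d}{d\xi}\hat J(\xi)\le 0$ for $\xi\ge0$. Then there exist constants $C_1(h)$ (depending on $h$), $C_2$, and $C_3(\sigma)$ (depending on $\sigma$) such that for every $h>0$, every $u_0\in H^{\sigma}(\mathbb{R})$ with $\sigma>\frac12$, and every $t\ge0$, $$\|u(\cdot,t)-\mathcal{S}U(\cdot,t)\|\le t\,C_1(h)\|u_0\|+C_2\,h\,\|u_0\|_{H^2(\mathbb{R})}+C_3(\sigma)\,h^{\sigma}\|u_0\|_{H^{\sigma}(\mathbb{R})},$$ where $u$ is the solution of the initial value problem $$u_t(x,t)=-u+u_x+u_{xx}+\int_{-\infty}^{\infty}J(x-y)\,(u(y,t)-u(x,t))\,dy,\qquad u(x,0)=u_0(x),\ x\in\mathbb{R},$$ and $U(t)=(U_j(t))_{j\in\mathbb{Z}}$ is its semidiscrete approximation $$\frac{dU_j}{dt}=\frac{U_{j+1}-2U_j+U_{j-1}}{h^2}+\frac{U_{j+1}-U_{j-1}}{2h}-U_j+h\sum_{k=-\infty}^{\infty}J(x_j-x_k)(U_k-U_j),\qquad U_j(0)=u_0(x_j),\ j\in\mathbb{Z}.$$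
   Context: Grid points are $x_j=jh$, $j\in\mathbb{Z}$. The continuous Fourier transform is $\hat v(\xi)=\frac{1}{\sqrt{2\pi}}\int_{-\infty}^{\infty}e^{-ix\xi}v(x)\,dx$. For a grid function $v=(v_m)$, the discrete Fourier transform is $\tilde v(\xi)=\frac{h}{\sqrt{2\pi}}\sum_{m}e^{-ihm\xi}v_m$, $\xi\in[-\pi/h,\pi/h]$ (applied to $J$ via its grid values $J(x_m)$). $\|\cdot\|$ is the $L_2(\mathbb{R})$ norm and $\|v\|_{H^s(\mathbb{R})}^2=\int(1+\xi^2)^s|\hat v(\xi)|^2d\xi$ (the right-hand side of the estimate is understood as $+\infty$ if $u_0\notin H^2(\mathbb{R})$). The exact solution $u$ is the one given by $\hat u(\xi,t)=e^{\hat q(\xi)t}\hat u_0(\xi)$ with $\hat q(\xi)=\sqrt{2\pi}(\hat J(\xi)-\hat J(0))-1-\xi^2+i\xi$. The semidiscrete solution is the one given by $\tilde U(\xi,t)=e^{\tilde q(\xi)t}\tilde U_0(\xi)$, where $\tilde U_0$ is the discrete Fourier transform of $(u_0(x_j))_j$ and $\tilde q(\xi)=\sqrt{2\pi}(\tilde J(\xi)-\tilde J(0))-\frac{4}{h^2}\sin^2\frac{h\xi}{2}+\frac{i}{h}\sin(h\xi)-1$. $\mathcal{S}U$ is its Fourier interpolant: $\mathcal{S}U(x,t)=\frac{1}{\sqrt{2\pi}}\int_{-\pi/h}^{\pi/h}e^{ix\xi}e^{\tilde q(\xi)t}\tilde U_0(\xi)\,d\xi$. The constants may depend on $J$; apart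 from this, only the indicated dependences are allowed (so the constants do not depend on $u_0$ or $t$, and $C_2$, $C_3(\sigma)$ do not depend on $h$). *)

(* Defs.v *)
From HB Require Import structures.
From mathcomp Require Import all_boot all_order all_algebra.
From mathcomp Require Import all_classical all_reals all_analysis.
From mathcomp Require Import complex.
Import Order.TTheory GRing.Theory Num.Theory.
Import numFieldNormedType.Exports.
Import ComplexField.

Set Implicit Arguments.
Unset Strict Implicit.
Unset Printing Implicit Defensive.

Local Open Scope classical_set_scope.
Local Open Scope ring_scope.
Local Open Scope complex_scope.

Section defs.
Context {R : realType}.
Implicit Types (D : set R) (f v w : R -> R[i]) (V : int -> R[i]) (J : R -> R).

Local Notation mu := (@lebesgue_measure R).
Local Notation Re := (@complex.Re R).
Local Notation Im := (@complex.Im R).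
Local Notation normc := (@Normc.normc R).

Definition cexp (z : R[i]) : R[i] :=
  (expR (Re z))%:C * (cos (Im z) +i* sin (Im z)).

Definition cis (y : R) : R[i] := cexp (0 +i* y).

Definition cint D f : R[i] :=
  Rintegral mu D (Re \o f) +i* Rintegral mu D (Im \o f).

Definition cmeasurable f : Prop :=
  measurable_fun setT (Re \o f) /\ measurable_fun setT (Im \o f).

Definition ccontinuous f : Prop :=
  continuous (Re \o f) /\ continuous (Im \o f).

Definition L2norm D f : \bar R :=
  'N[mu]_2%:E [EFin \o ((normc \o f) \_ D)].

Definition L2 D f : Prop := cmeasurable f /\ (L2norm D f < +oo)%E.

Definition fourier_integral D f (xi : R) : R[i] :=
  ((Num.sqrt (2 * pi))^-1)%:C * cint D (fun x => cis (- (x * xi)) * f x).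

(* Fourier transform on L2(R), in the sense of Plancherel: [w] is the limit in
   L2(R), as A -> +oo, of the transforms of [v] truncated to [-A, A]. *)
Definition is_fourier v w : Prop :=
  [/\ L2 setT v, L2 setT w &
      L2norm setT (w \- fourier_integral `[- A, A] v) @[A --> +oo] --> 0%E].

(* Defined up to a.e. equality only; for [v] in L2(R) the default value is not
   used, by Plancherel's theorem. *)
Definition fourier v : R -> R[i] := xget (fun=> 0) [set w | is_fourier v w].

(* The norm of H^s(R), infinite for [v] in L2(R) outside of H^s(R). *)
Definition sobolev_norm (s : R) v : \bar R :=
  ((\int[mu]_xi ((1 + xi ^+ 2) `^ s * normc (fourier v xi) ^+ 2)%:E)
     `^ 2^-1)%E.

(* For [s > 1/2] an element of H^s(R) has a continuous representative, the one
   whose grid values are meaningful; continuity is stated separately. *)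
Definition sobolev (s : R) v : Prop := L2 setT v /\ (sobolev_norm s v < +oo)%E.

(* The terms of index m = -n, ..., n of the series defining the discrete Fourier
   transform. *)
Definition dft_sum (h : R) V (n : nat) (xi : R) : R[i] :=
  (h / Num.sqrt (2 * pi))%:C *
  \sum_(k < n.*2.+1)
     let m := (k%:Z - n%:Z)%R in cis (- (h * m%:~R * xi)) * V m.

(* Pointwise sum, to be used for absolutely convergent series only. *)
Definition dft_series (h : R) V (xi : R) : R[i] :=
  limn (fun n => Re (dft_sum h V n xi)) +i*
  limn (fun n => Im (dft_sum h V n xi)).

Definition nyquist (h : R) : set R := `[- (pi / h), pi / h].

(* For a square-summable grid function the series converges in
   L2(-pi/h, pi/h) only. *)
Definition is_dft (h : R) V w : Prop :=
  L2 (nyquist h) w /\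
  L2norm (nyquist h) (w \- dft_sum h V n) @[n --> \oo] --> 0%E.

Definition dft (h : R) V : R -> R[i] := xget (fun=> 0) [set w | is_dft h V w].

Definition grid_values (T : Type) (h : R) (f : R -> T) (j : int) : T :=
  f (j%:~R * h).

Definition fourier_interpolant (h : R) V (x : R) : R[i] :=
  ((Num.sqrt (2 * pi))^-1)%:C *
  cint (nyquist h) (fun xi => cis (x * xi) * dft h V xi).

Definition J_hat J : R -> R[i] := fourier_integral setT (fun x => (J x)%:C).

Definition J_tilde (h : R) J : R -> R[i] :=
  dft_series h (grid_values h (fun x => (J x)%:C)).

Definition q_hat J (xi : R) : R[i] :=
  (Num.sqrt (2 * pi))%:C * (J_hat J xi - J_hat J 0)
  - 1 - (xi ^+ 2)%:C + 'i%C * xi%:C.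

Definition q_tilde (h : R) J (xi : R) : R[i] :=
  (Num.sqrt (2 * pi))%:C * (J_tilde h J xi - J_tilde h J 0)
  - (4 / h ^+ 2 * sin (h * xi / 2) ^+ 2)%:C
  + 'i%C * (sin (h * xi) / h)%:C - 1.

(* [u t x] is the solution of
   u_t = - u + u_x + u_xx + int J(x - y) (u(y, t) - u(x, t)) dy, u(., 0) = u0,
   that is, the one obtained by solving the equation in Fourier variables. *)
Definition exact_solution J (u0 : R -> R[i]) (u : R -> R -> R[i]) : Prop :=
  exists2 u0_hat : R -> R[i], is_fourier u0 u0_hat &
    forall t : R, 0 <= t ->
      is_fourier (u t) (fun xi => cexp (q_hat J xi * t%:C) * u0_hat xi).

(* [U t j] is the solution of
   dU_j/dt = (U_(j+1) - 2 U_j + U_(j-1)) / h^2 + (U_(j+1) - U_(j-1)) / (2 h)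
             - U_j + h sum_k J(x_j - x_k) (U_k - U_j),  U_j(0) = u0(x_j),
   obtained in the same way from the discrete Fourier transform. *)
Definition semidiscrete_solution (h : R) J (u0 : R -> R[i])
    (U : R -> int -> R[i]) : Prop :=
  exists2 U0_tilde : R -> R[i], is_dft h (grid_values h u0) U0_tilde &
    forall t : R, 0 <= t ->
      is_dft h (U t) (fun xi => cexp (q_tilde h J xi * t%:C) * U0_tilde xi).

Record kernel_hypotheses J : Prop := KernelHypotheses {
  kernel_L2 : J \in Lfun mu 2%:E ;
  kernel_continuous : continuous J ;
  kernel_ge0 : forall x, 0 <= J x ;
  kernel_int1 : (\int[mu]_x (J x)%:E = 1)%E ;
  kernel_even : forall x, J x = J (- x) ;
  kernel_decreasing : forall x y : R, 0 < x -> x <= y -> J y <= J x ;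
  (* in the order of R[i], i.e., [J_hat J xi] is real and nonnegative; hence the
     use of the real part below *)
  kernel_hat_ge0 : forall xi : R, 0 <= J_hat J xi ;
  kernel_hat_derivable : forall xi : R, 0 <= xi ->
    derivable (Re \o J_hat J) xi 1 ;
  kernel_hat_decreasing : forall xi : R, 0 <= xi ->
    derive1 (Re \o J_hat J) xi <= 0 }.

End defs.

(* Main.v *)
Require Import Defs.
From HB Require Import structures.
From mathcomp Require Import all_boot all_order all_algebra.
From mathcomp Require Import all_classical all_reals all_analysis.
From mathcomp Require Import complex.
From mathcomp Require Import measurable_realfun.
From mathcomp Require Import zify ring lra.
Import Order.TTheory GRing.Theory Num.Theory.
Import numFieldNormedType.Exports.

(** The error is estimated on the frequency side. By Plancherel's theorem the L2 norm of
    the error is that of the difference of [exp (q_hat t) u0_hat], where [u0_hat] is the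
    transform of [u0], and of [exp (q_tilde t) U0_tilde] restricted to the Nyquist
    interval [[- pi / h, pi / h]]. Three contributions are bounded separately.

    - The symbols. Both [q_hat] and [q_tilde h] have nonpositive real part and are bounded
      on the Nyquist interval, because [J] is even, nonnegative, decreasing and of
      integral 1; as the exponential is Lipschitz on the left half-plane,
      [exp (q_hat t)] and [exp (q_tilde t)] differ there by at most
      [t * consistency_cst J h] ([evolution_nyquist]).
    - The frequencies beyond the Nyquist interval, where the interpolant vanishes and the
      Sobolev weight is at least [(pi / h) ^ sigma] ([evolution_far]).
    - The sampling of the initial value. The samples of [u0] are the coefficients of
      [U0_tilde], so the coefficients of [U0_tilde - u0_hat] on the Nyquist interval are
      the samples of the function whose transform is the part of [u0_hat] beyond that
      interval. By duality these are bounded by pairing that part with trigonometric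
      sums, which are periodic: the weight [|xi| ^ (- 2 sigma)] makes the contributions
      of the translates of a period summable for [sigma > 1 / 2] ([bessel_tail]). Since
      the exponentials are complete ([nyquist_parseval]), the bound on the coefficients
      bounds the function ([sampling_error]).

    What is used of Plancherel's theorem are two inequalities. The transform does not
    increase the L2 norm ([ft_contraction]): by the multiplication formula, the transform
    of [f] damped by [exp (- d |xi|)] is paired with the Poisson smoothing of [f], and
    Schur's test applies. Inversion ([inversion_le], [plancherel_inversion]) bounds
    [v - ft w (- x)] by [ft v - w]; it follows from the first inequality since the
    damped inverse transforms converge in the mean, by Lebesgue's differentiation
    theorem. *)

Set Implicit Arguments.
Unset Strict Implicit.
Unset Printing Implicit Defensive.

Local Open Scope classical_set_scope.
Local Open Scope ring_scope.
Local Open Scope complex_scope.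

(** * Complex-valued measurable functions and their integrals *)

Section complex_numbers.
Context {R : realType}.
Local Notation Re := (@complex.Re R).
Local Notation Im := (@complex.Im R).
Local Notation normc := (@Normc.normc R).
Implicit Types z w : R[i].

Lemma normc_sqr z : normc z ^+ 2 = Re z ^+ 2 + Im z ^+ 2.
Proof. by case: z => a b /=; rewrite sqr_sqrtr// addr_ge0 ?sqr_ge0. Qed.

Lemma normc_ge0 z : 0 <= normc z.
Proof. by case: z => a b /=; exact: sqrtr_ge0. Qed.

Lemma normcD_le z w : normc (z + w) <= normc z + normc w.
Proof. exact: le_normcD. Qed.

Lemma normc_opp z : normc (- z) = normc z.
Proof. exact: (@normcN R). Qed.

Lemma normc_sub z w : normc (z - w) = normc (w - z).
Proof. by rewrite -normc_opp opprB. Qed.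

Lemma normcB_le z w : normc (z - w) <= normc z + normc w.
Proof. by rewrite -(normc_opp w); exact: normcD_le. Qed.

Lemma normc_real (x : R) : normc x%:C = `|x|.
Proof. by rewrite /= expr0n/= addr0 sqrtr_sqr. Qed.

Lemma normc_conj z : normc (conjc z) = normc z.
Proof. by case: z => a b /=; rewrite sqrrN. Qed.

Lemma normc_zero : normc 0 = 0.
Proof. exact: Normc.normc0. Qed.

Lemma Re_le_normc z : `|Re z| <= normc z.
Proof.
by case: z => a b /=; rewrite -sqrtr_sqr ler_wsqrtr// lerDl sqr_ge0.
Qed.

Lemma Im_le_normc z : `|Im z| <= normc z.
Proof.
by case: z => a b /=; rewrite -sqrtr_sqr ler_wsqrtr// lerDr sqr_ge0.
Qed.

Lemma normc_le_ReIm z : normc z <= `|Re z| + `|Im z|.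
Proof.
rewrite -(@ler_pXn2r _ 2)// ?nnegrE ?normc_ge0 ?addr_ge0//.
rewrite normc_sqr sqrrD !real_normK ?num_real//.
have : 0 <= `|Re z| * `|Im z| by rewrite mulr_ge0.
by rewrite mulr2n; lra.
Qed.

Lemma conj_mul_normc z : z * conjc z = (normc z ^+ 2)%:C.
Proof.
rewrite normc_sqr; case: z => a b /=; apply/eqP; rewrite eq_complex/=.
by apply/andP; split; apply/eqP; ring.
Qed.

Lemma ReD z w : Re (z + w) = Re z + Re w. Proof. by case: z w => ? ? []. Qed.
Lemma ImD z w : Im (z + w) = Im z + Im w. Proof. by case: z w => ? ? []. Qed.
Lemma ReN z : Re (- z) = - Re z. Proof. by case: z. Qed.
Lemma ImN z : Im (- z) = - Im z. Proof. by case: z. Qed.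
Lemma ReM z w : Re (z * w) = Re z * Re w - Im z * Im w.
Proof. by case: z w => ? ? []. Qed.
Lemma ImM z w : Im (z * w) = Re z * Im w + Im z * Re w.
Proof. by case: z w => ? ? []. Qed.
Lemma Re_conj z : Re (conjc z) = Re z. Proof. by case: z. Qed.
Lemma Im_conj z : Im (conjc z) = - Im z. Proof. by case: z. Qed.

Lemma conjM z w : conjc (z * w) = conjc z * conjc w. Proof. exact: (rmorphM (@conjc R)). Qed.

Lemma conj_real (x : R) : conjc (x%:C) = x%:C. Proof. by rewrite /= oppr0. Qed.

Lemma complexP z w : Re z = Re w -> Im z = Im w -> z = w.
Proof. by case: z w => ? ? [? ?] /= -> ->. Qed.

Lemma conj_sum I (r : seq I) (P : pred I) (F : I -> R[i]) :
  conjc (\sum_(i <- r | P i) F i) = \sum_(i <- r | P i) conjc (F i).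
Proof. by rewrite (big_morph (@conjc R) (rmorphD _) (rmorph0 _)). Qed.

Lemma cisE (y : R) : cis y = cos y +i* sin y.
Proof. by rewrite /cis /cexp /= expR0 mul1r. Qed.

Lemma cis0 : cis 0 = 1 :> R[i].
Proof. by rewrite cisE cos0 sin0. Qed.

Lemma cisD (x y : R) : cis (x + y) = cis x * cis y.
Proof.
by rewrite !cisE cosD sinD; apply: complexP; rewrite ?ReM ?ImM/=; ring.
Qed.

Lemma cis_conj (x : R) : conjc (cis x) = cis (- x).
Proof. by rewrite !cisE cosN sinN. Qed.

Lemma normc_cis (x : R) : normc (cis x) = 1.
Proof. by rewrite cisE /= cos2Dsin2 sqrtr1. Qed.

(** Multiplying a complex number by the phase [c] makes it equal to its norm;
    this reduces norm estimates of complex integrals to real ones. *)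
Lemma phase z : exists2 c, normc c = 1 & c * z = (normc z)%:C.
Proof.
have [z0|z0] := eqVneq (normc z) 0.
  by exists 1; rewrite ?Normc.normc1// mul1r z0; exact: Normc.eq0_normc.
exists (conjc z * ((normc z)^-1)%:C).
  by rewrite Normc.normcM normc_conj normc_real ger0_norm ?invr_ge0 ?normc_ge0// mulfV.
rewrite mulrAC [conjc z * z]mulrC conj_mul_normc -rmorphM; congr (_%:C).
by rewrite expr2 -mulrA mulfV// mulr1.
Qed.

End complex_numbers.

Section complex_measurability.
Context {R : realType} d (T : measurableType d).
Local Notation Re := (@complex.Re R).
Local Notation Im := (@complex.Im R).
Local Notation normc := (@Normc.normc R).
Implicit Types f g : T -> R[i].

(** [cmeasurable], over any measurable type: Fubini's theorem needs the plane. *)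
Definition cmeas f : Prop :=
  measurable_fun setT (Re \o f) /\ measurable_fun setT (Im \o f).

(* [Re \o f] spelled out pointwise, the form on which rewriting under binders works *)
Lemma cmeas_intro f : measurable_fun setT (fun x => Re (f x)) ->
  measurable_fun setT (fun x => Im (f x)) -> cmeas f.
Proof. by []. Qed.

Lemma cmeasD f g : cmeas f -> cmeas g -> cmeas (fun x => f x + g x).
Proof.
move=> [f1 f2] [g1 g2]; apply: cmeas_intro.
  by under eq_fun do rewrite ReD; exact: measurable_funD.
by under eq_fun do rewrite ImD; exact: measurable_funD.
Qed.

Lemma cmeasN f : cmeas f -> cmeas (fun x => - f x).
Proof.
move=> [f1 f2]; apply: cmeas_intro.
  by under eq_fun do rewrite ReN; exact: measurableT_comp.
by under eq_fun do rewrite ImN; exact: measurableT_comp.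
Qed.

Lemma cmeasB f g : cmeas f -> cmeas g -> cmeas (fun x => f x - g x).
Proof. by move=> mf mg; exact/cmeasD/cmeasN. Qed.

Lemma cmeasM f g : cmeas f -> cmeas g -> cmeas (fun x => f x * g x).
Proof.
move=> [f1 f2] [g1 g2]; apply: cmeas_intro.
  by under eq_fun do rewrite ReM; apply: measurable_funB; exact: measurable_funM.
by under eq_fun do rewrite ImM; apply: measurable_funD; exact: measurable_funM.
Qed.

Lemma cmeas_conj f : cmeas f -> cmeas (fun x => conjc (f x)).
Proof.
move=> [f1 f2]; apply: cmeas_intro.
  by under eq_fun do rewrite Re_conj.
by under eq_fun do rewrite Im_conj; exact: measurableT_comp.
Qed.

Lemma cmeas_real (f : T -> R) : measurable_fun setT f -> cmeas (fun x => (f x)%:C).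
Proof. by move=> mf; apply: cmeas_intro => //=; exact: measurable_cst. Qed.

Lemma cmeas_cst (c : R[i]) : cmeas (fun=> c).
Proof. by split; exact: measurable_cst. Qed.

Lemma cmeas_cis (f : T -> R) : measurable_fun setT f -> cmeas (fun x => cis (f x)).
Proof.
move=> mf; apply: cmeas_intro.
  under eq_fun do rewrite cisE/=.
  apply: measurableT_comp => //.
  exact: (continuous_measurable_fun (@continuous_cos R)).
under eq_fun do rewrite cisE/=.
apply: measurableT_comp => //.
exact: (continuous_measurable_fun (@continuous_sin R)).
Qed.

Lemma cmeas_sum I (r : seq I) (F : I -> T -> R[i]) :
  (forall i, cmeas (F i)) -> cmeas (fun x => \sum_(i <- r) F i x).
Proof.
move=> mF; elim: r => [|i r IH].
  by under eq_fun do rewrite big_nil; exact: cmeas_cst.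
by under eq_fun do rewrite big_cons; exact: cmeasD.
Qed.

Lemma measurable_normc_sqr f : cmeas f -> measurable_fun setT (fun x => normc (f x) ^+ 2).
Proof.
move=> [f1 f2]; under eq_fun do rewrite normc_sqr.
by apply: measurable_funD; exact: measurable_funX.
Qed.

Lemma measurable_normc f : cmeas f -> measurable_fun setT (fun x => normc (f x)).
Proof.
move=> mf; have := measurable_normc_sqr mf.
under [X in _ -> _ _ X]eq_fun do rewrite -[normc _]ger0_norm ?normc_ge0// -sqrtr_sqr.
move=> /(measurableT_comp _); apply.
exact: continuous_measurable_fun (@sqrt_continuous R).
Qed.

Lemma cmeas_eq f g : f =1 g -> cmeas f -> cmeas g.
Proof. by move=> /funext ->. Qed.

End complex_measurability.

Lemma cmeas_comp (R : realType) d d' (T : measurableType d) (T' : measurableType d')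
  (f : T' -> R[i]) (p : T -> T') : cmeas f -> measurable_fun setT p ->
  cmeas (fun x => f (p x)).
Proof. by move=> [f1 f2] mp; split; [exact: (measurableT_comp f1)|exact: (measurableT_comp f2)]. Qed.

Section complex_integral.
Context {R : realType}.
Local Notation mu := (@lebesgue_measure R).
Local Notation Re := (@complex.Re R).
Local Notation Im := (@complex.Im R).
Local Notation normc := (@Normc.normc R).
Implicit Types f g : R -> R[i].

Lemma ae_imply (P Q : R -> Prop) : (forall x, P x -> Q x) ->
  {ae mu, forall x, P x} -> {ae mu, forall x, Q x}.
Proof. by move=> PQ; apply: filterS; first exact: (ae_filter_ringOfSetsType mu). Qed.

Lemma ae_and (P Q : R -> Prop) : {ae mu, forall x, P x} -> {ae mu, forall x, Q x} ->
  {ae mu, forall x, P x /\ Q x}.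
Proof. by move=> p q; apply: filterI => //; exact: (ae_filter_ringOfSetsType mu). Qed.

Definition cintegrable f : Prop :=
  cmeas f /\ (\int[mu]_x (normc (f x))%:E < +oo)%E.

Lemma integrable_normc f : cintegrable f -> mu.-integrable setT (fun x => (normc (f x))%:E).
Proof.
move=> [mf fy]; apply/integrableP; split.
  exact/measurable_EFinP/measurable_normc.
apply: le_lt_trans fy; rewrite le_eqVlt; apply/orP; left; apply/eqP.
by apply: eq_integral => x _; rewrite gee0_abs// lee_fin normc_ge0.
Qed.

Lemma integrable_Re f : cintegrable f -> mu.-integrable setT (EFin \o (Re \o f)).
Proof.
move=> fi; apply: le_integrable (integrable_normc fi) => //.
  by apply/measurable_EFinP; case: fi => -[].
by move=> x _ /=; rewrite lee_fin [leRHS]ger0_norm ?normc_ge0// Re_le_normc.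
Qed.

Lemma integrable_Im f : cintegrable f -> mu.-integrable setT (EFin \o (Im \o f)).
Proof.
move=> fi; apply: le_integrable (integrable_normc fi) => //.
  by apply/measurable_EFinP; case: fi => -[].
by move=> x _ /=; rewrite lee_fin [leRHS]ger0_norm ?normc_ge0// Im_le_normc.
Qed.

Lemma cintegrable_le f (g : R -> R) : cmeas f -> mu.-integrable setT (EFin \o g) ->
  (forall x, normc (f x) <= g x) -> cintegrable f.
Proof.
move=> mf gi fg; split => //.
have /integrableP[mg] := gi; apply: le_lt_trans.
apply: ge0_le_integral => //.
- by move=> x _; rewrite lee_fin normc_ge0.
- exact/measurable_EFinP/measurable_normc.
- exact: measurableT_comp.
- by move=> x _ /=; rewrite lee_fin (le_trans (fg x))// ler_norm.
Qed.

Lemma cintegrable_bounded_mul f g (M : R) : cmeas g -> (forall x, normc (g x) <= M) ->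
  cintegrable f -> cintegrable (fun x => g x * f x).
Proof.
move=> mg gM fi; apply: (@cintegrable_le _ (fun x => M * normc (f x))).
- by apply: cmeasM => //; case: fi.
- by under [EFin \o _]eq_fun do rewrite /= EFinM; exact/integrableZl/integrable_normc.
- by move=> x; rewrite Normc.normcM ler_wpM2r ?normc_ge0.
Qed.

Lemma cintegrableZ (c : R[i]) f : cintegrable f -> cintegrable (fun x => c * f x).
Proof. by apply: (@cintegrable_bounded_mul _ _ (normc c)) => //; exact: cmeas_cst. Qed.

Lemma cintegrableD f g : cintegrable f -> cintegrable g -> cintegrable (fun x => f x + g x).
Proof.
move=> fi gi; apply: (@cintegrable_le _ (fun x => normc (f x) + normc (g x))).
- by apply: cmeasD; [case: fi|case: gi].
- have := integrableD measurableT (integrable_normc fi) (integrable_normc gi).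
  by congr (_.-integrable _ _).
- by move=> x; exact: normcD_le.
Qed.

Lemma cintegrableN f : cintegrable f -> cintegrable (fun x => - f x).
Proof.
move=> /(@cintegrableZ (-1)); congr cintegrable.
by apply/funext => x; rewrite mulN1r.
Qed.

Lemma cintegrableB f g : cintegrable f -> cintegrable g -> cintegrable (fun x => f x - g x).
Proof. by move=> fi gi; exact/cintegrableD/cintegrableN. Qed.

Lemma cintegrable_conj f : cintegrable f -> cintegrable (fun x => conjc (f x)).
Proof.
move=> fi; apply: (@cintegrable_le _ (fun x => normc (f x))).
- by apply: cmeas_conj; case: fi.
- exact: integrable_normc.
- by move=> x; rewrite normc_conj.
Qed.

Lemma eq_cint f g : f =1 g -> cint setT f = cint setT g.
Proof. by move=> /funext ->. Qed.

Lemma cintD f g : cintegrable f -> cintegrable g ->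
  cint setT (fun x => f x + g x) = cint setT f + cint setT g.
Proof.
move=> fi gi; apply: complexP; rewrite ?ReD ?ImD /=.
- rewrite -RintegralD//; [|exact: integrable_Re|exact: integrable_Re].
  by apply: eq_Rintegral => x _ /=; rewrite ReD.
- rewrite -RintegralD//; [|exact: integrable_Im|exact: integrable_Im].
  by apply: eq_Rintegral => x _ /=; rewrite ImD.
Qed.

Lemma cintZ (c : R[i]) f : cintegrable f ->
  cint setT (fun x => c * f x) = c * cint setT f.
Proof.
move=> fi; have ri := integrable_Re fi; have ii := integrable_Im fi.
have zi (a : R) (h : R -> R) : mu.-integrable setT (EFin \o h) ->
    mu.-integrable setT (EFin \o (fun x => a * h x)).
  by move=> hi; exact: (integrableZl measurableT a hi).
apply: complexP; rewrite ?ReM ?ImM /=.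
- rewrite -!RintegralZl// -RintegralB//; [|exact: zi|exact: zi].
  by apply: eq_Rintegral => x _ /=; rewrite ReM.
- rewrite -!RintegralZl// -RintegralD//; [|exact: zi|exact: zi].
  by apply: eq_Rintegral => x _ /=; rewrite ImM.
Qed.

Lemma cintN f : cintegrable f -> cint setT (fun x => - f x) = - cint setT f.
Proof.
move=> fi; rewrite -mulN1r -cintZ//.
by apply: eq_cint => x; rewrite mulN1r.
Qed.

Lemma cintB f g : cintegrable f -> cintegrable g ->
  cint setT (fun x => f x - g x) = cint setT f - cint setT g.
Proof. by move=> fi gi; rewrite cintD ?cintN//; exact: cintegrableN. Qed.

Lemma cint_sum (I : Type) (r : seq I) (F : I -> R -> R[i]) :
  (forall i, cintegrable (F i)) ->
  cint setT (fun x => \sum_(i <- r) F i x) = \sum_(i <- r) cint setT (F i)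
  /\ cintegrable (fun x => \sum_(i <- r) F i x).
Proof.
move=> Fi; elim: r => [|i r [IH IHi]].
  rewrite big_nil; under eq_fun do rewrite big_nil.
  split; last first.
    split; first exact: cmeas_cst.
    by under eq_integral do rewrite normc_zero; rewrite integral0.
  by apply: complexP; rewrite /= /Rintegral; under eq_integral do rewrite /=;
    rewrite integral0.
rewrite big_cons; under eq_fun do rewrite big_cons.
by rewrite cintD// IH; split => //; exact: cintegrableD.
Qed.

Lemma cint_conj f : cintegrable f -> cint setT (fun x => conjc (f x)) = conjc (cint setT f).
Proof.
move=> fi; apply: complexP => /=.
  by apply: eq_Rintegral => x _ /=; rewrite Re_conj.
rewrite -mulN1r -RintegralZl//; last exact: integrable_Im.
by apply: eq_Rintegral => x _ /=; rewrite Im_conj mulN1r.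
Qed.

Lemma normc_cint_le f : cintegrable f ->
  ((normc (cint setT f))%:E <= \int[mu]_x (normc (f x))%:E)%E.
Proof.
move=> fi; have [c c1 cE] := phase (cint setT f).
have -> : normc (cint setT f) = Re (cint setT (fun x => c * f x)).
  by rewrite cintZ// cE.
have cfi := cintegrableZ c fi.
rewrite /= /Rintegral fineK; last exact: integrable_fin_num (integrable_Re cfi).
apply: le_integral => //; [exact: integrable_Re|exact: integrable_normc|].
move=> x _ /=; rewrite lee_fin (le_trans (ler_norm _))// (le_trans (Re_le_normc _))//.
by rewrite Normc.normcM c1 mul1r.
Qed.

Lemma cint_dominated (f_ : (R -> R[i])^nat) f (g : R -> R) :
  (forall n, cmeas (f_ n)) -> cmeas f ->
  {ae mu, forall x, normc (f_ n x - f x) @[n --> \oo] --> 0} ->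
  mu.-integrable setT (EFin \o g) ->
  (forall n x, normc (f_ n x) <= g x) -> (forall x, normc (f x) <= g x) ->
  normc (cint setT (f_ n) - cint setT f) @[n --> \oo] --> 0.
Proof.
move=> mf_ mf f_f gi f_g fg.
have f_i n : cintegrable (f_ n) by exact: cintegrable_le gi _.
have fi : cintegrable f by exact: cintegrable_le gi _.
have di n : cintegrable (fun x => f_ n x - f x) by exact: cintegrableB.
have [|||||_ _] := @dominated_convergence _ _ _ mu setT measurableT
  (fun n x => (normc (f_ n x - f x))%:E) (cst 0%E) (fun x => (2 * g x)%:E).
- by move=> n; apply/measurable_EFinP/measurable_normc; case: (di n).
- exact: measurable_cst.
- by apply: ae_imply f_f => x f_f _; apply: cvg_EFin => //; exact: nearW.
- exact: (integrableZl measurableT 2 gi).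
- apply: aeW => x n _; rewrite gee0_abs ?lee_fin ?normc_ge0//.
  by rewrite (le_trans (normcB_le _ _))// mulr_natl mulr2n lerD.
rewrite integral0 => /fine_cvgP[_]; apply: (@squeeze_cvgr _ _ _ _ (cst 0)).
- apply: nearW => n; apply/andP; split; first exact: normc_ge0.
  rewrite -cintB// -lee_fin.
  apply: (le_trans (normc_cint_le (di n))); rewrite /comp fineK//.
  exact: integrable_fin_num (integrable_normc (di n)).
- exact: cvg_cst.
Qed.

(** The hypothesis is Tonelli's criterion for the integrability of [F]. *)
Lemma cint_fubini (F : R * R -> R[i]) : cmeas F ->
  (\int[mu]_x \int[mu]_y (normc (F (x, y)))%:E < +oo)%E ->
  (forall x, cintegrable (fun y => F (x, y))) ->
  (forall y, cintegrable (fun x => F (x, y))) ->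
  cint setT (fun x => cint setT (fun y => F (x, y))) =
  cint setT (fun y => cint setT (fun x => F (x, y))).
Proof.
move=> mF Fy Fx1 Fx2.
have Ni : (mu \x mu)%E.-integrable setT (fun z => (normc (F z))%:E).
  apply/integrable12ltyP; first exact/measurable_EFinP/measurable_normc.
  apply: le_lt_trans Fy; rewrite le_eqVlt; apply/orP; left; apply/eqP.
  apply: eq_integral => x _; apply: eq_integral => y _.
  by rewrite gee0_abs// lee_fin normc_ge0.
have Ri : (mu \x mu)%E.-integrable setT (EFin \o (Re \o F)).
  apply: le_integrable Ni => //; first by apply/measurable_EFinP; case: mF.
  by move=> x _ /=; rewrite lee_fin [leRHS]ger0_norm ?normc_ge0// Re_le_normc.
have Ii : (mu \x mu)%E.-integrable setT (EFin \o (Im \o F)).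
  apply: le_integrable Ni => //; first by apply/measurable_EFinP; case: mF.
  by move=> x _ /=; rewrite lee_fin [leRHS]ger0_norm ?normc_ge0// Im_le_normc.
apply: complexP; rewrite /= /Rintegral; congr fine.
- rewrite -[LHS]/(\int[mu]_x (Rintegral mu setT (fun y => Re (F (x, y))))%:E)%E.
  rewrite -[RHS]/(\int[mu]_y (Rintegral mu setT (fun x => Re (F (x, y))))%:E)%E.
  transitivity (\int[mu]_x \int[mu]_y (Re (F (x, y)))%:E)%E.
    apply: eq_integral => x _; rewrite fineK//.
    exact: integrable_fin_num (integrable_Re (Fx1 x)).
  rewrite (Fubini Ri); apply: eq_integral => y _; rewrite fineK//.
  exact: integrable_fin_num (integrable_Re (Fx2 y)).
- rewrite -[LHS]/(\int[mu]_x (Rintegral mu setT (fun y => Im (F (x, y))))%:E)%E.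
  rewrite -[RHS]/(\int[mu]_y (Rintegral mu setT (fun x => Im (F (x, y))))%:E)%E.
  transitivity (\int[mu]_x \int[mu]_y (Im (F (x, y)))%:E)%E.
    apply: eq_integral => x _; rewrite fineK//.
    exact: integrable_fin_num (integrable_Im (Fx1 x)).
  rewrite (Fubini Ii); apply: eq_integral => y _; rewrite fineK//.
  exact: integrable_fin_num (integrable_Im (Fx2 y)).
Qed.

End complex_integral.

(** * Square-integrable functions *)

Section square_integrable.
Context {R : realType}.
Local Notation mu := (@lebesgue_measure R).
Local Notation Re := (@complex.Re R).
Local Notation Im := (@complex.Im R).
Local Notation normc := (@Normc.normc R).
Implicit Types (f g : R -> R[i]) (D : set R).
Local Open Scope ereal_scope.

Lemma normc_dist (z w : R[i]) : (`|normc z - normc w| <= normc (z - w))%R.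
Proof.
rewrite ler_norml lerNl opprB !lerBlDr; apply/andP; split.
  by rewrite -normc_sub (le_trans _ (normcD_le _ _))// subrK.
by rewrite (le_trans _ (normcD_le _ _))// subrK.
Qed.

Lemma cvg_normc T (F : set_system T) {FF : ProperFilter F} (u : T -> R[i]) (l : R[i]) :
  normc (u x - l)%R @[x --> F] --> (0 : R)%R -> normc (u x) @[x --> F] --> normc l.
Proof.
move=> ul; apply/cvgrPdist_le => e e0.
move/cvgrPdist_le : ul => /(_ e e0); apply: filterS => x.
rewrite sub0r normrN ger0_norm ?normc_ge0//; apply: le_trans.
by rewrite distrC normc_dist.
Qed.

(** The square of the L2 norm, in the form to which the theorems of Tonelli and Fatou
    apply. *)
Definition energy f : \bar R := \int[mu]_x (normc (f x) ^+ 2)%:E.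

(** Truncation by multiplication, so that integrals over the whole line suffice. *)
Definition cut D f : R -> R[i] := fun x => ((\1_D x)%:C * f x)%R.

Lemma cut_in D f x : D x -> cut D f x = f x.
Proof. by move=> Dx; rewrite /cut indicE mem_set// mul1r. Qed.

Lemma cut_out D f x : ~ D x -> cut D f x = 0%R.
Proof. by move=> Dx; rewrite /cut indicE memNset// mul0r. Qed.

Lemma cutE D f x : cut D f x = if x \in D then f x else 0%R.
Proof. by case: ifPn => [/set_mem/cut_in|/negP/(contra_not (@mem_set _ _ _))/cut_out]. Qed.

Lemma cmeas_cut D f : measurable D -> cmeas f -> cmeas (cut D f).
Proof. by move=> mD mf; apply: cmeasM => //; apply: cmeas_real; exact: measurable_indic. Qed.

Lemma normc_cut_le D f x : (normc (cut D f x) <= normc (f x))%R.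
Proof. by rewrite cutE; case: ifP; rewrite ?normc_zero ?normc_ge0. Qed.

Lemma cint_cut D f : cint setT (cut D f) = cint D f.
Proof.
apply: complexP; rewrite /cint /= [RHS]Rintegral_mkcond; apply: eq_Rintegral => x _;
  by rewrite /= patchE cutE; case: ifP.
Qed.

Lemma cintegrable_cut D f : measurable D -> cintegrable f -> cintegrable (cut D f).
Proof.
move=> mD fi; apply: (cintegrable_le _ (integrable_normc fi)).
  by apply: cmeas_cut => //; case: fi.
by move=> x; exact: normc_cut_le.
Qed.

Lemma energy_ge0 f : 0 <= energy f.
Proof. by apply: integral_ge0 => x _; rewrite lee_fin sqr_ge0. Qed.

Lemma L2normTE f : L2norm setT f = 'N[mu]_2%:E[EFin \o (normc \o f)].
Proof. by rewrite /L2norm patch_setT. Qed.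

Lemma L2norm_cut D f : L2norm D f = L2norm setT (cut D f).
Proof.
rewrite L2normTE /L2norm; congr ('N[mu]_2%:E[EFin \o _]); apply/funext => x /=.
by rewrite patchE cutE; case: ifP; rewrite ?normc_zero.
Qed.

Lemma L2normE f : L2norm setT f = sqrte (energy f).
Proof.
rewrite L2normTE unlock -poweR12_sqrt ?energy_ge0//; congr (_ `^ _).
apply: eq_integral => x _ /=.
by rewrite ger0_norm ?normc_ge0// powR_mulrn ?normc_ge0.
Qed.

Lemma L2norm_sqr f : L2norm setT f ^+ 2 = energy f.
Proof. by rewrite L2normE sqr_sqrte ?energy_ge0. Qed.

Lemma L2norm_ge0 D f : 0 <= L2norm D f.
Proof. by rewrite L2norm_cut L2normE sqrte_ge0. Qed.

Lemma le_L2norm_energy f g : (L2norm setT f <= L2norm setT g) = (energy f <= energy g).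
Proof. by rewrite !L2normE lee_sqrt ?energy_ge0. Qed.

Lemma L2norm_leP f (k : R) : (0 <= k)%R ->
  (L2norm setT f <= k%:E) = (energy f <= (k ^+ 2)%:E).
Proof.
move=> k0; rewrite L2normE -[k in LHS]ger0_norm// -abse_EFin -sqrte_sqr.
by rewrite lee_sqrt// -EFin_expe lee_fin sqr_ge0.
Qed.

Lemma L2norm_fin f : (L2norm setT f < +oo) = (energy f < +oo).
Proof.
rewrite -!ge0_fin_numE ?L2norm_ge0 ?energy_ge0//.
by rewrite L2normE sqrte_fin_num ?energy_ge0.
Qed.

Lemma measurable_energy f : cmeas f ->
  measurable_fun setT (fun x => (normc (f x) ^+ 2)%:E).
Proof. by move=> mf; apply/measurable_EFinP; exact: measurable_normc_sqr. Qed.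

Lemma energy_le_ae f g : cmeas f -> cmeas g ->
  {ae mu, forall x, (normc (f x) <= normc (g x))%R} -> energy f <= energy g.
Proof.
move=> mf mg fg; apply: ae_ge0_le_integral => //.
- by move=> x _; rewrite lee_fin sqr_ge0.
- exact: measurable_energy.
- by move=> x _; rewrite lee_fin sqr_ge0.
- exact: measurable_energy.
- apply: ae_imply fg => x fg _.
  by rewrite lee_fin ler_pXn2r// nnegrE normc_ge0.
Qed.

Lemma energy_le f g : cmeas f -> cmeas g ->
  (forall x, (normc (f x) <= normc (g x))%R) -> energy f <= energy g.
Proof. by move=> mf mg fg; apply: energy_le_ae => //; exact: aeW. Qed.

Lemma eq_energy f g : (forall x, normc (f x) = normc (g x)) -> energy f = energy g.
Proof. by move=> fg; apply: eq_integral => x _; rewrite fg. Qed.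

Lemma L2norm_le_ae f g : cmeas f -> cmeas g ->
  {ae mu, forall x, (normc (f x) <= normc (g x))%R} ->
  L2norm setT f <= L2norm setT g.
Proof. by move=> mf mg fg; rewrite le_L2norm_energy energy_le_ae. Qed.

Lemma L2norm_le f g : cmeas f -> cmeas g ->
  (forall x, (normc (f x) <= normc (g x))%R) -> L2norm setT f <= L2norm setT g.
Proof. by move=> mf mg fg; rewrite le_L2norm_energy energy_le. Qed.

Lemma eq_L2norm f g : (forall x, normc (f x) = normc (g x)) ->
  L2norm setT f = L2norm setT g.
Proof. by move=> fg; rewrite !L2normE (eq_energy fg). Qed.

Lemma L2norm_sub f g : L2norm setT (fun x => f x - g x)%R = L2norm setT (fun x => g x - f x)%R.
Proof. by apply: eq_L2norm => x; rewrite normc_sub. Qed.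

Lemma L2normD f g : cmeas f -> cmeas g ->
  L2norm setT (fun x => f x + g x)%R <= L2norm setT f + L2norm setT g.
Proof.
move=> mf mg.
have := minkowski_EFin mu (measurable_normc mf) (measurable_normc mg) (ler1n R 2).
rewrite -!L2normTE; apply: le_trans.
pose s x : R[i] := (normc (f x) + normc (g x))%:C.
have sE : normc \o s = ((fun x => normc (f x)) \+ (fun x => normc (g x)))%R.
  by apply/funext => x; rewrite /comp /s normc_real ger0_norm// addr_ge0 ?normc_ge0.
rewrite -sE -L2normTE; apply: L2norm_le.
- exact: cmeasD.
- by apply: cmeas_real; apply: measurable_funD; exact: measurable_normc.
- by move=> x; rewrite -[leRHS]/((normc \o s) x) sE normcD_le.
Qed.

Lemma L2normB f g : cmeas f -> cmeas g ->
  L2norm setT (fun x => f x - g x)%R <= L2norm setT f + L2norm setT g.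
Proof.
move=> mf mg; rewrite -(@eq_L2norm (fun x => - g x)%R g); last by move=> x; rewrite normc_opp.
by apply: L2normD => //; exact: cmeasN.
Qed.

Lemma L2norm_tri f g k : cmeas f -> cmeas g -> cmeas k ->
  L2norm setT (fun x => f x - k x)%R <=
  L2norm setT (fun x => f x - g x)%R + L2norm setT (fun x => g x - k x)%R.
Proof.
move=> mf mg mk; apply: le_trans (L2normD _ _); [|exact: cmeasB|exact: cmeasB].
rewrite le_eqVlt; apply/orP; left; apply/eqP; apply: eq_L2norm => x; congr (normc _).
by ring.
Qed.

Lemma L2normZ (c : R[i]) f : cmeas f ->
  L2norm setT (fun x => c * f x)%R = (normc c)%:E * L2norm setT f.
Proof.
move=> mf; rewrite !L2normE.
have -> : energy (fun x => c * f x)%R = ((normc c) ^+ 2)%:E * energy f :> \bar R.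
  rewrite -ge0_integralZl_EFin ?sqr_ge0//; last 2 first.
  - by move=> x _; rewrite lee_fin sqr_ge0.
  - exact: measurable_energy.
  by apply: eq_integral => x _; rewrite Normc.normcM exprMn.
rewrite sqrteM ?lee_fin ?sqr_ge0//.
by rewrite [sqrte _%:E]/= sqrtr_sqr ger0_norm ?normc_ge0.
Qed.

Lemma cauchy_schwarz f g : cmeas f -> cmeas g ->
  \int[mu]_x (normc (f x) * normc (g x))%:E <= L2norm setT f * L2norm setT g.
Proof.
move=> mf mg.
have := hoelder mu (measurable_normc mf) (measurable_normc mg) (ltr0n R 2) (ltr0n R 2).
rewrite -!L2normTE => /(_ _)/(le_trans _); apply; last by lra.
rewrite Lnorm1 le_eqVlt; apply/orP; left; apply/eqP.
by apply: eq_integral => x _ /=; rewrite ger0_norm// mulr_ge0 ?normc_ge0.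
Qed.

Lemma cintegrableM f g : cmeas f -> cmeas g ->
  L2norm setT f < +oo -> L2norm setT g < +oo -> cintegrable (fun x => f x * g x)%R.
Proof.
move=> mf mg fy gy; split; first exact: cmeasM.
under eq_integral do rewrite Normc.normcM.
apply: le_lt_trans (cauchy_schwarz mf mg) _.
by rewrite lte_mul_pinfty ?L2norm_ge0// ge0_fin_numE ?L2norm_ge0.
Qed.

Lemma cauchy_schwarz_cint f g : cmeas f -> cmeas g ->
  L2norm setT f < +oo -> L2norm setT g < +oo ->
  (normc (cint setT (fun x => f x * g x)%R))%:E <= L2norm setT f * L2norm setT g.
Proof.
move=> mf mg fy gy; apply: le_trans (cauchy_schwarz mf mg).
apply: le_trans (normc_cint_le (cintegrableM mf mg fy gy)) _.
by under eq_integral do rewrite Normc.normcM.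
Qed.

Lemma energy_eq0 f : cmeas f -> L2norm setT f = 0 -> {ae mu, forall x, f x = 0%R}.
Proof.
move=> mf; rewrite L2normTE => /Lnorm_eq0_eq0 => /(_ _ _)/(ae_imply _); apply => //.
- by move=> x /= /(_ I) [] /Normc.eq0_normc.
- exact/measurable_EFinP/measurable_normc.
Qed.

Lemma energy_fatou (f_ : (R -> R[i])^nat) f (K : \bar R) :
  (forall n, cmeas (f_ n)) -> cmeas f ->
  {ae mu, forall x, normc (f_ n x - f x)%R @[n --> \oo] --> (0 : R)%R} ->
  (\forall n \near \oo, energy (f_ n) <= K) -> energy f <= K.
Proof.
move=> mf_ mf f_f f_K.
have [N [mN N0 NP]] := f_f.
have cvgN x : (~` N) x -> normc (f_ n x - f x)%R @[n --> \oo] --> (0 : R)%R.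
  by move=> Nx; apply: contrapT => /NP.
have mCN : measurable (~` N) by exact: measurableC.
have restrict g : cmeas g -> energy g = \int[mu]_(x in ~` N) (normc (g x) ^+ 2)%:E.
  move=> mg; rewrite -setTD; apply: ge0_negligible_integral => //.
  - exact: measurable_energy.
  - by move=> x _; rewrite lee_fin sqr_ge0.
have -> : energy f = \int[mu]_(x in ~` N) limn_einf (fun n => (normc (f_ n x) ^+ 2)%:E).
  rewrite restrict//; apply: eq_integral => x /set_mem Nx; apply/esym.
  apply: (cvg_limn_einf_sup _).1; apply: cvg_EFin; first exact: nearW.
  by rewrite /comp/=; apply: cvgM; apply: cvg_normc; exact: cvgN.
have := @fatou _ _ _ mu _ mCN (fun n x => (normc (f_ n x) ^+ 2)%:E).
move=> /(_ _ _)/le_trans; apply.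
- by move=> n; apply: measurable_funTS; exact: measurable_energy.
- by move=> n x _; rewrite lee_fin sqr_ge0.
rewrite limn_einf_lim; apply: lime_le; first exact: is_cvg_einfs.
case: f_K => n0 _ f_K; near=> m.
apply: (@le_trans _ _ (energy (f_ m))); last by apply: f_K => /=; near: m; exact: nbhs_infty_ge.
by rewrite restrict//; apply: ereal_inf_lbound; exists m => /=.
Unshelve. all: by end_near. Qed.

End square_integrable.

(** * The Fourier transform of an integrable function *)

Section fourier_L1.
Context {R : realType}.
Local Notation mu := (@lebesgue_measure R).
Local Notation Re := (@complex.Re R).
Local Notation Im := (@complex.Im R).
Local Notation normc := (@Normc.normc R).
Implicit Types (f g : R -> R[i]) (D : set R).

Definition ft f : R -> R[i] := fourier_integral setT f.

Definition ft_cst : R := (Num.sqrt (2 * pi))^-1.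

Lemma ft_cst_gt0 : 0 < ft_cst.
Proof. by rewrite invr_gt0 sqrtr_gt0 mulr_gt0// pi_gt0. Qed.

Lemma ft_cst_sqr : ft_cst * ft_cst = (2 * pi)^-1.
Proof. by rewrite -invfM -expr2 sqr_sqrtr// mulr_ge0// pi_ge0. Qed.

Lemma ftE f y : ft f y = ft_cst%:C * cint setT (fun x => cis (- (x * y)) * f x).
Proof. by []. Qed.

Lemma cintegrable_cis (h : R -> R) f : measurable_fun setT h -> cintegrable f ->
  cintegrable (fun x => cis (h x) * f x).
Proof.
move=> mh; apply: (@cintegrable_bounded_mul _ _ _ 1); first exact: cmeas_cis.
by move=> x; rewrite normc_cis.
Qed.

Lemma cintegrable_ft_kernel f y : cintegrable f ->
  cintegrable (fun x => cis (- (x * y)) * f x).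
Proof. by apply: cintegrable_cis; apply: measurableT_comp => //; exact: measurable_funM. Qed.

Lemma ft_cut D f : ft (cut D f) = fourier_integral D f.
Proof.
apply/funext => y; rewrite /ft /fourier_integral -[cint D _]cint_cut; congr (_ * _).
by apply: eq_cint => x; rewrite /cut; ring.
Qed.

Lemma ftD f g y : cintegrable f -> cintegrable g ->
  ft (fun x => f x + g x) y = ft f y + ft g y.
Proof.
move=> fi gi; have fyi := cintegrable_ft_kernel y fi; have gyi := cintegrable_ft_kernel y gi.
rewrite !ftE -mulrDr -cintD//.
by congr (_ * _); apply: eq_cint => x; rewrite mulrDr.
Qed.

Lemma ftZ (c : R[i]) f y : cintegrable f -> ft (fun x => c * f x) y = c * ft f y.
Proof.
move=> fi; rewrite !ftE mulrCA -(cintZ c); last exact: cintegrable_ft_kernel.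
by congr (_ * _); apply: eq_cint => x; rewrite mulrCA.
Qed.

Lemma ftB f g y : cintegrable f -> cintegrable g ->
  ft (fun x => f x - g x) y = ft f y - ft g y.
Proof.
move=> fi gi; rewrite ftD//; last exact: cintegrableN.
congr (_ + _); have := ftZ (-1) y gi; rewrite (mulN1r (ft g y)) => <-; congr (ft _ y).
by apply/funext => x; rewrite (mulN1r (g x)).
Qed.

Lemma ft_conj f y : cintegrable f -> conjc (ft f y) = ft (fun x => conjc (f x)) (- y).
Proof.
move=> fi; rewrite !ftE conjM conj_real -cint_conj; last exact: cintegrable_ft_kernel.
congr (_ * _); apply: eq_cint => x; rewrite conjM cis_conj.
by rewrite mulrN.
Qed.

Lemma ft_dominated f g y : cintegrable f -> cintegrable g ->
  (forall x, normc (f x) <= normc (g x)) ->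
  normc (ft f y) <= ft_cst * fine (\int[mu]_x (normc (g x))%:E).
Proof.
move=> fi gi fg; rewrite ftE Normc.normcM normc_real gtr0_norm ?ft_cst_gt0//.
apply: ler_wpM2l; first exact: ltW ft_cst_gt0.
rewrite -lee_fin fineK; last exact: integrable_fin_num (integrable_normc gi).
apply: le_trans (normc_cint_le (cintegrable_ft_kernel _ fi)) _.
under eq_integral do rewrite Normc.normcM normc_cis mul1r.
apply: ge0_le_integral => //.
- by move=> x _; rewrite lee_fin normc_ge0.
- by apply/measurable_EFinP/measurable_normc; case: fi.
- by apply/measurable_EFinP/measurable_normc; case: gi.
- by move=> x _; rewrite lee_fin.
Qed.

Lemma ft_bounded f : cintegrable f -> exists M, forall y, normc (ft f y) <= M.
Proof. by move=> fi; eexists => y; exact: (ft_dominated y fi fi (fun=> lexx _)). Qed.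

Lemma continuous_cis_seq (a : nat -> R) (l : R) : a n @[n --> \oo] --> l ->
  normc (cis (a n) - cis l) @[n --> \oo] --> 0.
Proof.
move=> al; apply: (@squeeze_cvgr _ _ _ _ (cst 0) (fun n => `|cos (a n) - cos l| + `|sin (a n) - sin l|)).
- apply: nearW => n; apply/andP; split; first exact: normc_ge0.
  apply: le_trans (normc_le_ReIm _) _.
  by rewrite !ReD !ImD ReN ImN !cisE.
- exact: cvg_cst.
- rewrite -[X in _ --> X]addr0; apply: cvgD.
    apply/norm_cvg0P; apply/subr_cvg0.
    exact: (continuous_cvg _ (@continuous_cos R l)).
  apply/norm_cvg0P; apply/subr_cvg0.
  exact: (continuous_cvg _ (@continuous_sin R l)).
Qed.

Lemma ft_cvg_seq f (a : nat -> R) (l : R) : cintegrable f -> a n @[n --> \oo] --> l ->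
  normc (ft f (a n) - ft f l) @[n --> \oo] --> 0.
Proof.
move=> fi al.
rewrite (_ : (fun n => _) = (fun n => ft_cst * normc
   (cint setT (fun x => cis (- (x * a n)) * f x) -
    cint setT (fun x => cis (- (x * l)) * f x)))); last first.
  apply/funext => n; rewrite !ftE -mulrBr Normc.normcM normc_real.
  by rewrite gtr0_norm// ft_cst_gt0.
rewrite -[X in _ --> X](mulr0 ft_cst); apply: cvgMl_tmp.
apply: (@cint_dominated _ _ _ (fun x => normc (f x))).
- by move=> n; have [] := cintegrable_ft_kernel (a n) fi.
- by have [] := cintegrable_ft_kernel l fi.
- apply: aeW => x.
  rewrite (_ : (fun n => _) = (fun n => normc (cis (- (x * a n)) - cis (- (x * l))) * normc (f x))); last first.
    by apply/funext => n; rewrite -mulrBl Normc.normcM.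
  rewrite -[X in _ --> X](mul0r (normc (f x))); apply: cvgMr_tmp.
  by apply: continuous_cis_seq; apply: cvgN; exact: cvgMl_tmp.
- exact: integrable_normc.
- by move=> n x; rewrite Normc.normcM normc_cis mul1r.
- by move=> x; rewrite Normc.normcM normc_cis mul1r.
Qed.

Lemma normc_cvg_Re (u : nat -> R[i]) (l : R[i]) : normc (u n - l) @[n --> \oo] --> 0 ->
  Re (u n) @[n --> \oo] --> Re l.
Proof.
move=> ul; apply/subr_cvg0; apply/norm_cvg0P.
apply: (squeeze_cvgr _ (@cvg_cst _ 0 _ _ _) ul); apply: nearW => n.
by rewrite normr_ge0 -ReN -ReD Re_le_normc.
Qed.

Lemma normc_cvg_Im (u : nat -> R[i]) (l : R[i]) : normc (u n - l) @[n --> \oo] --> 0 ->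
  Im (u n) @[n --> \oo] --> Im l.
Proof.
move=> ul; apply/subr_cvg0; apply/norm_cvg0P.
apply: (squeeze_cvgr _ (@cvg_cst _ 0 _ _ _) ul); apply: nearW => n.
by rewrite normr_ge0 -ImN -ImD Im_le_normc.
Qed.

Lemma ccontinuous_ft f : cintegrable f -> ccontinuous (ft f).
Proof.
move=> fi; split => y; apply/(@cvg_nbhsP _ R^o) => a al.
  exact: normc_cvg_Re (ft_cvg_seq fi al).
exact: normc_cvg_Im (ft_cvg_seq fi al).
Qed.

Lemma ccontinuous_cmeas f : ccontinuous f -> cmeas f.
Proof. by move=> [f1 f2]; split; exact: continuous_measurable_fun. Qed.

Lemma cmeas_ft f : cintegrable f -> cmeas (ft f).
Proof. by move=> fi; exact/ccontinuous_cmeas/ccontinuous_ft. Qed.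

Lemma cmeas_fst f : cmeas f -> cmeas (fun z : R * R => f z.1).
Proof. by move=> mf; exact: (cmeas_comp mf measurable_fst). Qed.

Lemma cmeas_snd f : cmeas f -> cmeas (fun z : R * R => f z.2).
Proof. by move=> mf; exact: (cmeas_comp mf measurable_snd). Qed.

Lemma tonelli_prod f g : cintegrable f -> cintegrable g ->
  (\int[mu]_x \int[mu]_y (normc (f x) * normc (g y))%:E < +oo)%E.
Proof.
move=> fi gi; under eq_integral => x _.
  under eq_integral do rewrite EFinM.
  rewrite ge0_integralZl//; last 3 first.
  - exact/measurable_EFinP/measurable_normc/(proj1 gi).
  - by move=> y _; rewrite lee_fin normc_ge0.
  - by rewrite lee_fin normc_ge0.
  over.
rewrite ge0_integralZr//; last 3 first.
- exact/measurable_EFinP/measurable_normc/(proj1 fi).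
- by move=> y _; rewrite lee_fin normc_ge0.
- by apply: integral_ge0 => y _; rewrite lee_fin normc_ge0.
by rewrite lte_mul_pinfty//; [apply: integral_ge0 => y _; rewrite lee_fin normc_ge0
  |exact: integrable_fin_num (integrable_normc fi)|case: gi].
Qed.

(** The transform is its own transpose, since its kernel is symmetric. *)
Lemma ft_multiplication f g : cintegrable f -> cintegrable g ->
  cint setT (fun y => ft f y * g y) = cint setT (fun x => f x * ft g x).
Proof.
move=> fi gi; pose F (z : R * R) := cis (- (z.1 * z.2)) * (f z.1 * g z.2).
have mF : cmeas F.
  apply: cmeasM; last by apply: cmeasM; [exact/cmeas_fst/(proj1 fi)|exact/cmeas_snd/(proj1 gi)].
  by apply: cmeas_cis; apply: measurableT_comp => //; apply: measurable_funM.
have F1 x : cintegrable (fun y => F (x, y)).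
  rewrite /F /=; under eq_fun do rewrite mulrCA.
  apply: cintegrableZ; under eq_fun do rewrite mulrC [x * _]mulrC mulrC.
  exact: cintegrable_ft_kernel.
have F2 y : cintegrable (fun x => F (x, y)).
  rewrite /F /=; under eq_fun do rewrite mulrA mulrC.
  by apply: cintegrableZ; exact: cintegrable_ft_kernel.
have k0 : (ft_cst%:C : R[i]) != 0.
  by rewrite eq_complex /= eqxx andbT gt_eqF// ft_cst_gt0.
have fgi : cintegrable (fun y => ft f y * g y).
  have [M fM] := ft_bounded fi.
  by apply: (cintegrable_bounded_mul _ fM) => //; exact: cmeas_ft.
have gfi : cintegrable (fun x => f x * ft g x).
  have [M gM] := ft_bounded gi; under eq_fun do rewrite mulrC.
  by apply: (cintegrable_bounded_mul _ gM) => //; exact: cmeas_ft.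
apply: (mulfI (invr_neq0 k0)); rewrite -!cintZ//.
transitivity (cint setT (fun y => cint setT (fun x => F (x, y)))).
  apply: eq_cint => y; rewrite ftE -mulrA mulKf// mulrC -cintZ; last exact: cintegrable_ft_kernel.
  by apply: eq_cint => x; rewrite /F/=; ring.
rewrite -(cint_fubini mF _ F1 F2); last first.
  apply: le_lt_trans (tonelli_prod fi gi).
  rewrite le_eqVlt; apply/orP; left; apply/eqP.
  by apply: eq_integral => x _; apply: eq_integral => y _;
    rewrite /F Normc.normcM normc_cis mul1r Normc.normcM.
apply: eq_cint => x; rewrite ftE mulrCA mulKf// -cintZ; last exact: cintegrable_ft_kernel.
by apply: eq_cint => y; rewrite /F/= [x * y]mulrC; ring.
Qed.

End fourier_L1.

(** * The Poisson kernel *)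

Section real_integrals.
Context {R : realType}.
Local Notation mu := (@lebesgue_measure R).
Implicit Types f F : R -> R.

Lemma integral_reflect (f : R -> \bar R) : measurable_fun setT f -> (forall x, 0 <= f x)%E ->
  (\int[mu]_x f (- x)%R = \int[mu]_x f x)%E.
Proof.
move=> mf f0.
transitivity (\int[pushforward mu (-%R : R -> measurableTypeR R)]_y f y)%E.
  by rewrite ge0_integral_pushforward.
by apply: eq_measure_integral => //= A mA _; exact: lebesgue_measureN.
Qed.

Lemma integral_translate (c : R) (f : R -> \bar R) : measurable_fun setT f ->
  (forall x, 0 <= f x)%E -> (\int[mu]_x f (x + c)%R = \int[mu]_x f x)%E.
Proof.
move=> mf f0; pose phi : R -> measurableTypeR R := fun x => x + c.
have mphi : measurable_fun setT phi by exact: measurable_funD.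
pose phim : {mfun R >-> measurableTypeR R} := HB.pack phi (isMeasurableFun.Build _ _ _ _ phi mphi).
transitivity (\int[pushforward mu phim]_y f y)%E.
  by rewrite ge0_integral_pushforward.
apply: eq_measure_integral => /= A mA _; apply/esym/lebesgue_measure_unique => //= _ [[a b]] _ <-.
rewrite /pushforward (_ : _ @^-1` _ = `]a - c, b - c]%classic).
  by rewrite !lebesgue_measure_itv/= !lte_fin ltrD2r -!EFinB opprB addrA subrK.
by apply/seteqP; split => x /=; rewrite !in_itv/= ltrBlDr lerBrDr.
Qed.

Lemma ftc_segment F f (a b : R) : a < b -> continuous f ->
  (forall x : R, is_derive x 1 F (f x)) ->
  (\int[mu]_(x in `[a, b]) (f x)%:E = (F b - F a)%:E)%E.
Proof.
move=> ab cf dF; have cF : continuous F.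
  move=> x; have [dx _] := dF x.
  by apply: differentiable_continuous; exact/derivable1_diffP.
rewrite (continuous_FTC2 ab (F := F))//.
- exact: continuous_subspaceT.
- split.
  + by move=> x _; have [] := dF x.
  + by apply: cvg_at_right_filter; exact: cF.
  + by apply: cvg_at_left_filter; exact: cF.
- by move=> x _; rewrite derive1E; have [_ ->] := dF x.
Qed.

Lemma ftc_even F f (l : R) : (forall x, 0 <= f x) -> continuous f -> f =1 f \o -%R ->
  (forall x : R, 0 < x -> is_derive x 1 F (f x)) -> F x @[x --> 0^'+] --> F 0 ->
  F x @[x --> +oo] --> l ->
  (\int[mu]_x (f x)%:E = (2 * (l - F 0))%:E)%E.
Proof.
move=> f0 cf fe dF cF Fl.
rewrite ge0_symfun_integralT// -set_itvcy EFinM; congr (_ * _)%E.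
rewrite (ge0_continuous_FTC2y _ _ Fl)//.
- exact: continuous_subspaceT.
- by move=> x x0; have [] := dF x x0.
- by move=> x; rewrite in_itv/= andbT => x0; rewrite derive1E; case: (dF x x0).
Qed.

End real_integrals.

Section poisson_kernel.
Context {R : realType}.
Local Notation mu := (@lebesgue_measure R).
Implicit Types (d c x y : R).

(** Abel's summation factor, whose transform is the Poisson kernel. *)
Definition abel d x : R := expR (- (d * `|x|)).

Definition poisson d x : R := d / (pi * (d ^+ 2 + x ^+ 2)).

Lemma abel_gt0 d x : 0 < abel d x. Proof. exact: expR_gt0. Qed.

Lemma abel_le1 d x : 0 <= d -> abel d x <= 1.
Proof. by move=> d0; rewrite -expR0 ler_expR oppr_le0 mulr_ge0. Qed.

Lemma continuous_abel d : continuous (abel d).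
Proof.
move=> x; apply: (@continuous_comp _ _ _ (fun x => - (d * `|x|)) expR).
  by apply: cvgN; apply: cvgMl_tmp; exact: norm_continuous.
exact: continuous_expR.
Qed.

Lemma measurable_abel d : measurable_fun setT (abel d).
Proof. by apply: continuous_measurable_fun; exact: continuous_abel. Qed.

Lemma sqD_gt0 d x : 0 < d -> 0 < d ^+ 2 + x ^+ 2.
Proof. by move=> d0; apply: ltr_pwDl; [exact: exprn_gt0|exact: sqr_ge0]. Qed.

Lemma poisson_ge0 d x : 0 < d -> 0 <= poisson d x.
Proof. by move=> d0; apply: divr_ge0; [exact: ltW|by apply: mulr_ge0; [exact: pi_ge0|exact/ltW/sqD_gt0]]. Qed.

Lemma poissonN d x : poisson d (- x) = poisson d x.
Proof. by rewrite /poisson sqrrN. Qed.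

Lemma cvg_expRM0 d : 0 < d -> expR (- (d * x)) @[x --> +oo] --> 0.
Proof.
move=> d0; apply: (cvg_comp _ _ _ (@cvgr_expR R)).
exact: gt0_cvgMry.
Qed.

(* A primitive on [0, +oo[ of the nonnegative function abel d x * (1 + cos (c * x)) *)
Let prim d c x : R := expR (- (d * x)) *
  ((c * sin (c * x) - d * cos (c * x)) / (d ^+ 2 + c ^+ 2) - d^-1).

(** Adding 1 to the cosine makes the integrand nonnegative, as is required by the
    fundamental theorem of calculus on a half-line. *)
Lemma integral_abel_cos1 d c : 0 < d ->
  (\int[mu]_x (abel d x * (1 + cos (c * x)))%:E =
   (2 * (d^-1 + d / (d ^+ 2 + c ^+ 2)))%:E)%E.
Proof.
move=> d0; have s0 := sqD_gt0 c d0.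
transitivity ((2 * (0 - prim d c 0))%:E); last first.
  congr (_%:E); rewrite /prim !mulr0 oppr0 expR0 sin0 cos0; field.
  by rewrite !gt_eqF.
apply: ftc_even.
- move=> x; apply: mulr_ge0; first exact/ltW/abel_gt0.
  by have := cos_geN1 (c * x); lra.
- move=> x; apply: cvgM; first exact: continuous_abel.
  apply: cvgD; first exact: cvg_cst.
  apply: (@continuous_comp _ _ _ (fun x => c * x) cos); last exact: continuous_cos.
  by apply: cvgMl_tmp.
- by move=> x; rewrite /abel /= normrN mulrN cosN.
- move=> x x0; rewrite /prim.
  apply: is_derive_eq.
  rewrite /abel gtr0_norm// /GRing.scale/=; field.
  by rewrite !gt_eqF.
- apply: cvg_at_right_filter.
  have : derivable (prim d c) 0 1 by rewrite /prim; exact: ex_derive.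
  by move/derivable1_diffP/differentiable_continuous.
- pose M := (`|c| + d) / (d ^+ 2 + c ^+ 2) + d^-1.
  have E0 : M * expR (- (d * x)) @[x --> +oo] --> 0.
    by rewrite -[X in _ --> X](mulr0 M); apply: cvgMl_tmp; exact: cvg_expRM0.
  apply/norm_cvg0P; apply: squeeze_cvgr (@cvg_cst _ 0 _ _ _) E0.
  apply: nearW => x; rewrite normr_ge0/= /prim normrM gtr0_norm ?expR_gt0// mulrC.
  apply: ler_wpM2r; first exact: expR_ge0.
  apply: (le_trans (ler_normB _ _)); apply: lerD; last by rewrite ger0_norm ?invr_ge0// ltW.
  rewrite normrM [X in _ * X]gtr0_norm ?invr_gt0// ler_pM2r ?invr_gt0//.
  apply: (le_trans (ler_normB _ _)); rewrite !normrM (gtr0_norm d0).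
  apply: lerD.
    by rewrite ler_piMr// ler_norml sin_geN1 sin_le1.
  by rewrite ler_piMr ?(ltW d0)// ler_norml cos_geN1 cos_le1.
Qed.

Lemma measurable_abelM d (f : R -> R) : continuous f ->
  measurable_fun setT (fun x => (abel d x * f x)%:E).
Proof.
move=> cf; apply/measurable_EFinP; apply: measurable_funM; first exact: measurable_abel.
exact: continuous_measurable_fun.
Qed.

Lemma integral_abel d : 0 < d -> (\int[mu]_x (abel d x)%:E = (2 / d)%:E)%E.
Proof.
move=> d0; have := integral_abel_cos1 0 d0.
have -> : (\int[mu]_x (abel d x * (1 + cos (0 * x)))%:E = 2%:E * \int[mu]_x (abel d x)%:E)%E.
  rewrite -ge0_integralZl_EFin//; last first.
  - by apply/measurable_EFinP; exact: measurable_abel.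
  - by move=> x _; rewrite lee_fin ltW ?abel_gt0.
  by apply: eq_integral => x _; rewrite mul0r cos0 -EFinM; congr EFin; ring.
move=> /(congr1 (fun z => 2^-1%:E * z)%E); rewrite muleA -!EFinM mulVf ?mul1e//.
by move=> ->; congr EFin; field; exact: lt0r_neq0.
Qed.

Lemma integrable_abel d : 0 < d -> mu.-integrable setT (EFin \o abel d).
Proof.
move=> d0; apply/integrableP; split; first by apply/measurable_EFinP; exact: measurable_abel.
under eq_integral do rewrite /= ger0_norm ?(ltW (abel_gt0 _ _))//.
by rewrite integral_abel// ltry.
Qed.

Lemma cintegrable_abel d (f : R -> R) : 0 < d -> measurable_fun setT f ->
  cintegrable (fun x => cis (f x) * (abel d x)%:C).
Proof.
move=> d0 mf; apply: cintegrable_cis => //.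
apply: (cintegrable_le _ (integrable_abel d0)).
  by apply: cmeas_real; exact: measurable_abel.
by move=> x; rewrite normc_real gtr0_norm ?abel_gt0.
Qed.

(** The imaginary part of the integrand is odd. *)
Lemma cint_abel d c : 0 < d ->
  cint setT (fun x => cis (c * x) * (abel d x)%:C) = (2 * d / (d ^+ 2 + c ^+ 2))%:C.
Proof.
move=> d0; have s0 := sqD_gt0 c d0.
have ai := integrable_abel d0.
have mc : measurable_fun setT (fun x => c * x) by exact: measurable_funM.
have ci := cintegrable_abel d0 mc.
have Ri := integrable_Re ci; have Ii := integrable_Im ci.
have ReE x : complex.Re (cis (c * x) * (abel d x)%:C) = abel d x * cos (c * x).
  by rewrite ReM cisE /= mulr0 subr0 mulrC.
have ImE x : complex.Im (cis (c * x) * (abel d x)%:C) = abel d x * sin (c * x).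
  by rewrite ImM cisE /= mulr0 add0r mulrC.
have dC : 2 * (d^-1 + d / (d ^+ 2 + c ^+ 2)) = 2 / d + 2 * d / (d ^+ 2 + c ^+ 2).
  by ring.
apply: complexP; rewrite /=.
- have h : (\int[mu]_x (abel d x)%:E +
      \int[mu]_x (complex.Re (cis (c * x) * (abel d x)%:C))%:E =
      (2 / d + 2 * d / (d ^+ 2 + c ^+ 2))%:E)%E.
    rewrite -dC -integral_abel_cos1// -integralD//.
    by apply: eq_integral => x _; rewrite ReE -EFinD mulrDr mulr1.
  move: h; rewrite integral_abel// -[X in (_ + X)%E]fineK; last exact: integrable_fin_num Ri.
  by rewrite -EFinD => -[] /addrI.
- have sin0E : (\int[mu]_x (abel d x * (1 + sin (c * x)))%:E =
     \int[mu]_x (abel d x * (1 - sin (c * x)))%:E)%E.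
    rewrite -integral_reflect.
    + by apply: eq_integral => x _; rewrite /abel normrN mulrN sinN.
    + apply: measurable_abelM => x; apply: cvgD; first exact: cvg_cst.
      apply: (@continuous_comp _ _ _ (fun x => c * x) sin); last exact: continuous_sin.
      by apply: cvgMl_tmp.
    + move=> x; rewrite lee_fin; apply: mulr_ge0; first exact/ltW/abel_gt0.
      by have := sin_geN1 (c * x); lra.
  have h : (\int[mu]_x (abel d x)%:E +
      \int[mu]_x (complex.Im (cis (c * x) * (abel d x)%:C))%:E =
      \int[mu]_x (abel d x)%:E -
      \int[mu]_x (complex.Im (cis (c * x) * (abel d x)%:C))%:E)%E.
    rewrite -integralD// -integralB//.
    transitivity (\int[mu]_x (abel d x * (1 + sin (c * x)))%:E)%E.
      by apply: eq_integral => x _; rewrite ImE -EFinD mulrDr mulr1.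
    by rewrite sin0E; apply: eq_integral => x _; rewrite ImE -EFinB mulrBr mulr1.
  move: h; rewrite integral_abel// -[X in (_ + X)%E]fineK; last exact: integrable_fin_num Ii.
  rewrite -[X in (_ - X)%E]fineK; last exact: integrable_fin_num Ii.
  by rewrite -EFinD -EFinB => -[] /addrI h; rewrite /Rintegral; lra.
Qed.

Lemma ft_abel_cis d x y : 0 < d ->
  ft (fun xi => cis (x * xi) * (abel d xi)%:C) y =
  (2 * pi * ft_cst * poisson d (x - y))%:C.
Proof.
move=> d0; have mc z : measurable_fun setT (fun xi : R => z * xi) by exact: measurable_funM.
rewrite ftE.
have -> : cint setT (fun xi => cis (- (xi * y)) * (cis (x * xi) * (abel d xi)%:C)) =
    cint setT (fun xi => cis ((x - y) * xi) * (abel d xi)%:C).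
  by apply: eq_cint => xi; rewrite mulrA -cisD; congr (cis _ * _); ring.
rewrite cint_abel// -rmorphM; congr (_%:C); rewrite /poisson.
have := @pi_gt0 R; move: pi => p p0; field.
by rewrite (gt_eqF p0) gt_eqF ?sqD_gt0.
Qed.

Lemma continuous_poisson d : 0 < d -> continuous (poisson d).
Proof.
move=> d0 x; apply: cvgMl_tmp; apply: cvgV.
  by rewrite gt_eqF// mulr_gt0 ?pi_gt0// sqD_gt0.
by apply: cvgMl_tmp; apply: cvgD; [exact: cvg_cst|exact: exprn_continuous].
Qed.

Lemma integral_poisson d c : 0 < d -> (\int[mu]_x (poisson d (x + c))%:E = 1)%E.
Proof.
move=> d0.
have cp := continuous_poisson d0.
rewrite (@integral_translate _ c (fun x => (poisson d x)%:E)); last 2 first.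
- by apply/measurable_EFinP; exact: continuous_measurable_fun.
- by move=> x; rewrite lee_fin poisson_ge0.
transitivity ((2 * (2^-1 - (pi^-1 * atan (d^-1 * (0 : R))))%R)%:E).
  apply: (@ftc_even _ (fun x => pi^-1 * atan (d^-1 * x))) => //.
  - by move=> x; exact: poisson_ge0.
  - by move=> x; rewrite /= poissonN.
  - move=> x x0; apply: is_derive_eq.
    rewrite /poisson /GRing.scale/=.
    have := @pi_gt0 R; move: pi => p p0; field.
    by rewrite (gt_eqF p0) (gt_eqF d0) !gt_eqF// sqD_gt0.
  - apply: cvg_at_right_filter.
    have : derivable (fun x => pi^-1 * atan (d^-1 * x)) 0 1 by exact: ex_derive.
    by move/derivable1_diffP/differentiable_continuous.
  - have -> : 2^-1 = pi^-1 * (pi / 2) :> R.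
      by rewrite mulrA mulVf ?mul1r// gt_eqF// pi_gt0.
    apply: cvgMl_tmp; apply: (cvg_comp _ _ _ (@cvgy_atan R)).
    by apply: gt0_cvgMry; rewrite ?invr_gt0.
by rewrite mulr0 atan0 mulr0 subr0 divff.
Qed.

(** Integrating the Poisson kernel over an interval gives a harmonic measure, which
    tends to the indicator function of the interval as [d] tends to 0. *)
Lemma integral_poisson_segment d a b y : 0 < d -> a < b ->
  (\int[mu]_(s in `[a, b]) (poisson d (s - y))%:E =
   (pi^-1 * atan (d^-1 * (b - y)) - pi^-1 * atan (d^-1 * (a - y)))%:E)%E.
Proof.
move=> d0 ab; apply: (@ftc_segment _ (fun s => pi^-1 * atan (d^-1 * (s - y)))) => //.
- move=> x; apply: (@continuous_comp _ _ _ (fun s => s - y) (poisson d)).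
    by apply: cvgB => //; exact: cvg_cst.
  exact: continuous_poisson.
- move=> x; apply: is_derive_eq.
  rewrite /poisson /GRing.scale/=.
  have := @pi_gt0 R; move: pi => p p0; field.
  by rewrite (gt_eqF p0) (gt_eqF d0) !gt_eqF// sqD_gt0.
Qed.

End poisson_kernel.

(** * Contractivity of the Fourier transform *)

Section contraction.
Context {R : realType}.
Local Notation mu := (@lebesgue_measure R).
Local Notation Re := (@complex.Re R).
Local Notation normc := (@Normc.normc R).
Implicit Types (f g : R -> R[i]) (d : R).

(* [mu] is explicit below to keep unification away from the alternative
   measurable structures of [R] *)
Lemma tonelli_swap (F : R * R -> \bar R) : measurable_fun setT F -> (forall z, 0 <= F z)%E ->
  (\int[mu]_x \int[mu]_y F (x, y) = \int[mu]_y \int[mu]_x F (x, y))%E.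
Proof. exact: (@fubini_tonelli _ _ _ _ _ mu mu F). Qed.

Lemma tonelli_product (F : R * R -> \bar R) : measurable_fun setT F -> (forall z, 0 <= F z)%E ->
  (\int[mu \x mu]_z F z = \int[mu]_x \int[mu]_y F (x, y))%E.
Proof. exact: (@fubini_tonelli1 _ _ _ _ _ mu mu F). Qed.

Lemma tonelli_measurable (F : R * R -> \bar R) : measurable_fun setT F -> (forall z, 0 <= F z)%E ->
  measurable_fun setT (fun x : R => \int[mu]_y F (x, y))%E.
Proof. exact: (@measurable_fun_fubini_tonelli_F _ _ _ _ _ mu F). Qed.

Definition psmooth d f x : R[i] := cint setT (fun y => (poisson d (x - y))%:C * f y).

Definition abel_mul d f : R -> R[i] := fun xi => (abel d xi)%:C * f xi.

Lemma abel_double d (x : R) : abel (d + d) x = abel d x ^+ 2.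
Proof. by rewrite /abel mulrDl opprD expRD expr2. Qed.

Lemma cmeas_abel_mul d f : cmeas f -> cmeas (abel_mul d f).
Proof. by move=> mf; apply: cmeasM => //; apply: cmeas_real; exact: measurable_abel. Qed.

Lemma normc_abel_mul d f x : normc (abel_mul d f x) = abel d x * normc (f x).
Proof. by rewrite Normc.normcM normc_real gtr0_norm// abel_gt0. Qed.

Lemma normc_abel_mul_le d f x : 0 <= d -> normc (abel_mul d f x) <= normc (f x).
Proof. by move=> d0; rewrite normc_abel_mul ler_piMl ?normc_ge0// abel_le1. Qed.

Lemma cintegrable_abel_mul_bounded d f (M : R) : 0 < d -> cmeas f ->
  (forall x, normc (f x) <= M) -> cintegrable (abel_mul d f).
Proof.
move=> d0 mf fM; rewrite /abel_mul; under eq_fun do rewrite mulrC.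
apply: (cintegrable_bounded_mul mf fM).
apply: (cintegrable_le _ (integrable_abel d0)).
  by apply: cmeas_real; exact: measurable_abel.
by move=> x; rewrite normc_real gtr0_norm ?abel_gt0.
Qed.

Lemma poisson_le d x : 0 < d -> poisson d x <= (pi * d)^-1.
Proof.
move=> d0; rewrite /poisson ler_pdivrMr ?mulr_gt0 ?pi_gt0 ?sqD_gt0//.
have -> : (pi * d)^-1 * (pi * (d ^+ 2 + x ^+ 2)) = d + x ^+ 2 / d.
  have := @pi_gt0 R; move: pi => p p0; field.
  by rewrite (gt_eqF p0) (gt_eqF d0).
by rewrite lerDl divr_ge0 ?sqr_ge0// ltW.
Qed.

Lemma measurable_poisson d : 0 < d -> measurable_fun setT (poisson d).
Proof. by move=> d0; apply: continuous_measurable_fun; exact: continuous_poisson. Qed.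

Lemma measurable_poissonB d x : 0 < d -> measurable_fun setT (fun y : R => poisson d (x - y)).
Proof.
move=> d0; apply: (measurableT_comp (measurable_poisson d0)).
exact: measurable_funB.
Qed.

Lemma measurable_poisson2 d : 0 < d ->
  measurable_fun setT (fun z : R * R => poisson d (z.1 - z.2)).
Proof.
move=> d0; apply: (measurableT_comp (measurable_poisson d0)).
exact: measurable_funB.
Qed.

Lemma cintegrable_poissonM d f x : 0 < d -> cintegrable f ->
  cintegrable (fun y => (poisson d (x - y))%:C * f y).
Proof.
move=> d0; apply: (@cintegrable_bounded_mul _ _ _ (pi * d)^-1).
  by apply: cmeas_real; exact: measurable_poissonB.
by move=> y; rewrite normc_real ger0_norm ?poisson_le ?poisson_ge0.
Qed.

(** Damping [ft f] by [exp (- d |xi|)] before inverting the transform amounts to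
    convolving [f] with the Poisson kernel: the multiplication formula moves the
    transform onto the damping factor, where it is explicit. *)
Lemma ft_abel_mul_ft d f x : 0 < d -> cintegrable f ->
  ft (abel_mul d (ft f)) (- x) = psmooth d f x.
Proof.
move=> d0 fi; pose g xi := cis (x * xi) * (abel d xi)%:C : R[i].
have gi : cintegrable g by apply: cintegrable_abel => //; exact: measurable_funM.
rewrite ftE (@eq_cint _ _ (fun xi => ft f xi * g xi)); last first.
  move=> xi; rewrite /abel_mul /g -mulrN opprK [xi * x]mulrC; ring.
rewrite ft_multiplication// (@eq_cint _ _ (fun y =>
    (2 * pi * ft_cst)%:C * ((poisson d (x - y))%:C * f y))); last first.
  by move=> y; rewrite ft_abel_cis// rmorphM /=; ring.
rewrite cintZ; last exact: cintegrable_poissonM.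
rewrite mulrA -rmorphM [ft_cst * _]mulrCA ft_cst_sqr divff ?mul1r//.
by rewrite mulf_neq0// gt_eqF// pi_gt0.
Qed.

Lemma kernel_column (K : R * R -> R) f : measurable_fun setT K -> (forall z, 0 <= K z) ->
  (forall y, \int[mu]_x (K (x, y))%:E = 1)%E -> cmeas f ->
  (\int[mu]_x \int[mu]_y (K (x, y) * normc (f y) ^+ 2)%:E = energy f)%E.
Proof.
move=> mK K0 K1 mf.
pose F (z : R * R) := (K z * normc (f z.2) ^+ 2)%:E.
have mF : measurable_fun setT F.
  apply/measurable_EFinP; apply: measurable_funM => //.
  exact/measurable_normc_sqr/cmeas_snd.
have F0 z : (0 <= F z)%E by rewrite lee_fin mulr_ge0// sqr_ge0.
rewrite -[LHS]/(\int[mu]_x \int[mu]_y F (x, y))%E (tonelli_swap mF F0); apply: eq_integral => y _; rewrite /F/=.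
under eq_integral do rewrite mulrC EFinM.
rewrite ge0_integralZl_EFin ?sqr_ge0//; last first.
- apply/measurable_EFinP; apply: (measurableT_comp mK).
  by apply: measurable_fun_pair; [exact: measurable_id|exact: measurable_cst].
- by move=> x _; rewrite lee_fin.
by rewrite K1 mule1.
Qed.

(** Schur's test: the Poisson kernel is symmetric and of total mass 1. *)
Lemma poisson_schur d f : 0 < d -> cmeas f ->
  (\int[mu]_x \int[mu]_y (poisson d (x - y) * (normc (f x) * normc (f y)))%:E
    <= energy f)%E.
Proof.
move=> d0 mf.
have mn1 : measurable_fun setT (fun z : R * R => normc (f z.1)).
  exact/measurable_normc/cmeas_fst.
have mn2 : measurable_fun setT (fun z : R * R => normc (f z.2)).
  exact/measurable_normc/cmeas_snd.
have mp := measurable_poisson2 d0.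
pose F (z : R * R) := (poisson d (z.1 - z.2) * (normc (f z.1) * normc (f z.2)))%:E.
pose A (z : R * R) := (poisson d (z.1 - z.2) * normc (f z.1) ^+ 2)%:E.
pose B (z : R * R) := (poisson d (z.1 - z.2) * normc (f z.2) ^+ 2)%:E.
have mF : measurable_fun setT F.
  by apply/measurable_EFinP; apply: measurable_funM => //; apply: measurable_funM.
have mA : measurable_fun setT A.
  by apply/measurable_EFinP; apply: measurable_funM => //; exact: measurable_funX.
have mB : measurable_fun setT B.
  by apply/measurable_EFinP; apply: measurable_funM => //; exact: measurable_funX.
have F0 z : (0 <= F z)%E.
  by rewrite lee_fin mulr_ge0 ?poisson_ge0// mulr_ge0 ?normc_ge0.
have A0 z : (0 <= A z)%E by rewrite lee_fin mulr_ge0 ?poisson_ge0// sqr_ge0.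
have B0 z : (0 <= B z)%E by rewrite lee_fin mulr_ge0 ?poisson_ge0// sqr_ge0.
have BE : (\int[mu]_x \int[mu]_y B (x, y) = energy f)%E.
  have K0 z : 0 <= (fun z : R * R => poisson d (z.1 - z.2)) z by exact: poisson_ge0.
  have K1 y : (\int[mu]_x (poisson d (x - y))%:E = 1)%E by exact: integral_poisson.
  exact: (kernel_column mp K0 K1 mf).
have AE : (\int[mu]_x \int[mu]_y A (x, y) = energy f)%E.
  rewrite (tonelli_swap mA A0).
  have mp' : measurable_fun setT (fun z : R * R => poisson d (z.2 - z.1)).
    by under eq_fun do rewrite -poissonN opprB.
  have K0 z : 0 <= (fun z : R * R => poisson d (z.2 - z.1)) z by exact: poisson_ge0.
  have K1 y : (\int[mu]_x (poisson d (y - x))%:E = 1)%E.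
    by under eq_integral do rewrite -poissonN opprB; exact: integral_poisson.
  exact: (kernel_column mp' K0 K1 mf).
rewrite -[leLHS]/(\int[mu]_x \int[mu]_y F (x, y))%E -(tonelli_product mF)//.
apply: (@le_trans _ _ (\int[(mu \x mu)%E]_z (2^-1%:E * (A z + B z)))%E).
  apply: ge0_le_integral => //.
  - by apply: measurable_funeM; exact: emeasurable_funD.
  - move=> z _; rewrite /A /B -EFinD -EFinM lee_fin -mulrDr [leRHS]mulrCA.
    apply: ler_wpM2l; first exact: poisson_ge0.
    have := sqr_ge0 (normc (f z.1) - normc (f z.2)).
    by rewrite sqrrB; lra.
rewrite ge0_integralZl_EFin//; last first.
- exact: emeasurable_funD.
- by move=> z _; rewrite adde_ge0.
rewrite ge0_integralD// (tonelli_product mA)// (tonelli_product mB)//.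
rewrite -[X in (_ * (X + _))%E]/(\int[mu]_x \int[mu]_y A (x, y))%E AE.
rewrite -[X in (_ * (_ + X))%E]/(\int[mu]_x \int[mu]_y B (x, y))%E BE.
rewrite -[(energy f + energy f)%E]mule2n -mule_natl muleA -EFinM mulVf// mul1e.
exact: lexx.
Qed.

Lemma normc_psmooth_le d f x : 0 < d -> cintegrable f ->
  ((normc (psmooth d f x))%:E <= \int[mu]_y (poisson d (x - y) * normc (f y))%:E)%E.
Proof.
move=> d0 fi; apply: le_trans (normc_cint_le (cintegrable_poissonM x d0 fi)) _.
rewrite le_eqVlt; apply/orP; left; apply/eqP; apply: eq_integral => y _.
by rewrite Normc.normcM normc_real ger0_norm// poisson_ge0.
Qed.

(** The multiplication formula turns the energy of [abel_mul d (ft f)] into the pairing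
    of [f] with [psmooth (d + d) f], to which Schur's test applies. *)
Lemma energy_abel_ft d f : 0 < d -> cintegrable f -> (energy (abel_mul d (ft f)) <= energy f)%E.
Proof.
move=> d0 fi.
have d20 : 0 < d + d by exact: addr_gt0.
have [M fM] := ft_bounded fi.
have mft := cmeas_ft fi.
pose g := abel_mul (d + d) (fun xi => conjc (ft f xi)).
have ai : cintegrable (abel_mul (d + d) (ft f)).
  exact: cintegrable_abel_mul_bounded fM.
have gE xi : g xi = conjc (abel_mul (d + d) (ft f) xi).
  by rewrite /g /abel_mul [RHS]conjM conj_real.
have gi : cintegrable g.
  by rewrite (_ : g = fun xi => conjc (abel_mul (d + d) (ft f) xi));
    [exact: cintegrable_conj|exact/funext].
have ftg x : ft g x = conjc (psmooth (d + d) f x).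
  rewrite -ft_abel_mul_ft// ft_conj// opprK; congr (ft _ x).
  exact/funext.
have fgi : cintegrable (fun y => ft f y * g y).
  exact: cintegrable_bounded_mul fM gi.
have fgE y : ft f y * g y = (normc (abel_mul d (ft f) y) ^+ 2)%:C.
  rewrite gE normc_abel_mul /abel_mul conjM conj_real mulrCA conj_mul_normc -rmorphM.
  by congr (_%:C); rewrite exprMn abel_double.
have EE : (energy (abel_mul d (ft f)) = (complex.Re (cint setT (fun y => ft f y * g y)))%:E)%E.
  transitivity (\int[mu]_y (Re (ft f y * g y))%:E)%E.
    by apply: eq_integral => y _; rewrite fgE.
  by rewrite -[LHS]fineK//; exact: integrable_fin_num (integrable_Re fgi).
rewrite EE ft_multiplication//.
have [N gN] := ft_bounded gi.
have fgi' : cintegrable (fun x => f x * ft g x).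
  under eq_fun do rewrite mulrC.
  by apply: cintegrable_bounded_mul gN _ => //; exact: cmeas_ft.
apply: (@le_trans _ _ (normc (cint setT (fun x => f x * ft g x)))%:E).
  by rewrite lee_fin (le_trans (ler_norm _))// Re_le_normc.
apply: (le_trans (normc_cint_le fgi')).
apply: le_trans (poisson_schur d20 (proj1 fi)).
pose F (z : R * R) := (poisson (d + d) (z.1 - z.2) * (normc (f z.1) * normc (f z.2)))%:E.
have mF : measurable_fun setT F.
  apply/measurable_EFinP; apply: measurable_funM; first exact: measurable_poisson2.
  by apply: measurable_funM; [exact/measurable_normc/cmeas_fst/(proj1 fi)
    |exact/measurable_normc/cmeas_snd/(proj1 fi)].
have F0 z : (0 <= F z)%E.
  by rewrite lee_fin mulr_ge0 ?poisson_ge0// mulr_ge0 ?normc_ge0.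
apply: ge0_le_integral => //.
- by move=> x _; rewrite lee_fin normc_ge0.
- by apply/measurable_EFinP/measurable_normc; case: fgi'.
- exact: (tonelli_measurable mF F0).
move=> x _; rewrite Normc.normcM ftg normc_conj EFinM.
apply: (@le_trans _ _ ((normc (f x))%:E *
    \int[mu]_y (poisson (d + d) (x - y) * normc (f y))%:E)%E).
  by apply: lee_wpmul2l; [rewrite lee_fin normc_ge0|exact: normc_psmooth_le].
rewrite -ge0_integralZl_EFin ?normc_ge0//; last first.
- apply/measurable_EFinP; apply: measurable_funM; first exact: measurable_poissonB.
  exact/measurable_normc/(proj1 fi).
- by move=> y _; rewrite lee_fin mulr_ge0 ?poisson_ge0 ?normc_ge0.
rewrite le_eqVlt; apply/orP; left; apply/eqP; apply: eq_integral => y _.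
by rewrite -EFinM mulrCA.
Qed.

Lemma cvg_abel_mul f x : normc (abel_mul (harmonic n) f x - f x) @[n --> \oo] --> 0.
Proof.
rewrite (_ : (fun n => _) = fun n => `|abel (harmonic n) x - 1| * normc (f x)); last first.
  apply/funext => n; rewrite -normc_real -Normc.normcM; congr (normc _).
  by rewrite /abel_mul rmorphB/= mulrBl mul1r.
rewrite -[X in _ --> X](mul0r (normc (f x))); apply: cvgMr_tmp.
apply/norm_cvg0P; apply/subr_cvg0.
rewrite -[X in _ --> X]expR0; apply: continuous_cvg; first exact: continuous_expR.
rewrite -oppr0 -(mul0r `|x|); apply: cvgN; apply: cvgMr_tmp; exact: cvg_harmonic.
Qed.

(** The inequality half of Plancherel's theorem; the damping is removed by Fatou's
    lemma. *)
Lemma ft_contraction f : cintegrable f -> (energy (ft f) <= energy f)%E.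
Proof.
move=> fi; apply: (@energy_fatou _ (fun n => abel_mul (@harmonic R n) (ft f))).
- by move=> n; apply: cmeas_abel_mul; exact: cmeas_ft.
- exact: cmeas_ft.
- by apply: aeW => x; exact: cvg_abel_mul.
- by apply: nearW => n; apply: energy_abel_ft => //; exact: harmonic_gt0.
Qed.

End contraction.

(** * Local means *)

Section local_means.
Context {R : realType}.
Local Notation mu := (@lebesgue_measure R).
Local Notation Re := (@complex.Re R).
Local Notation Im := (@complex.Im R).
Local Notation normc := (@Normc.normc R).
Implicit Types (f g : R -> R[i]) (r x y : R).

Lemma measurable_Rintegral_param (F : R * R -> R) : measurable_fun setT F ->
  measurable_fun setT (fun x : R => Rintegral mu setT (fun y => F (x, y))).
Proof.
move=> mF.
apply: (@measurableT_comp _ _ _ _ _ _ fine _ (fun x : R => \int[mu]_y (F (x, y))%:E)%E) => //.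
have mE : measurable_fun setT (EFin \o F) by exact/measurable_EFinP.
rewrite (_ : (fun x => _) = (fun x => \int[mu]_y ((EFin \o F)^\+ (x, y)) -
    \int[mu]_y ((EFin \o F)^\- (x, y)))%E); last first.
  apply/funext => x; rewrite -[LHS]/(\int[mu]_y ((EFin \o F) \o pair x) y)%E integralE.
  by rewrite funepos_comp funeneg_comp.
apply: emeasurable_funB.
- by apply: tonelli_measurable; [exact: measurable_funepos|move=> z; exact: funepos_ge0].
- by apply: tonelli_measurable; [exact: measurable_funeneg|move=> z; exact: funeneg_ge0].
Qed.

Lemma cmeas_cint_param (F : R * R -> R[i]) : cmeas F ->
  cmeas (fun x : R => cint setT (fun y => F (x, y))).
Proof.
move=> [F1 F2]; split.
- exact: (measurable_Rintegral_param F1).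
- exact: (measurable_Rintegral_param F2).
Qed.

Definition window r : set R := `[- r, r]%classic.

Definition mean r f x : R[i] := ((2 * r)^-1)%:C * cint setT (cut `[x - r, x + r] f).

Lemma cut_window r f x y : cut `[x - r, x + r] f y = (\1_(window r) (x - y))%:C * f y.
Proof.
rewrite /cut !indicE; congr ((_%:R)%:C * _); congr nat_of_bool.
apply/idP/idP; rewrite !inE /window/= !in_itv/= => /andP[h1 h2];
  by apply/andP; split; lra.
Qed.

Lemma measurable_window2 r :
  measurable_fun setT (fun z : R * R => \1_(window r) (z.1 - z.2) : R).
Proof.
apply: (@measurableT_comp _ _ _ _ _ _ (\1_(window r) : R -> R)).
  by apply: measurable_indic; exact: measurable_itv.
exact: measurable_funB.
Qed.

Lemma cmeas_mean r f : cmeas f -> cmeas (mean r f).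
Proof.
move=> mf; apply: cmeasM; first exact: cmeas_cst.
pose F (z : R * R) : R[i] := (\1_(window r) (z.1 - z.2))%:C * f z.2.
have mF : cmeas F.
  apply: cmeasM; last exact: cmeas_snd.
  by apply: cmeas_real; exact: measurable_window2.
apply: cmeas_eq (cmeas_cint_param mF) => x.
by apply: eq_cint => y; rewrite cut_window.
Qed.

Lemma mu_segment (a b : R) : a <= b -> mu `[a, b] = (b - a)%:E.
Proof.
rewrite le_eqVlt => /predU1P[->|ab].
  by rewrite set_itv1 lebesgue_measure_set1 subrr.
by rewrite lebesgue_measure_itv/= lte_fin ab EFinB.
Qed.

Lemma energy_indic_segment (a b : R) : a <= b ->
  energy (fun x : R => (\1_`[a, b] x)%:C) = (b - a)%:E.
Proof.
move=> ab; transitivity (\int[mu]_x (\1_`[a, b] x)%:E)%E; last first.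
  have mI : measurable (`[a, b]%classic : set R) by exact: measurable_itv.
  by rewrite integral_indic// setIT; exact: mu_segment.
apply: eq_integral => x _; rewrite normc_real indicE.
by case: (_ \in _); rewrite ?normr1 ?normr0 ?expr1n ?expr0n.
Qed.

Lemma normc_cint_segment (a b : R) f : a <= b -> cmeas f -> (energy f < +oo)%E ->
  ((normc (cint setT (cut `[a, b] f)) ^+ 2)%:E <=
   (b - a)%:E * energy (cut `[a, b] f))%E.
Proof.
move=> ab mf fy; have mI : measurable (`[a, b]%classic : set R) by exact: measurable_itv.
have mc := cmeas_cut mI mf.
have cy : (L2norm setT (cut `[a, b] f) < +oo)%E.
  rewrite L2norm_fin; apply: le_lt_trans fy; apply: energy_le => // x.
  exact: normc_cut_le.
have mi : cmeas (fun x : R => (\1_`[a, b] x)%:C : R[i]).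
  by apply: cmeas_real; exact: measurable_indic.
have iy : (L2norm setT (fun x : R => (\1_`[a, b] x)%:C) < +oo)%E.
  by rewrite L2norm_fin energy_indic_segment// ltry.
have := cauchy_schwarz_cint mi mc iy cy.
rewrite (@eq_cint _ _ (cut `[a, b] f)); last first.
  by move=> x; rewrite !cutE indicE; case: ifP => _; rewrite ?mul1r ?mulr0.
rewrite !L2normE -sqrteM ?energy_ge0// energy_indic_segment// => h.
rewrite -[leRHS]sqr_sqrte; last by rewrite mule_ge0 ?energy_ge0// lee_fin subr_ge0.
by rewrite EFin_expe !expe2; apply: lee_pmul => //; rewrite lee_fin normc_ge0.
Qed.

(** Cauchy--Schwarz over each window, then Tonelli's theorem: the windows that contain
    a given point have total weight 1. *)
Lemma energy_mean_le r f : 0 < r -> cmeas f -> (energy (mean r f) <= energy f)%E.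
Proof.
move=> r0 mf; have [->|] := eqVneq (energy f) +oo%E; first exact: leey.
rewrite -ltey => fy.
pose K (z : R * R) := (2 * r)^-1 * \1_(window r) (z.1 - z.2).
have mK : measurable_fun setT K by apply: measurable_funM => //; exact: measurable_window2.
have K0 z : 0 <= K z by rewrite mulr_ge0// ?invr_ge0 ?mulr_ge0 ?ltW// indicE.
rewrite -(@kernel_column _ K f) //; last first.
  move=> y; rewrite /K/=; under eq_integral do rewrite EFinM.
  have mw : measurable_fun setT (fun x => (\1_(window r) x : R)%:E).
    by apply/measurable_EFinP; apply: measurable_indic; exact: measurable_itv.
  have r20 : 0 <= (2 * r)^-1 by rewrite invr_ge0 mulr_ge0// ltW.
  rewrite ge0_integralZl_EFin//; last first.
    by apply: (measurableT_comp mw); exact: measurable_funD.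
  rewrite (integral_translate (- y) mw); last by move=> x; rewrite lee_fin indicE.
  have -> : (\int[mu]_x (\1_(window r) x : R)%:E = (2 * r)%:E)%E.
    have mI : measurable (window r) by exact: measurable_itv.
    rewrite integral_indic// setIT -[LHS]/(mu (window r)) mu_segment; last by lra.
    by congr EFin; ring.
  by rewrite -EFinM mulVf// mulf_neq0// gt_eqF.
pose F (z : R * R) := (K z * normc (f z.2) ^+ 2)%:E.
have mF : measurable_fun setT F.
  apply/measurable_EFinP; apply: measurable_funM => //.
  exact/measurable_normc_sqr/cmeas_snd.
have F0 z : (0 <= F z)%E by rewrite lee_fin mulr_ge0// sqr_ge0.
apply: ge0_le_integral => //.
- by move=> x _; rewrite lee_fin sqr_ge0.
- by apply: measurable_energy; exact: cmeas_mean.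
- exact: (tonelli_measurable mF F0).
move=> x _; rewrite /mean Normc.normcM normc_real exprMn EFinM.
have ab : x - r <= x + r by lra.
pose S : set R := `[x - r, x + r]%classic.
apply: (@le_trans _ _ ((`|(2 * r)^-1| ^+ 2)%:E *
   ((x + r - (x - r))%:E * energy (cut S f)))%E).
  by apply: lee_wpmul2l; [rewrite lee_fin sqr_ge0|exact: normc_cint_segment].
rewrite muleA -EFinM.
have -> : `|(2 * r)^-1| ^+ 2 * (x + r - (x - r)) = (2 * r)^-1.
  by rewrite real_normK ?num_real//; field; exact: lt0r_neq0.
have r20 : 0 <= (2 * r)^-1 by rewrite invr_ge0 mulr_ge0// ltW.
rewrite -ge0_integralZl_EFin//; last first.
- by apply: measurable_energy; apply: cmeas_cut => //; exact: measurable_itv.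
- by move=> y _; rewrite lee_fin sqr_ge0.
rewrite le_eqVlt; apply/orP; left; apply/eqP; apply: eq_integral => y _.
rewrite cut_window Normc.normcM normc_real -EFinM /K/= -mulrA exprMn; congr ((_ * (_ * _))%:E).
by rewrite indicE; case: (_ \in _); rewrite ?normr1 ?normr0 ?expr1n ?expr0n.
Qed.

Lemma locally_integrable_bounded (g : R -> R) (M : R) : measurable_fun setT g ->
  (forall x, `|g x| <= M) -> locally_integrable setT g.
Proof.
move=> mg gM; split => //; first exact: openT.
move=> K _ cK; have mK := compact_measurable cK.
apply: (@le_lt_trans _ _ (\int[mu]_(x in K) (cst M%:E x))%E).
  apply: ge0_le_integral => //.
  - by apply/measurable_EFinP; apply: measurableT_comp => //; exact: measurable_funTS.
  - by move=> x _; rewrite lee_fin.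
have M0 : 0 <= M by rewrite (le_trans _ (gM 0)).
by rewrite integral_cst// lte_mul_pinfty ?lee_fin// compact_finite_measure.
Qed.

Lemma nicely_shrinking_segment x :
  nicely_shrinking x (fun n => `[x - harmonic n, x + harmonic n]%classic).
Proof.
split; first by move=> n; exact: measurable_itv.
have h0 n : (0 : R) < 2 * harmonic n by rewrite mulr_gt0// harmonic_gt0.
exists (2, fun n => PosNum (h0 n)); split => //=.
- by rewrite -(mulr0 2); apply: cvgMl_tmp; exact: cvg_harmonic.
- move=> n y /=; rewrite in_itv/= => /andP[h1 h2].
  have hn := @harmonic_gt0 R n; rewrite /= in hn.
  rewrite /ball/= ltr_norml; move: (n.+1%:R^-1) h1 h2 hn => e h1 h2 hn.
  by apply/andP; split; lra.
- move=> n; have hn := @harmonic_gt0 R n; rewrite /= in hn *.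
  move: (n.+1%:R^-1) hn => e hn.
  rewrite (lebesgue_measure_ball x) ?mu_segment; last 2 first.
  - by lra.
  - by rewrite /=; lra.
  by rewrite -EFinM lee_fin /=; lra.
Qed.

Lemma real_mean_cvg (g : R -> R) : locally_integrable setT g ->
  {ae mu, forall x, (2 * harmonic n)^-1 * Rintegral mu `[x - harmonic n, x + harmonic n] g
    @[n --> \oo] --> g x}.
Proof.
move=> lg; apply: ae_imply (lebesgue_differentiation lg) => x gx.
have := nice_lebesgue_differentiation (@nicely_shrinking_segment) lg gx.
move=> /fine_cvgP[_]; apply: cvg_trans; apply: near_eq_cvg; apply: nearW => n.
have hn := @harmonic_gt0 R n.
rewrite /comp mu_segment; last by lra.
rewrite inver; case: ifPn => [|_]; first by move/eqP; lra.
rewrite fineM//; last first.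
  case: lg => mg _ lg.
  apply: integrable_fin_num; first exact: measurable_itv.
  apply/integrableP; split.
    by apply/measurable_EFinP; exact: measurable_funTS.
  by apply: lg => //; exact: segment_compact.
by congr ((_^-1)%R * _); ring.
Qed.

Lemma mean_cvg f : locally_integrable setT (Re \o f) -> locally_integrable setT (Im \o f) ->
  {ae mu, forall x, normc (mean (harmonic n) f x - f x) @[n --> \oo] --> 0}.
Proof.
move=> /real_mean_cvg h1 /real_mean_cvg h2; apply: ae_imply (ae_and h1 h2) => x [].
move=> /subr_cvg0 d1 /subr_cvg0 d2.
have c1 := (norm_cvg0P _).2 d1; have c2 := (norm_cvg0P _).2 d2.
pose dist (g : R -> R) n := `|(2 * harmonic n)^-1 *
  Rintegral mu `[x - harmonic n, x + harmonic n] g - g x|.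
have c12 : dist (Re \o f) n + dist (Im \o f) n @[n --> \oo] --> 0.
  by rewrite -[X in _ --> X]addr0; apply: cvgD; [exact: c1|exact: c2].
apply: (squeeze_cvgr _ (@cvg_cst _ 0 _ _ _) c12); apply: nearW => n.
apply/andP; split; first exact: normc_ge0.
apply: (le_trans (normc_le_ReIm _)).
rewrite ReD ImD ReN ImN /mean ReM ImM !mul0r subr0 addr0 cint_cut.
exact: lexx.
Qed.

End local_means.

(** * Fourier inversion *)

Section inversion.
Context {R : realType}.
Local Notation mu := (@lebesgue_measure R).
Local Notation Re := (@complex.Re R).
Local Notation Im := (@complex.Im R).
Local Notation normc := (@Normc.normc R).
Implicit Types (f g v w : R -> R[i]) (a b d x y : R).

(** The mass that the Poisson kernel centered at [y] gives to the interval from [a] to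
    [b], seen as a function of [y]. *)
Definition harmonic_measure d a b y : R :=
  pi^-1 * atan (d^-1 * (b - y)) - pi^-1 * atan (d^-1 * (a - y)).

Lemma cint_real (g : R -> R) : cint setT (fun x => (g x)%:C) = (Rintegral mu setT g)%:C.
Proof.
apply: complexP => //=; rewrite /Rintegral.
by under eq_integral do rewrite /=; rewrite integral0.
Qed.

(** Fubini's theorem lets the Poisson kernel act on the interval instead of on [v]. *)
Lemma psmooth_segment d a b v : 0 < d -> a < b -> cintegrable v ->
  cint setT (cut `[a, b] (psmooth d v)) =
  cint setT (fun y => (harmonic_measure d a b y)%:C * v y).
Proof.
move=> d0 ab vi; have mI : measurable (`[a, b]%classic : set R) by exact: measurable_itv.
pose I : set R := `[a, b]%classic.
pose F (z : R * R) : R[i] := (\1_I z.1)%:C * ((poisson d (z.1 - z.2))%:C * v z.2).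
have mI1 : measurable_fun setT (fun z : R * R => \1_I z.1 : R).
  by apply: (@measurableT_comp _ _ _ _ _ _ (\1_I : R -> R)) => //; exact: measurable_indic.
have mF : cmeas F.
  apply: cmeasM; first exact: cmeas_real.
  apply: cmeasM; first by apply: cmeas_real; exact: measurable_poisson2.
  by apply: cmeas_snd; case: vi.
have F1 s : cintegrable (fun y => F (s, y)).
  by rewrite /F /=; apply: cintegrableZ; exact: cintegrable_poissonM.
have mPy y : measurable_fun setT (fun s : R => poisson d (s - y)).
  by apply: (measurableT_comp (measurable_poisson d0)); exact: measurable_funB.
have Pi y : mu.-integrable setT (EFin \o (fun s : R => poisson d (s - y))).
  apply/integrableP; split; first by apply/measurable_EFinP; exact: mPy.
  under eq_integral do rewrite /= ger0_norm ?poisson_ge0//.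
  by rewrite integral_poisson// ltry.
have indic_le1 s : `|\1_I s : R| <= 1.
  by rewrite indicE; case: (_ \in _); rewrite ?normr1 ?normr0.
have Gi y : cintegrable (fun s => (\1_I s * poisson d (s - y))%:C).
  apply: (cintegrable_le _ (Pi y)).
    by apply: cmeas_real; apply: measurable_funM => //; exact: measurable_indic.
  by move=> s; rewrite normc_real normrM [`|poisson _ _|]ger0_norm ?poisson_ge0// ler_piMl ?poisson_ge0.
have FE s y : F (s, y) = v y * (\1_I s * poisson d (s - y))%:C.
  by rewrite /F (rmorphM _ (\1_I s)) [RHS]mulrC -mulrA.
have F2 y : cintegrable (fun s => F (s, y)).
  rewrite (_ : (fun s => _) = fun s => v y * (\1_I s * poisson d (s - y))%:C).
    exact: cintegrableZ.
  by apply/funext => s; exact: FE.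
transitivity (cint setT (fun s => cint setT (fun y => F (s, y)))).
  apply: eq_cint => s; apply/esym.
  exact: (cintZ (\1_I s)%:C (cintegrable_poissonM s d0 vi)).
rewrite cint_fubini//.
  apply: eq_cint => y; rewrite (eq_cint (FE^~ y)).
  rewrite cintZ// mulrC cint_real; congr (_%:C * _).
  have := integral_poisson_segment y d0 ab; rewrite -/(harmonic_measure d a b y).
  move=> /(congr1 fine)/= <-.
  rewrite -[RHS]/(Rintegral mu `[a, b] (fun s => poisson d (s - y))) Rintegral_mkcond.
  by apply: eq_Rintegral => s _; rewrite patchE indicE; case: ifP; rewrite ?mul1r ?mul0r.
pose N (z : R * R) := (normc (F z))%:E.
have mN : measurable_fun setT N by apply/measurable_EFinP; exact: measurable_normc.
have N0 z : (0 <= N z)%E by rewrite lee_fin normc_ge0.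
rewrite -[ltLHS]/(\int[mu]_x \int[mu]_y N (x, y))%E (tonelli_swap mN N0).
case: (vi) => mv; apply: le_lt_trans.
apply: ge0_le_integral => //.
- by move=> y _; apply: integral_ge0.
- apply: (@tonelli_measurable _ (fun z => N (z.2, z.1))) => [|z]; last exact: N0.
  apply: (measurableT_comp mN); exact: measurable_fun_pair.
- by apply/measurable_EFinP; exact: measurable_normc.
move=> y _; rewrite -[leRHS]mule1 -(integral_poisson (- y) d0).
rewrite -ge0_integralZl_EFin ?normc_ge0//; last first.
- by apply/measurable_EFinP; exact: mPy.
- by move=> s _; rewrite lee_fin poisson_ge0.
apply: ge0_le_integral => //.
- by apply/measurable_EFinP/measurable_normc; case: (F2 y).
- by apply/measurable_EFinP; apply: measurable_funM => //; exact: mPy.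
move=> s _; rewrite /N FE Normc.normcM normc_real -EFinM lee_fin.
apply: ler_wpM2l; first exact: normc_ge0.
by rewrite normrM [`|poisson _ _|]ger0_norm ?poisson_ge0// ler_piMl ?poisson_ge0.
Qed.

Lemma atan_bound x : `|pi^-1 * atan x| <= 2^-1.
Proof.
have p0 := @pi_gt0 R.
rewrite normrM gtr0_norm ?invr_gt0// ler_pdivrMl// ler_norml.
by have := atan_gtNpi2 x; have := atan_ltpi2 x; lra.
Qed.

Lemma harmonic_measure_le1 d a b y : `|harmonic_measure d a b y| <= 1.
Proof.
apply: (le_trans (ler_normB _ _)).
by have := atan_bound (d^-1 * (b - y)); have := atan_bound (d^-1 * (a - y)); lra.
Qed.

Lemma cvg_atan_pos x : 0 < x -> pi^-1 * atan ((harmonic n)^-1 * x) @[n --> \oo] --> (2^-1 : R).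
Proof.
move=> x0; have -> : 2^-1 = pi^-1 * (pi / 2) :> R.
  by rewrite mulrA mulVf ?mul1r// gt_eqF// pi_gt0.
apply: cvgMl_tmp.
apply: (@cvg_comp _ _ _ (fun n => (harmonic n)^-1 * x) atan _ _ _ _ (@cvgy_atan R)).
rewrite (_ : (fun n => _) = fun n => n.+1%:R * x); last first.
  by apply/funext => n; rewrite /harmonic/= invrK.
apply/cvgryPge => A; have := @cvgr_idn R; rewrite -cvg_shiftS => /cvgryPge /(_ (A / x)).
by apply: filterS => n; rewrite ler_pdivrMr.
Qed.

Lemma cvg_atan_neg x : x < 0 -> pi^-1 * atan ((harmonic n)^-1 * x) @[n --> \oo] --> (- 2^-1 : R).
Proof.
move=> x0; rewrite (_ : (fun n => _) =
    fun n => - (pi^-1 * atan ((harmonic n)^-1 * - x))); last first.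
  by apply/funext => n; rewrite mulrN atanN mulrN opprK.
by apply: cvgN; apply: cvg_atan_pos; rewrite oppr_gt0.
Qed.

Lemma cvg_harmonic_measure a b y : a < b -> y != a -> y != b ->
  harmonic_measure (harmonic n) a b y @[n --> \oo] --> (\1_`[a, b] y : R).
Proof.
move=> ab ya yb; rewrite indicE.
have [lay|lay] := ltP a y.
  have [lyb|lyb] := ltP y b.
    rewrite mem_set/=; last by rewrite in_itv/= !ltW.
    have -> : (1%:R : R) = 2^-1 - (- 2^-1) by lra.
    by apply: cvgB; [apply: cvg_atan_pos; lra|apply: cvg_atan_neg; lra].
  have {}lyb : b < y by rewrite lt_neqAle eq_sym yb.
  rewrite memNset/=; last by rewrite in_itv/= => /andP[]; lra.
  have -> : (0%:R : R) = - 2^-1 - (- 2^-1) by lra.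
  by apply: cvgB; apply: cvg_atan_neg; lra.
have {}lay : y < a by rewrite lt_neqAle ya.
rewrite memNset/=; last by rewrite in_itv/= => /andP[]; lra.
have -> : (0%:R : R) = 2^-1 - 2^-1 by lra.
by apply: cvgB; apply: cvg_atan_pos; lra.
Qed.

Lemma ae_neq a : {ae mu, forall x, x != a}.
Proof.
exists [set a]; split; [exact: measurable_set1|exact: lebesgue_measure_set1|].
by move=> x /= /negP; rewrite negbK => /eqP.
Qed.

(** The harmonic measures of an interval are bounded by 1 and converge except at the
    end points, so that dominated convergence applies. *)
Lemma psmooth_weak_cvg a b v : a < b -> cintegrable v ->
  normc (cint setT (cut `[a, b] (psmooth (harmonic n) v)) - cint setT (cut `[a, b] v))
    @[n --> \oo] --> 0.
Proof.
move=> ab vi; have h0 := @harmonic_gt0 R.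
have mI : measurable (`[a, b]%classic : set R) by exact: measurable_itv.
under eq_fun do rewrite psmooth_segment//.
apply: (@cint_dominated _ _ _ (fun x => normc (v x))).
- move=> n; apply: cmeasM; last by case: vi.
  apply: cmeas_real; apply: measurable_funB; apply: measurable_funM => //;
    apply: measurableT_comp; try exact: (continuous_measurable_fun (@continuous_atan R));
    by apply: measurable_funM => //; exact: measurable_funB.
- by apply: cmeas_cut => //; case: vi.
- apply: ae_imply (ae_and (ae_neq a) (ae_neq b)) => y [ya yb].
  rewrite /cut (_ : (fun n => _) = fun n =>
    `|harmonic_measure (harmonic n) a b y - \1_`[a, b] y| * normc (v y)); last first.
    by apply/funext => n; rewrite -mulrBl Normc.normcM -rmorphB normc_real.
  rewrite -[X in _ --> X](mul0r (normc (v y))); apply: cvgMr_tmp.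
  apply/norm_cvg0P; apply/subr_cvg0; exact: cvg_harmonic_measure.
- exact: integrable_normc.
- move=> n x; rewrite Normc.normcM normc_real ler_piMl ?normc_ge0//.
  exact: harmonic_measure_le1.
- by move=> x; exact: normc_cut_le.
Qed.

Lemma ft_abel_mul_cvg w x : cintegrable w ->
  normc (ft (abel_mul (harmonic n) w) x - ft w x) @[n --> \oo] --> 0.
Proof.
move=> wi.
have awi n : cintegrable (abel_mul (harmonic n) w).
  apply: (cintegrable_le _ (integrable_normc wi)); first by apply: cmeas_abel_mul; case: wi.
  by move=> y; apply: normc_abel_mul_le; exact: harmonic_ge0.
rewrite (_ : (fun n => _) = (fun n => ft_cst * normc
   (cint setT (fun y => cis (- (y * x)) * abel_mul (harmonic n) w y) -
    cint setT (fun y => cis (- (y * x)) * w y)))); last first.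
  apply/funext => n; rewrite !ftE -mulrBr Normc.normcM normc_real.
  by rewrite gtr0_norm// ft_cst_gt0.
rewrite -[X in _ --> X](mulr0 ft_cst); apply: cvgMl_tmp.
apply: (@cint_dominated _ _ _ (fun x => normc (w x))).
- by move=> n; have [] := cintegrable_ft_kernel x (awi n).
- by have [] := cintegrable_ft_kernel x wi.
- apply: aeW => y; have := cvg_abel_mul w y; apply: cvg_trans; apply: near_eq_cvg.
  by apply: nearW => n; rewrite -mulrBr Normc.normcM normc_cis mul1r.
- exact: integrable_normc.
- move=> n y; rewrite Normc.normcM normc_cis mul1r.
  by apply: normc_abel_mul_le; exact: harmonic_ge0.
- by move=> y; rewrite Normc.normcM normc_cis mul1r.
Qed.

End inversion.

Section inversion_inequality.
Context {R : realType}.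
Local Notation mu := (@lebesgue_measure R).
Local Notation Re := (@complex.Re R).
Local Notation Im := (@complex.Im R).
Local Notation normc := (@Normc.normc R).
Implicit Types (f g v w : R -> R[i]) (a b d x y : R).

Lemma cmeas_opp f : cmeas f -> cmeas (fun x : R => f (- x)).
Proof. by move=> mf; apply: (cmeas_comp mf); exact: oppr_measurable. Qed.

Lemma energy_reflect f : cmeas f -> energy (fun x => f (- x)) = energy f.
Proof.
move=> mf; rewrite /energy (integral_reflect (measurable_energy mf))// => x.
by rewrite lee_fin sqr_ge0.
Qed.

Lemma cintegrable_cut_bounded a b f (M : R) : a <= b -> cmeas f ->
  (forall x, normc (f x) <= M) -> cintegrable (cut `[a, b] f).
Proof.
move=> ab mf fM; have mI : measurable (`[a, b]%classic : set R) by exact: measurable_itv.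
have ii : cintegrable (fun x : R => (\1_`[a, b] x)%:C : R[i]).
  split; first by apply: cmeas_real; exact: measurable_indic.
  rewrite (_ : (\int[mu]_x _)%E = (b - a)%:E) ?ltry// -energy_indic_segment//.
  apply: eq_integral => x _; rewrite normc_real indicE.
  by case: (_ \in _); rewrite ?normr1 ?normr0 ?expr1n ?expr0n.
by rewrite /cut; under eq_fun do rewrite mulrC; exact: cintegrable_bounded_mul fM ii.
Qed.

(** Contractivity bounds the energy of the damped functions
    [ft (abel_mul d (ft v - w))]. If these converged pointwise to [v - ft w], up to
    reflection, as [d] tends to 0, then Fatou's lemma would suffice. Their means over
    intervals do converge, so Fatou's lemma is applied to these means, and then a
    second time, by Lebesgue's differentiation theorem, as the intervals shrink. *)
Lemma inversion_le v w : cintegrable v -> cintegrable w ->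
  (energy (fun x => v x - ft w (- x))%R <= energy (fun xi => ft v xi - w xi)%R)%E.
Proof.
move=> vi wi; set K := leRHS; pose f x := v x - ft w (- x).
have h0 := @harmonic_gt0 R.
have [Mv vM] := ft_bounded vi; have [Mw wM] := ft_bounded wi.
have mftw := cmeas_opp (cmeas_ft wi).
have mf : cmeas f by apply: cmeasB => //; case: vi.
have avi n : cintegrable (abel_mul (harmonic n) (ft v)).
  by apply: (cintegrable_abel_mul_bounded _ _ vM) => //; exact: cmeas_ft.
have awi n : cintegrable (abel_mul (harmonic n) w).
  apply: (cintegrable_le _ (integrable_normc wi)); first by apply: cmeas_abel_mul; case: wi.
  by move=> y; apply: normc_abel_mul_le; exact: harmonic_ge0.
pose g n := abel_mul (harmonic n) (fun xi => ft v xi - w xi)%R.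
have gE n : g n = fun xi => abel_mul (harmonic n) (ft v) xi - abel_mul (harmonic n) w xi.
  by apply/funext => xi; rewrite /g /abel_mul mulrBr.
have gi n : cintegrable (g n) by rewrite gE; exact: cintegrableB.
pose fn n x := ft (g n) (- x).
have mfn n : cmeas (fn n) by apply: cmeas_opp; exact: cmeas_ft.
have fnK n : (energy (fn n) <= K)%E.
  rewrite energy_reflect; last exact: cmeas_ft.
  apply: (le_trans (ft_contraction (gi n))); apply: energy_le.
  - by case: (gi n).
  - by apply: cmeasB; [exact: cmeas_ft|case: wi].
  - by move=> xi; apply: normc_abel_mul_le; exact: harmonic_ge0.
have fnE n x : fn n x = psmooth (harmonic n) v x - ft (abel_mul (harmonic n) w) (- x).
  by rewrite /fn gE ftB// ft_abel_mul_ft.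
have weak a b : a < b ->
    normc (cint setT (cut `[a, b] (fn n)) - cint setT (cut `[a, b] f)) @[n --> \oo] --> 0.
  move=> ab; have leab := ltW ab.
  have mI : measurable (`[a, b]%classic : set R) by exact: measurable_itv.
  pose A n := cint setT (cut `[a, b] (psmooth (harmonic n) v)).
  pose B n := cint setT (cut `[a, b] (fun x => ft (abel_mul (harmonic n) w) (- x))).
  have pi_ n : cintegrable (cut `[a, b] (psmooth (harmonic n) v)).
    have [M aM] := ft_bounded (avi n).
    have e x : psmooth (harmonic n) v x = ft (abel_mul (harmonic n) (ft v)) (- x).
      by rewrite ft_abel_mul_ft.
    apply: (@cintegrable_cut_bounded _ _ _ M) => //; last by move=> x; rewrite e.
    rewrite (_ : psmooth _ _ = fun x => ft (abel_mul (harmonic n) (ft v)) (- x)).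
      by apply: cmeas_opp; exact: cmeas_ft.
    exact/funext.
  have wi_ n : cintegrable (cut `[a, b] (fun x => ft (abel_mul (harmonic n) w) (- x))).
    have [M aM] := ft_bounded (awi n).
    apply: (@cintegrable_cut_bounded _ _ _ M) => //.
    by apply: cmeas_opp; exact: cmeas_ft.
  have wi0 : cintegrable (cut `[a, b] (fun x => ft w (- x))).
    exact: (@cintegrable_cut_bounded _ _ _ Mw).
  have fnAB n : cint setT (cut `[a, b] (fn n)) = A n - B n.
    rewrite -[RHS](cintB (pi_ n) (wi_ n)); apply: eq_cint => x.
    by rewrite /cut fnE mulrBr.
  have fAB : cint setT (cut `[a, b] f) =
      cint setT (cut `[a, b] v) - cint setT (cut `[a, b] (fun x => ft w (- x))).
    rewrite -[RHS](cintB (cintegrable_cut mI vi) wi0).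
    by apply: eq_cint => x; rewrite /cut /f mulrBr.
  have cA := psmooth_weak_cvg ab vi.
  have cB : normc (B n - cint setT (cut `[a, b] (fun x => ft w (- x)))) @[n --> \oo] --> 0.
    pose M := ft_cst * fine (\int[mu]_x (normc (w x))%:E).
    have M0 : 0 <= M.
      exact: le_trans (normc_ge0 _) (ft_dominated 0 wi wi (fun=> lexx _)).
    have awM n x : normc (ft (abel_mul (harmonic n) w) x) <= M.
      apply: ft_dominated => // y.
      by apply: normc_abel_mul_le; exact: harmonic_ge0.
    have Mi : cintegrable (cut `[a, b] (fun=> M%:C)).
      apply: (@cintegrable_cut_bounded _ _ _ M) => //; first exact: cmeas_cst.
      by move=> x; rewrite normc_real ger0_norm.
    have cutM (F : R -> R[i]) x : (forall y, normc (F y) <= M) ->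
        normc (cut `[a, b] F x) <= normc (cut `[a, b] (fun=> M%:C) x).
      move=> FM; rewrite !cutE; case: ifP => _ //.
      by rewrite normc_real ger0_norm.
    apply: (@cint_dominated _ _ _ (fun x => normc (cut `[a, b] (fun=> M%:C) x))).
    - by move=> n; case: (wi_ n).
    - by case: wi0.
    - apply: aeW => x; have c := ft_abel_mul_cvg (- x) wi.
      rewrite (_ : (fun n => _) = fun n => `|\1_`[a, b] x| *
         normc (ft (abel_mul (harmonic n) w) (- x) - ft w (- x))); last first.
        by apply/funext => n; rewrite /cut -mulrBr Normc.normcM normc_real.
      by rewrite -[X in _ --> X](mulr0 `|\1_`[a, b] x|); apply: cvgMl_tmp.
    - exact: integrable_normc.
    - by move=> n x; apply: cutM => y.
    - by move=> x; apply: cutM => y; exact: ft_dominated.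
  have cAB : normc (A n - cint setT (cut `[a, b] v)) +
      normc (B n - cint setT (cut `[a, b] (fun x => ft w (- x)))) @[n --> \oo] --> 0.
    by rewrite -[X in _ --> X]addr0; exact: cvgD.
  apply: (squeeze_cvgr _ (@cvg_cst _ 0 _ _ _) cAB); apply: nearW => n; apply/andP; split; first exact: normc_ge0.
  apply: le_trans (normcB_le _ _); rewrite le_eqVlt; apply/orP; left; apply/eqP.
  by rewrite fnAB fAB; congr (normc _); rewrite /A; ring.
have meanK m : (energy (mean (harmonic m) f) <= K)%E.
  apply: (@energy_fatou _ (fun n => mean (harmonic m) (fn n))).
  - by move=> n; exact: cmeas_mean.
  - exact: cmeas_mean.
  - apply: aeW => x; rewrite /mean.
    have hm := h0 m.
    rewrite (_ : (fun n => _) = fun n => (2 * harmonic m)^-1 *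
      normc (cint setT (cut `[x - harmonic m, x + harmonic m] (fn n)) -
             cint setT (cut `[x - harmonic m, x + harmonic m] f))); last first.
      apply/funext => n; rewrite -mulrBr Normc.normcM normc_real ger0_norm//.
      by rewrite invr_ge0 mulr_ge0// ltW.
    rewrite -[X in _ --> X](mulr0 (2 * harmonic m)^-1); apply: cvgMl_tmp.
    by apply: weak; lra.
  - by apply: nearW => n; apply: (le_trans (energy_mean_le _ _)).
apply: (@energy_fatou _ (fun m => mean (harmonic m) f)) => //.
- by move=> m; exact: cmeas_mean.
- apply: mean_cvg.
  + rewrite (_ : Re \o f = (Re \o v) \- (Re \o (fun x => ft w (- x)))); last first.
      by apply/funext => x; rewrite /comp /f ReD ReN.
    apply: locally_integrableB.
      by apply: open_integrable_locally; [exact: openT|exact: integrable_Re].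
    apply: (@locally_integrable_bounded _ _ Mw); first by case: mftw.
    by move=> x; exact: le_trans (Re_le_normc _) (wM _).
  + rewrite (_ : Im \o f = (Im \o v) \- (Im \o (fun x => ft w (- x)))); last first.
      by apply/funext => x; rewrite /comp /f ImD ImN.
    apply: locally_integrableB.
      by apply: open_integrable_locally; [exact: openT|exact: integrable_Im].
    apply: (@locally_integrable_bounded _ _ Mw); first by case: mftw.
    by move=> x; exact: le_trans (Im_le_normc _) (wM _).
- exact: nearW.
Qed.

(** The errors [e n] make room for replacing a square-integrable function by its
    truncations. *)
Lemma L2norm_fatou (f_ : (R -> R[i])^nat) f (K : \bar R) (e : (\bar R)^nat) :
  (forall n, cmeas (f_ n)) -> cmeas f ->
  {ae mu, forall x, normc (f_ n x - f x) @[n --> \oo] --> 0} ->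
  (0 <= K)%E -> (forall n, (L2norm setT (f_ n) <= e n + K)%E) -> (e @ \oo --> 0%E)%classic ->
  (L2norm setT f <= K)%E.
Proof.
move=> mf_ mf f_f K0 f_K e0; case: K K0 f_K => [k| |] K0 f_K; last 2 first.
- exact: leey.
- by move: K0; rewrite leeNy_eq.
move: K0; rewrite lee_fin => k0; apply/lee_addgt0Pr => d d0.
have kd : 0 <= k + d by rewrite addr_ge0// ltW.
rewrite -EFinD L2norm_leP//; apply: (energy_fatou mf_ mf f_f).
have /fine_cvgP[efin /cvgrPdist_le/(_ d d0) ed] := e0.
apply: filterS2 efin ed => n efin; rewrite /comp sub0r normrN => ed.
rewrite -L2norm_leP//; apply: (le_trans (f_K n)).
rewrite EFinD [leRHS]addeC; apply: leeD => //; rewrite -[leLHS]fineK// lee_fin.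
exact: le_trans (ler_norm _) ed.
Qed.

(** * The Fourier transform on square-integrable functions *)

Lemma L2_cut_cintegrable a b f : a <= b -> L2 setT f -> cintegrable (cut `[a, b] f).
Proof.
move=> ab [mf fy].
have mI : measurable (`[a, b]%classic : set R) by exact: measurable_itv.
rewrite (_ : cut _ _ = fun x => (\1_`[a, b] x)%:C * f x)//.
apply: cintegrableM => //; first by apply: cmeas_real; exact: measurable_indic.
by rewrite L2norm_fin energy_indic_segment// ltry.
Qed.

Lemma is_fourier_seq v g : is_fourier v g ->
  [/\ forall n : nat, cintegrable (cut `[- n%:R, n%:R] v)%R,
      (forall n : nat, (L2norm setT (cut `[- n%:R, n%:R] v)%R <= L2norm setT v)%E) &
      (L2norm setT (fun xi => g xi - ft (cut `[- n%:R, n%:R] v) xi)%R @[n --> \oo] --> 0%E)%classic].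
Proof.
move=> [vL2 gL2 vg].
have nn (n : nat) : (- n%:R : R) <= n%:R by rewrite -subr_ge0 opprK addr_ge0.
split=> [n|n|].
- exact: L2_cut_cintegrable.
- apply: L2norm_le; [|by case: vL2|by move=> x; exact: normc_cut_le].
  by apply: cmeas_cut; [exact: measurable_itv|case: vL2].
- have := cvg_comp _ _ (@cvgr_idn R) vg.
  by under [X in X @ _ --> _]eq_fun do rewrite /comp/= -ft_cut.
Qed.

(** The truncations of [v] are integrable, their transforms tend to [g] in L2, and they
    are eventually constant at each point, so that [inversion_le] passes to the
    limit. This is the form of Plancherel's theorem by which errors on the line are
    estimated on the frequency side. *)
Lemma plancherel_inversion v g w : is_fourier v g -> cintegrable w ->
  (L2norm setT (fun x => v x - ft w (- x))%R <= L2norm setT (fun xi => g xi - w xi)%R)%E.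
Proof.
move=> vg wi; have [vni _ gn] := is_fourier_seq vg; have [[mv _] [mg _] _] := vg.
have mftw := cmeas_opp (cmeas_ft wi).
have mvn n := (vni n).1.
apply: (@L2norm_fatou (fun n x => cut `[- n%:R, n%:R] v x - ft w (- x)) _ _
  (fun n => L2norm setT (fun xi => g xi - ft (cut `[- n%:R, n%:R] v) xi)%R)) => //.
- by move=> n; apply: cmeasB.
- exact: cmeasB.
- apply: aeW => x; apply: cvg_near_cst; near=> n.
  rewrite cut_in; first by rewrite subrr normc_zero.
  by rewrite /= in_itv/= -ler_norml; near: n; exact: nbhs_infty_ger.
- exact: L2norm_ge0.
- move=> n; have mftvn := cmeas_ft (vni n).
  apply: (@le_trans _ _ (L2norm setT (fun xi => ft (cut `[- n%:R, n%:R] v) xi - w xi)%R)).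
    by rewrite le_L2norm_energy; exact: inversion_le.
  rewrite [X in (_ <= X + _)%E]L2norm_sub; apply: L2norm_tri => //; by case: wi.
Unshelve. all: by end_near. Qed.

Lemma plancherel_le v g : is_fourier v g -> (L2norm setT g <= L2norm setT v)%E.
Proof.
move=> vg; have [vni vn gn] := is_fourier_seq vg; have [[mv _] [mg _] _] := vg.
apply: (@L2norm_fatou (fun=> g) _ _
  (fun n => L2norm setT (fun xi => g xi - ft (cut `[- n%:R, n%:R] v) xi)%R)) => //.
- apply: aeW => x; rewrite subrr normc_zero; exact: cvg_cst.
- exact: L2norm_ge0.
- move=> n; have mftvn := cmeas_ft (vni n).
  apply: (@le_trans _ _ (L2norm setT (fun xi => g xi - ft (cut `[- n%:R, n%:R] v) xi)%R +
     L2norm setT (ft (cut `[- n%:R, n%:R] v))%R)%E).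
    apply: le_trans (L2normD _ _) => //; last exact: cmeasB.
    rewrite le_eqVlt; apply/orP; left; apply/eqP; apply: eq_L2norm => xi.
    by rewrite subrK.
  apply: leeD => //; apply: le_trans (vn n).
  by rewrite le_L2norm_energy; exact: ft_contraction.
Qed.

Lemma fourier_unique v g g' : is_fourier v g -> is_fourier v g' ->
  L2norm setT (fun xi => g xi - g' xi) = 0%E.
Proof.
move=> vg vg'; have [vni vn gn] := is_fourier_seq vg; have [_ _ gn'] := is_fourier_seq vg'.
have [[mv _] [mg _] _] := vg; have [_ [mg' _] _] := vg'.
apply/eqP; rewrite eq_le L2norm_ge0 andbT.
apply: (@L2norm_fatou (fun=> fun xi => g xi - g' xi) _ _
  (fun n => L2norm setT (fun xi => g xi - ft (cut `[- n%:R, n%:R] v) xi)%R +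
     L2norm setT (fun xi => g' xi - ft (cut `[- n%:R, n%:R] v) xi)%R)%E) => //.
- by move=> n; exact: cmeasB.
- exact: cmeasB.
- apply: aeW => x; rewrite subrr normc_zero; exact: cvg_cst.
- move=> n; have mftvn := cmeas_ft (vni n); rewrite adde0.
  by rewrite [X in (_ <= _ + X)%E]L2norm_sub; exact: L2norm_tri.
- rewrite -[X in _ --> X]adde0; exact: cvgeD.
Qed.

End inversion_inequality.

(** * Trigonometric sums *)

Section trigonometric_sums.
Context {R : realType}.
Local Notation mu := (@lebesgue_measure R).
Local Notation Re := (@complex.Re R).
Local Notation Im := (@complex.Im R).
Local Notation normc := (@Normc.normc R).
Implicit Types (f g : R -> R[i]) (h : R) (V : int -> R[i]) (n : nat).

Definition freq n (k : 'I_(n.*2.+1)) : int := k%:Z - n%:Z.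

Lemma freq_inj n : injective (@freq n).
Proof. by move=> k k' /addIr[] /val_inj. Qed.

(** The squared L2 norm of a grid function, the terms of index beyond [n] dropped. *)
Definition denergy h V n : R := h * \sum_(k < n.*2.+1) normc (V (freq k)) ^+ 2.

Lemma denergy_ge0 h V n : 0 < h -> 0 <= denergy h V n.
Proof.
by move=> h0; apply: mulr_ge0; [exact: ltW|apply: sumr_ge0 => k _; exact: sqr_ge0].
Qed.

Lemma dft_sumE h V n xi : dft_sum h V n xi =
  \sum_(k < n.*2.+1) ((h * ft_cst)%:C * V (freq k)) * cis (- (h * (freq k)%:~R * xi)).
Proof.
rewrite /dft_sum mulr_sumr; apply: eq_bigr => k _.
by rewrite -/(freq k) /ft_cst; ring.
Qed.

Lemma nyquistP h : 0 < h -> - (pi / h) < (pi / h : R).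
Proof. by move=> h0; have := @pi_gt0 R => p0; rewrite gtrN// divr_gt0. Qed.

Lemma measurable_nyquist h : measurable (nyquist h : set R).
Proof. exact: measurable_itv. Qed.

Lemma sin_int (j : int) : sin (pi * j%:~R) = 0 :> R.
Proof.
have sn m : sin (pi * m%:R) = 0 :> R.
  elim: m => [|m IH]; first by rewrite mulr0 sin0.
  by rewrite -natr1 mulrDr mulr1 sinDpi IH oppr0.
case: j => m; first exact: sn.
by rewrite NegzE mulrNz mulrN sinN sn oppr0.
Qed.

Lemma continuous_cosM (c : R) : continuous (fun x : R => cos (c * x)).
Proof.
move=> x; apply: (@continuous_comp _ _ _ (fun x => c * x) cos).
  exact: cvgMl_tmp.
exact: continuous_cos.
Qed.

Lemma continuous_sinM (c : R) : continuous (fun x : R => sin (c * x)).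
Proof.
move=> x; apply: (@continuous_comp _ _ _ (fun x => c * x) sin).
  exact: cvgMl_tmp.
exact: continuous_sin.
Qed.

Lemma cint_nyquist_cis h (j : int) : 0 < h ->
  cint (nyquist h) (fun xi => cis (h * j%:~R * xi)) =
  (if j == 0 then 2 * pi / h else 0)%:C.
Proof.
move=> h0; have ab := nyquistP h0; set c := h * j%:~R.
have [j0|j0] := eqVneq j 0.
  have c0 : c = 0 by rewrite /c j0 mulr0.
  have E (r : R) : Rintegral mu (nyquist h) (fun=> r) = r * (2 * pi / h).
    rewrite Rintegral_cst; last exact: measurable_nyquist.
    congr (_ * _); rewrite -[LHS]/(fine (mu `[- (pi / h), pi / h])) mu_segment ?(ltW ab)//.
    by rewrite /fine; ring.
  apply: complexP; rewrite /cint.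
  - rewrite -[RHS]mul1r -E; apply: eq_Rintegral => x _.
    by rewrite /comp c0 mul0r cis0.
  - rewrite -[RHS](mul0r (2 * pi / h)) -E; apply: eq_Rintegral => x _.
    by rewrite /comp c0 mul0r cis0.
have c0 : c != 0 by rewrite mulf_neq0 ?intr_eq0// gt_eqF.
have cE : c * (pi / h) = pi * j%:~R.
  by rewrite /c; field; exact: lt0r_neq0.
apply: complexP; rewrite /cint.
- transitivity (fine (\int[mu]_(x in nyquist h) (cos (c * x))%:E)%E).
    by congr fine; apply: eq_integral => x _; rewrite /comp cisE.
  have -> : (\int[mu]_(x in nyquist h) (cos (c * x))%:E =
      (c^-1 * sin (c * (pi / h)) - c^-1 * sin (c * - (pi / h)))%:E)%E.
    apply: (@ftc_segment _ (fun x => c^-1 * sin (c * x))) => //.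
      exact: continuous_cosM.
    move=> x; apply: is_derive_eq; rewrite /GRing.scale/=; field.
    exact: c0.
  by rewrite /fine mulrN cE sinN sin_int oppr0 mulr0 subrr.
- transitivity (fine (\int[mu]_(x in nyquist h) (sin (c * x))%:E)%E).
    by congr fine; apply: eq_integral => x _; rewrite /comp cisE.
  have -> : (\int[mu]_(x in nyquist h) (sin (c * x))%:E =
      (- c^-1 * cos (c * (pi / h)) - - c^-1 * cos (c * - (pi / h)))%:E)%E.
    apply: (@ftc_segment _ (fun x => - c^-1 * cos (c * x))) => //.
      exact: continuous_sinM.
    move=> x; apply: is_derive_eq; rewrite /GRing.scale/=; field.
    exact: c0.
  by rewrite /fine mulrN cosN subrr.
Qed.

Lemma cmeas_cisl (c : R) : cmeas (fun x : R => cis (c * x)).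
Proof. by apply: cmeas_cis; exact: measurable_funM. Qed.

Lemma cmeas_dft_sum h V n : cmeas (dft_sum h V n).
Proof.
rewrite (_ : dft_sum h V n = fun xi => \sum_(k < n.*2.+1)
  ((h * ft_cst)%:C * V (freq k)) * cis (- (h * (freq k)%:~R * xi))); last first.
  by apply/funext => xi; rewrite dft_sumE.
apply: cmeas_sum => k; apply: cmeasM; first exact: cmeas_cst.
by apply: cmeas_cis; apply: measurableT_comp => //; exact: measurable_funM.
Qed.

Lemma dft_sum_bounded h V n : exists M, forall xi, normc (dft_sum h V n xi) <= M.
Proof.
exists (\sum_(k < n.*2.+1) normc ((h * ft_cst)%:C * V (freq k))) => xi.
rewrite dft_sumE; elim/big_ind2 : _ => [|x1 x2 y1 y2 h1 h2|k _].
- by rewrite normc_zero.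
- by apply: (le_trans (normcD_le _ _)); exact: lerD.
- by rewrite Normc.normcM normc_cis mulr1.
Qed.

Lemma cintegrable_nyquist_bounded h f (M : R) : 0 < h -> cmeas f ->
  (forall x, normc (f x) <= M) -> cintegrable (cut (nyquist h) f).
Proof. by move=> h0 mf fM; apply: (cintegrable_cut_bounded _ mf fM); exact/ltW/nyquistP. Qed.

Lemma cintegrable_nyquist_L2 h f : 0 < h -> L2 (nyquist h) f ->
  cintegrable (cut (nyquist h) f).
Proof.
move=> h0 [mf fy]; have mN := @measurable_nyquist h.
rewrite (_ : cut _ f = cut (nyquist h) (cut (nyquist h) f)); last first.
  by apply/funext => x; rewrite !cutE; case: ifP.
apply: L2_cut_cintegrable; first exact/ltW/nyquistP.
by split; [exact: cmeas_cut|rewrite -L2norm_cut].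
Qed.

(** Orthogonality of the exponentials over the Nyquist interval: the coefficients
    of a trigonometric sum are recovered as values of the Fourier transform. *)
Lemma ft_cut_dft_sum h V n (k : 'I_(n.*2.+1)) : 0 < h ->
  ft (cut (nyquist h) (dft_sum h V n)) (- (h * (freq k)%:~R)) = V (freq k).
Proof.
move=> h0; rewrite ftE.
pose c (l : 'I_(n.*2.+1)) := (h * ft_cst)%:C * V (freq l).
pose e (j : int) : R -> R[i] := cut (nyquist h) (fun xi => cis (h * j%:~R * xi)).
have ei j : cintegrable (e j).
  apply: (@cintegrable_nyquist_bounded _ _ 1) => //; first exact: cmeas_cisl.
  by move=> x; rewrite normc_cis.
rewrite (@eq_cint _ _ (fun xi => \sum_(l < n.*2.+1) c l * e (freq k - freq l) xi)); last first.
  move=> xi; rewrite /cut dft_sumE mulrCA mulr_sumr mulr_sumr.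
  apply: eq_bigr => l _; rewrite -/(c l) /e /cut.
  have -> : cis (h * (freq k - freq l)%:~R * xi) =
      cis (- (xi * - (h * (freq k)%:~R))) * cis (- (h * (freq l)%:~R * xi)) :> R[i].
    by rewrite -cisD rmorphB/=; congr cis; ring.
  by ring.
have [-> _] := @cint_sum _ _ (index_enum 'I_(n.*2.+1))
  (fun l xi => c l * e (freq k - freq l) xi) (fun l => cintegrableZ (c l) (ei _)).
rewrite (bigD1 k)//= big1 ?addr0; last first.
  move=> l lk; rewrite cintZ// cint_cut cint_nyquist_cis// subr_eq0.
  by rewrite (inj_eq (@freq_inj n)) eq_sym (negPf lk) mulr0.
rewrite cintZ// cint_cut cint_nyquist_cis// subrr eqxx /c.
have e1 : ft_cst * (h * ft_cst * (2 * pi / h)) = 1 :> R.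
  have -> : ft_cst * (h * ft_cst * (2 * pi / h)) = ft_cst * ft_cst * (2 * pi) :> R.
    by field; exact: lt0r_neq0.
  by rewrite ft_cst_sqr mulVf// mulf_neq0// gt_eqF// pi_gt0.
transitivity ((ft_cst * (h * ft_cst * (2 * pi / h)))%:C * V (freq k)).
  rewrite (rmorphM _ ft_cst) (rmorphM _ (h * ft_cst) (2 * pi / h)).
  by rewrite -!mulrA; congr (_ * (_ * _)); rewrite mulrC.
by rewrite e1 mul1r.
Qed.

(** Paired with a trigonometric sum, [g] is seen only through its samples. *)
Lemma cint_mul_conj_dft_sum h V n g : cintegrable g ->
  cint setT (fun xi => g xi * conjc (dft_sum h V n xi)) =
  h%:C * \sum_(k < n.*2.+1) conjc (V (freq k)) * ft g (- (h * (freq k)%:~R)).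
Proof.
move=> gi.
pose c (l : 'I_(n.*2.+1)) := (h * ft_cst)%:C * conjc (V (freq l)).
pose e (l : 'I_(n.*2.+1)) xi : R[i] := cis (- (xi * - (h * (freq l)%:~R))) * g xi.
have ei l : cintegrable (e l) by exact: cintegrable_ft_kernel.
rewrite (@eq_cint _ _ (fun xi => \sum_(l < n.*2.+1) c l * e l xi)); last first.
  move=> xi; rewrite dft_sumE conj_sum mulr_sumr; apply: eq_bigr => l _.
  rewrite conjM [conjc (_%:C * _)]conjM conj_real cis_conj -/(c l) /e opprK.
  rewrite (_ : - (xi * - (h * (freq l)%:~R)) = h * (freq l)%:~R * xi); last by ring.
  by ring.
have [-> _] := @cint_sum _ _ (index_enum 'I_(n.*2.+1))
  (fun l xi => c l * e l xi) (fun l => cintegrableZ (c l) (ei l)).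
rewrite mulr_sumr; apply: eq_bigr => l _; rewrite cintZ// ftE -/(e l) /c rmorphM/=.
by ring.
Qed.

Lemma energy_dft_sum h V n : 0 < h ->
  energy (cut (nyquist h) (dft_sum h V n)) = (denergy h V n)%:E.
Proof.
move=> h0; set S := dft_sum h V n.
have [M SM] := dft_sum_bounded h V n.
have ci : cintegrable (cut (nyquist h) S).
  by apply: (cintegrable_nyquist_bounded h0 _ SM); exact: cmeas_dft_sum.
have cSi : cintegrable (fun xi => conjc (S xi) * cut (nyquist h) S xi).
  apply: (@cintegrable_bounded_mul _ _ _ M) => //.
    by apply: cmeas_conj; exact: cmeas_dft_sum.
  by move=> x; rewrite normc_conj.
have := @cint_mul_conj_dft_sum h V n _ ci.
under [X in _ = _ * X]eq_bigr do
  rewrite ft_cut_dft_sum// mulrC conj_mul_normc.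
rewrite -rmorph_sum -rmorphM => /(congr1 Re) E.
rewrite -[RHS]/((Re (denergy h V n)%:C)%:E) -E.
under [in RHS]eq_cint do rewrite mulrC.
transitivity (\int[mu]_xi (Re (conjc (S xi) * cut (nyquist h) S xi))%:E)%E.
  apply: eq_integral => xi _; rewrite !cutE; case: ifP => _.
    by rewrite mulrC conj_mul_normc.
  by rewrite mulr0 normc_zero expr0n.
by rewrite -[LHS]fineK//; exact: integrable_fin_num (integrable_Re cSi).
Qed.

End trigonometric_sums.

(** * Bessel's inequality and completeness *)

Section bessel.
Context {R : realType}.
Local Notation mu := (@lebesgue_measure R).
Local Notation Re := (@complex.Re R).
Local Notation normc := (@Normc.normc R).
Implicit Types (f g D : R -> R[i]) (h s : R) (V : int -> R[i]) (n : nat).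

(** The values of the transform of [g] at the nodes [- j h]. When [g] is an
    integrable transform these are the grid values of the function it comes from. *)
Definition samples h g (j : int) : R[i] := ft g (- (h * j%:~R)).

Lemma samplesD h f g j : cintegrable f -> cintegrable g ->
  samples h (fun xi => f xi + g xi) j = samples h f j + samples h g j.
Proof. exact: ftD. Qed.

Lemma samplesB h f g j : cintegrable f -> cintegrable g ->
  samples h (fun xi => f xi - g xi) j = samples h f j - samples h g j.
Proof. exact: ftB. Qed.

(** Bessel's inequality by duality: the energy of the samples of [g] is the
    pairing of [g] with the trigonometric sum that they define. *)
Lemma bessel_duality h n g (p q : R -> R[i]) (kappa : R) : 0 < h -> cintegrable g ->
  cmeas p -> cmeas q -> 0 <= kappa ->
  (forall xi, g xi * conjc (dft_sum h (samples h g) n xi) = p xi * q xi) ->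
  (energy p < +oo)%E ->
  (energy q <= (kappa * denergy h (samples h g) n)%:E)%E ->
  ((denergy h (samples h g) n)%:E <= kappa%:E * energy p)%E.
Proof.
move=> h0 gi mp mq k0 gpq; set X := denergy h _ n => py qX.
have X0 : 0 <= X by exact: denergy_ge0.
have qy : (energy q < +oo)%E by apply: le_lt_trans qX _; exact: ltry.
have Xpq : (X%:E <= L2norm setT p * L2norm setT q)%E.
  have := cauchy_schwarz_cint mp mq; rewrite !L2norm_fin => /(_ py qy); apply: le_trans.
  rewrite -(eq_cint gpq) cint_mul_conj_dft_sum// lee_fin.
  apply: le_trans (Re_le_normc _); apply: le_trans (ler_norm _).
  rewrite le_eqVlt; apply/orP; left; apply/eqP.
  under eq_bigr do rewrite -/(samples h g _) mulrC conj_mul_normc.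
  by rewrite -rmorph_sum -rmorphM.
have [->|Xn0] := eqVneq X 0; first by rewrite mule_ge0 ?energy_ge0.
have {}X0 : 0 < X by rewrite lt_neqAle eq_sym Xn0.
have pE : (energy p)%E = (fine (energy p))%:E by rewrite fineK// ge0_fin_numE ?energy_ge0.
have : (X%:E * X%:E <= energy p * (kappa * X)%:E)%E.
  apply: (@le_trans _ _ (energy p * energy q)%E); last first.
    by apply: lee_wpmul2l => //; exact: energy_ge0.
  rewrite -(@sqr_sqrte _ (energy p * energy q)%E); last by rewrite mule_ge0 ?energy_ge0.
  rewrite sqrteM ?energy_ge0// -!L2normE expe2.
  by apply: lee_pmul => //; rewrite lee_fin ltW.
rewrite pE -!EFinM !lee_fin; set e := fine _.
by rewrite [e * _]mulrA ler_pM2r// [e * _]mulrC.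
Qed.

(** Here the energy of the trigonometric sum over a period is known exactly, so that
    duality loses nothing. *)
Lemma bessel h D n : 0 < h -> cmeas D -> (energy (cut (nyquist h) D) < +oo)%E ->
  ((denergy h (samples h (cut (nyquist h) D)) n)%:E <= energy (cut (nyquist h) D))%E.
Proof.
move=> h0 mD Dy; have mN := @measurable_nyquist R h.
have mc := cmeas_cut mN mD.
have ci : cintegrable (cut (nyquist h) D).
  by apply: cintegrable_nyquist_L2 => //; split; rewrite // L2norm_cut L2norm_fin.
set V := samples h _.
rewrite -[leRHS]mul1e.
apply: (@bessel_duality h n _ _ (fun xi => conjc (cut (nyquist h) (dft_sum h V n) xi))) => //.
- by apply: cmeas_conj; apply: cmeas_cut => //; exact: cmeas_dft_sum.
- move=> xi; rewrite !cutE; case: ifP => // _.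
  by rewrite !mul0r.
- rewrite mul1r -energy_dft_sum// le_eqVlt; apply/orP; left; apply/eqP.
  by apply: eq_energy => x; rewrite normc_conj.
Qed.

(** The translates of [[c, c + p]] by the multiples of [p] cover the line. *)
Lemma integral_le_periods (p c : R) (phi : R -> \bar R) : 0 < p -> measurable_fun setT phi ->
  (forall x, 0 <= phi x)%E ->
  (\int[mu]_x phi x <= \sum_(0 <= n <oo) (
     \int[mu]_(x in `[c, (c + p)%R]) phi (x + n%:R * p)%R +
     \int[mu]_(x in `[c, (c + p)%R]) phi (x - n.+1%:R * p)%R))%E.
Proof.
move=> p0 mphi phi0.
pose I : set R := `[c, c + p]%classic.
have mI : measurable I by exact: measurable_itv.
have mIs (t : R) : measurable_fun setT (fun x : R => (\1_I (x + t) : R)%:E).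
  apply/measurable_EFinP; apply: (@measurableT_comp _ _ _ _ _ _ (\1_I : R -> R)).
    exact: measurable_indic.
  exact: measurable_funD.
pose T (t : R) x := ((\1_I (x + t))%:E * phi x)%E.
have mT t : measurable_fun setT (T t) by apply: emeasurable_funM.
have T0 t x : (0 <= T t x)%E by rewrite mule_ge0// lee_fin indicE.
have TE (t : R) : (\int[mu]_x T (- t)%R x = \int[mu]_(x in I) phi (x + t)%R)%E.
  rewrite -(integral_translate t (mT _) (T0 _)) [RHS]integral_mkcond.
  apply: eq_integral => x _; rewrite /T patchE indicE addrK.
  by case: ifP; rewrite ?mul1e ?mul0e.
have TE' (t : R) : (\int[mu]_x T t x = \int[mu]_(x in I) phi (x - t)%R)%E.
  by rewrite -{1}(opprK t) TE.
pose G n x := (T (- (n%:R * p))%R x + T (n.+1%:R * p)%R x)%E.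
have mG n : measurable_fun setT (G n) by exact: emeasurable_funD.
have G0 n x : (0 <= G n x)%E by rewrite adde_ge0.
have -> : (\sum_(0 <= n <oo) (
     \int[mu]_(x in `[c, (c + p)%R]) phi (x + n%:R * p)%R +
     \int[mu]_(x in `[c, (c + p)%R]) phi (x - n.+1%:R * p)%R) = \int[mu]_x \sum_(0 <= n <oo) G n x)%E.
  rewrite integral_nneseries//; apply: eq_eseriesr => n _.
  rewrite -[RHS]/(\int[mu]_x (T (- (n%:R * p))%R x + T (n.+1%:R * p)%R x))%E.
  rewrite ge0_integralD//; [|exact: mT|exact: mT].
  by congr (_ + _)%E; apply: esym; [exact: TE|exact: TE'].
apply: ge0_le_integral => //.
  by apply: ge0_emeasurable_sum => // n _; exact: mG.
move=> x _.
have Gle n : (G n x <= \sum_(0 <= k <oo) G k x)%E.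
  by rewrite (nneseriesD1 (n := n))// leeDl// nneseries_ge0.
have key : exists n, (phi x <= G n x)%E.
  (* [j] is the index of the translate that contains [x] *)
  pose j := Num.floor ((x - c) / p).
  have /andP[j1 j2] : j%:~R <= (x - c) / p < (j + 1)%:~R.
    by rewrite Num.Theory.floor_le_tmp Num.Theory.lt_succ_floor.
  have Tphi t : I (x + t) -> (T t x = phi x)%E.
    by move=> It; rewrite /T indicE mem_set// mul1e.
  move: j1 j2; rewrite ler_pdivlMr// ltr_pdivrMr// rmorphD/=.
  case: (j) => m j1 j2.
    exists m; rewrite -(Tphi (- (m%:R * p))) ?leeDl//.
    by rewrite /I/= in_itv/=; move: j1 j2; rewrite mulrDl mul1r -pmulrn => j1 j2; apply/andP; split; lra.
  exists m; rewrite -(Tphi (m.+1%:R * p)) ?leeDr//.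
  move: j1 j2; rewrite NegzE mulrNz -pmulrn mulrDl mul1r !mulNr => j1 j2.
  by rewrite /I/= in_itv/=; apply/andP; split; lra.
by have [n /le_trans] := key; apply; exact: Gle.
Qed.

End bessel.

Section completeness.
Context {R : realType}.
Local Notation mu := (@lebesgue_measure R).
Local Notation normc := (@Normc.normc R).
Implicit Types (f g D : R -> R[i]) (h s : R) (V W : int -> R[i]) (n : nat).

Lemma derivative_le1_lipschitz (f df : R -> R) : (forall x : R, is_derive x 1 f (df x)) ->
  (forall x, `|df x| <= 1) -> forall x y, `|f x - f y| <= `|x - y|.
Proof.
move=> fdf df1 x y; wlog xy : x y / x < y.
  move=> H; have [xy|yx|->] := ltgtP x y; first exact: H.
    by rewrite distrC [leRHS]distrC; exact: H.
  by rewrite !subrr.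
have cf : {within `[x, y], continuous f}.
  by apply: derivable_within_continuous => z _; have [] := fdf z.
have [c _ e] := MVT xy (fun z _ => fdf z) cf.
by rewrite distrC e normrM [leRHS]distrC ler_piMl.
Qed.

Lemma cos_lipschitz (x y : R) : `|cos x - cos y| <= `|x - y|.
Proof.
apply: (derivative_le1_lipschitz (@is_derive_cos R)) => z.
by rewrite normrN ler_norml sin_geN1 sin_le1.
Qed.

Lemma sin_lipschitz (x y : R) : `|sin x - sin y| <= `|x - y|.
Proof.
apply: (derivative_le1_lipschitz (@is_derive_sin R)) => z.
by rewrite ler_norml cos_geN1 cos_le1.
Qed.

Lemma cis_lipschitz (x y : R) : normc (cis x - cis y) <= 2 * `|x - y|.
Proof.
apply: (le_trans (normc_le_ReIm _)); rewrite ReD ImD ReN ImN !cisE mulr_natl mulr2n.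
by apply: lerD; [exact: cos_lipschitz|exact: sin_lipschitz].
Qed.

Lemma sum_freqE (M : zmodType) (F : int -> M) n :
  \sum_(k < n.*2.+1) F (freq k) = F 0 + \sum_(0 <= k < n) (F k.+1%:Z + F (- k.+1%:Z)).
Proof.
rewrite big_split/= addrA -(big_nat_recl n 0 (fun k : nat => F k%:Z))//= [LHS]/=.
rewrite -(big_mkord xpredT (fun k => F (k%:Z - n%:Z))) (@big_cat_nat _ _ _ n)//=; last first.
  by rewrite -addnn; apply: leqW; exact: leq_addr.
rewrite addrC; congr (_ + _).
  rewrite -{1}[n]add0n big_addn (_ : n.*2.+1 - n = n.+1)%N; last first.
    by rewrite -addnn subSn ?leq_addr// addnK.
  by apply: eq_bigr => k _; rewrite PoszD addrK.
rewrite big_nat_rev/= add0n big_nat [RHS]big_nat; apply: eq_bigr => k /andP[_ kn]; congr F.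
by rewrite -subzn// addrAC subrr sub0r.
Qed.

Lemma sum_freq (F : int -> R) n : (forall j, 0 <= F j) ->
  \sum_(0 <= k < n) (F k%:Z + F (- (k.+1%:Z))) <= \sum_(k < n.*2.+1) F (freq k).
Proof.
move=> F0; rewrite sum_freqE !big_split/= addrA lerD2r.
by rewrite -(big_nat_recl n 0 (fun k : nat => F k%:Z))// big_nat_recr//= lerDl.
Qed.

Lemma ft_modulate s f y : cintegrable f ->
  ft (fun xi => cis (s * xi) * f xi) y = ft f (y - s).
Proof.
move=> fi; rewrite !ftE; congr (_ * _); apply: eq_cint => x.
by rewrite mulrA -cisD; congr (cis _ * _); ring.
Qed.

Lemma dft_sumD h V W n xi :
  dft_sum h (fun j => V j + W j) n xi = dft_sum h V n xi + dft_sum h W n xi.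
Proof.
by rewrite !dft_sumE -big_split/=; apply: eq_bigr => k _; rewrite mulrDr mulrDl.
Qed.

Lemma L2norm_dft_sum h V n : 0 < h ->
  (L2norm setT (cut (nyquist h) (dft_sum h V n)) = (Num.sqrt (denergy h V n))%:E)%E.
Proof. by move=> h0; rewrite L2normE energy_dft_sum. Qed.

(** Minkowski's inequality for grid functions, transported from trigonometric sums. *)
Lemma sqrt_denergyD h V W n : 0 < h ->
  Num.sqrt (denergy h (fun j => V j + W j) n) <=
  Num.sqrt (denergy h V n) + Num.sqrt (denergy h W n).
Proof.
move=> h0; rewrite -lee_fin EFinD -!L2norm_dft_sum//.
have mN := @measurable_nyquist R h.
have mc U : cmeas (cut (nyquist h) (dft_sum h U n)).
  by apply: cmeas_cut => //; exact: cmeas_dft_sum.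
apply: le_trans (L2normD (mc V) (mc W)).
rewrite le_eqVlt; apply/orP; left; apply/eqP; apply: eq_L2norm => x; congr (normc _).
by rewrite /cut dft_sumD mulrDr.
Qed.

Lemma eq_denergy h V W n : V =1 W -> denergy h V n = denergy h W n.
Proof. by move=> /funext ->. Qed.

(** The exponentials are complete on the Nyquist interval: [D] is controlled by its
    samples. By inversion, [D] has no more energy than [ft D], whose energy is the mean
    over one period of the energy [Q s] of the samples of [ft D] on the grid shifted
    by [s]. Bessel's inequality bounds [Q s] by the energy of [D], for every [s]. Hence
    [Q s] cannot be much smaller than the energy of [D], not even for [s] close to 0,
    where it is close to the energy of the samples on the grid itself. *)
Lemma nyquist_parseval h D (eps : R) : 0 < h -> 0 <= eps -> cmeas D ->
  (L2norm setT (cut (nyquist h) D) < +oo)%E ->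
  (forall n, denergy h (samples h (cut (nyquist h) D)) n <= eps ^+ 2) ->
  (L2norm setT (cut (nyquist h) D) <= eps%:E)%E.
Proof.
move=> h0 e0 mD Dy De; have mN := @measurable_nyquist R h.
set D' := cut _ D in Dy De *; have mD' : cmeas D' by exact: cmeas_cut.
have cutD' : cut (nyquist h) D' = D'.
  by apply/funext => x; rewrite cutE; case: ifP => // xN; rewrite /D' cutE xN.
have D'i : cintegrable D'.
  by rewrite -cutD'; apply: L2_cut_cintegrable; [exact/ltW/nyquistP|].
pose d := fine (L2norm setT D').
have dE : L2norm setT D' = d%:E by rewrite fineK// ge0_fin_numE ?L2norm_ge0.
have d0 : 0 <= d by rewrite -lee_fin -dE L2norm_ge0.
have dd : energy D' = (d ^+ 2)%:E by rewrite -L2norm_sqr dE -EFin_expe.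
rewrite dE lee_fin.
(* Modulation by [cis (s * xi)] shifts the grid by [s]. *)
pose Ds s xi := cis (s * xi) * D' xi.
have mDs s : cmeas (Ds s) by apply: cmeasM => //; exact: cmeas_cisl.
have Dsi s : cintegrable (Ds s) by apply: cintegrable_cis => //; exact: measurable_funM.
have cutDs s : cut (nyquist h) (Ds s) = Ds s.
  apply/funext => x; rewrite cutE; case: ifP => // xN.
  by rewrite /Ds /D' cutE xN mulr0.
have DsE s : energy (Ds s) = energy D'.
  by apply: eq_energy => x; rewrite [LHS]Normc.normcM normc_cis mul1r.
have Q1 s n : denergy h (samples h (Ds s)) n <= d ^+ 2.
  rewrite -lee_fin -dd -(DsE s) -{2}cutDs -{1}cutDs; apply: bessel => //.
  by rewrite cutDs DsE dd ltry.
pose a := pi / h.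
have a0 : 0 < a by rewrite divr_gt0// pi_gt0.
have Q2 s n : 0 <= s -> denergy h (samples h (Ds s)) n <= (eps + 2 * s * a * d) ^+ 2.
  move=> s0; pose W xi := Ds s xi - D' xi.
  have mW : cmeas W by exact: cmeasB.
  have Wi : cintegrable W by exact: cintegrableB.
  have cutW : cut (nyquist h) W = W.
    apply/funext => x; rewrite cutE; case: ifP => // xN.
    by rewrite /W /Ds /D' cutE xN mulr0 subrr.
  have c0 : 0 <= 2 * s * a by apply: mulr_ge0; [exact: mulr_ge0|exact: ltW].
  have c0d : 0 <= 2 * s * a * d by exact: mulr_ge0.
  have WD : (L2norm setT W <= (2 * s * a * d)%:E)%E.
    have -> : ((2 * s * a * d)%:E = L2norm setT (fun x => (2 * s * a)%:C * D' x)%R)%E.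
      by rewrite L2normZ// normc_real ger0_norm// dE -EFinM.
    apply: L2norm_le => //; first by apply: cmeasM => //; exact: cmeas_cst.
    move=> x; rewrite Normc.normcM normc_real (ger0_norm c0).
    have -> : W x = (cis (s * x) - cis 0) * D' x by rewrite cis0 mulrBl mul1r.
    rewrite Normc.normcM /D' cutE; case: ifP => [|_]; last by rewrite normc_zero !mulr0.
    rewrite inE /nyquist/= in_itv/= -/a => xa.
    apply: ler_wpM2r; first exact: normc_ge0.
    apply: (le_trans (cis_lipschitz _ _)); rewrite subr0 normrM (ger0_norm s0) -mulrA.
    by rewrite ler_pM2l//; apply: ler_wpM2l => //; rewrite ler_norml.
  have sE : samples h (Ds s) =1 fun j => samples h D' j + samples h W j.
    have DW : Ds s = fun x => D' x + W x.
      by apply/funext => x; rewrite /W [RHS]addrC subrK.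
    by move=> j; rewrite DW; exact: samplesD.
  have dW : Num.sqrt (denergy h (samples h W) n) <= 2 * s * a * d.
    rewrite -(ger0_norm c0d) -sqrtr_sqr; apply: ler_wsqrtr.
    rewrite -lee_fin; apply: (@le_trans _ _ (energy W)); last first.
      by rewrite -L2norm_leP.
    rewrite -cutW; apply: bessel => //.
    by rewrite cutW -L2norm_fin; apply: le_lt_trans WD _; exact: ltry.
  have q0 := denergy_ge0 (samples h (Ds s)) n h0.
  rewrite -(sqr_sqrtr q0) ler_pXn2r ?nnegrE ?sqrtr_ge0//; last exact: addr_ge0.
  rewrite (eq_denergy _ _ sE); apply: (le_trans (sqrt_denergyD _ _ _ h0)).
  apply: lerD => //.
  by rewrite -(ger0_norm e0) -sqrtr_sqr; apply: ler_wsqrtr.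
(* On the period, the bound [Q2] is used up to [s0], and the bound [Q1] beyond. *)
have main s0 : 0 < s0 -> s0 < h -> d <= eps + 2 * s0 * a * d.
  move=> s00 s0h; pose al := (eps + 2 * s0 * a * d) ^+ 2.
  have al0 : 0 <= al by exact: sqr_ge0.
  pose phi x : \bar R := (normc (ft D' (- x)) ^+ 2)%:E.
  have mphi : measurable_fun setT phi.
    by apply: measurable_energy; apply: cmeas_opp; exact: cmeas_ft.
  have phi0 x : (0 <= phi x)%E by rewrite lee_fin sqr_ge0.
  have Dphi : (energy D' <= \int[mu]_x phi x)%E.
    have zi : cintegrable (fun=> 0 : R[i]).
      by have := cintegrableB D'i D'i; under eq_fun do rewrite subrr.
    have ft0 (y : R) : ft (fun=> 0 : R[i]) y = 0.
      by rewrite -[RHS](subrr (ft D' y)) -ftB//; congr (ft _ y); apply/funext => x; rewrite subrr.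
    rewrite -[leRHS]/(energy (fun x => ft D' (- x))) energy_reflect; last exact: cmeas_ft.
    have := inversion_le D'i zi.
    by under [X in (energy X <= _)%E]eq_fun do rewrite ft0 subr0;
      under [X in (_ <= energy X)%E]eq_fun do rewrite subr0.
  pose I : set R := `[0, 0 + h]%classic.
  pose b s : R := al * \1_`[0, s0] s + d ^+ 2 * \1_`[s0, h] s.
  have mind (u v : R) : measurable (`[u, v]%classic : set R) by exact: measurable_itv.
  have indI (u v : R) : u <= v -> (\int[mu]_x (\1_`[u, v] x)%:E = (v - u)%:E)%E.
    by move=> uv; rewrite integral_indic// setIT; exact: mu_segment.
  have mi (u v : R) : measurable_fun setT (fun x : R => (\1_`[u, v] x : R)%:E).
    by apply/measurable_EFinP; exact: measurable_indic.
  have mb : measurable_fun setT (fun x : R => (b x)%:E).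
    by apply/measurable_EFinP; apply: measurable_funD; apply: measurable_funM => //;
      exact: measurable_indic.
  have b0 x : 0 <= b x by rewrite addr_ge0// mulr_ge0 ?sqr_ge0// indicE.
  have bI : (\int[mu]_x (b x)%:E = (al * s0 + d ^+ 2 * (h - s0))%:E)%E.
    transitivity (al%:E * \int[mu]_x (\1_`[0%R, s0] x)%:E +
        (d ^+ 2)%:E * \int[mu]_x (\1_`[s0, h] x)%:E)%E; last first.
      by rewrite !indI ?(ltW s0h) ?(ltW s00)// subr0 -!EFinM -EFinD.
    have i0 (u v x : R) : (0 <= (\1_`[u, v] x : R)%:E)%E by rewrite lee_fin indicE ler0n.
    have Zi (c u v : R) : 0 <= c -> (c%:E * \int[mu]_x (\1_`[u, v] x)%:E =
        \int[mu]_x (c%:E * (\1_`[u, v] x)%:E))%E.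
      by move=> c0; rewrite ge0_integralZl_EFin//; exact: mi.
    rewrite !Zi ?sqr_ge0// -ge0_integralD//.
    - move=> x _; apply: mule_ge0; first by rewrite lee_fin.
      rewrite lee_fin indicE; exact: ler0n.
    - by apply: measurable_funeM; exact: mi.
    - move=> x _; apply: mule_ge0; first by rewrite lee_fin sqr_ge0.
      by rewrite lee_fin indicE ler0n.
    - by apply: measurable_funeM; exact: mi.
  have sumle N s : I s -> (\sum_(0 <= n < N) (phi (s + n%:R * h)%R + phi (s - n.+1%:R * h)%R)
      <= (h^-1 * b s)%:E)%E.
    rewrite /I add0r /= in_itv/= => /andP[s_ge0 sh].
    pose F j := normc (samples h (Ds s) j) ^+ 2.
    have FE j : normc (ft D' (- (s + h * j%:~R))) ^+ 2 = F j.
      by rewrite /F /samples ft_modulate//; congr (normc (ft D' _) ^+ 2); ring.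
    apply: (@le_trans _ _ (\sum_(0 <= n < N) (F n%:Z + F (- n.+1%:Z)))%:E).
      rewrite -sumEFin; apply: lee_sum => n _; rewrite EFinD /phi -!FE.
      rewrite le_eqVlt; apply/orP; left; apply/eqP.
      congr ((normc (ft D' (- _)) ^+ 2)%:E + (normc (ft D' (- _)) ^+ 2)%:E)%E.
        by rewrite -pmulrn mulrC.
      by rewrite mulrNz mulrN -pmulrn mulrC.
    rewrite lee_fin; apply: (le_trans (@sum_freq F N (fun=> sqr_ge0 _))).
    rewrite ler_pdivlMl// -/(denergy h (samples h (Ds s)) N) /b.
    have [ss0|s0s] := leP s s0.
      rewrite [\1_`[0, s0] s]indicE mem_set/= ?in_itv/= ?s_ge0// mulr1.
      apply: (@le_trans _ _ al); last by rewrite lerDl mulr_ge0 ?sqr_ge0// indicE.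
      apply: (le_trans (Q2 s N s_ge0)).
      have pos t : 0 <= t -> 0 <= eps + 2 * t * a * d.
        move=> t0; apply: addr_ge0 => //; apply: mulr_ge0 => //.
        by apply: mulr_ge0; [exact: mulr_ge0|exact: ltW].
      rewrite /al ler_pXn2r ?nnegrE ?pos ?(ltW s00)//.
      rewrite lerD2l; apply: ler_wpM2r => //; apply: ler_wpM2r; first exact: ltW.
      by rewrite ler_pM2l.
    rewrite [\1_`[s0, h] s]indicE mem_set/= ?in_itv/= ?(ltW s0s)// mulr1.
    by apply: (le_trans (Q1 s N)); rewrite lerDr mulr_ge0// indicE.
  have : (energy D' <= h^-1%:E * (al * s0 + d ^+ 2 * (h - s0))%:E)%E.
    apply: (le_trans Dphi); apply: (le_trans (integral_le_periods 0 h0 mphi phi0)).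
    have mph (t : R) : measurable_fun setT (fun x : R => phi (x + t)).
      by apply: (measurableT_comp mphi); exact: measurable_funD.
    have mhb : measurable_fun setT (fun x : R => (h^-1 * b x)%:E).
      by apply/measurable_EFinP; apply: measurable_funM; [exact: measurable_cst|exact/measurable_EFinP].
    have mIm : measurable I by exact: measurable_itv.
    apply: lime_le.
      apply: is_cvg_nneseries => n _ _; apply: adde_ge0; exact: integral_ge0.
    apply: nearW => N.
    apply: (@le_trans _ _ (\int[mu]_(s in I) (h^-1 * b s)%:E)%E); last first.
      rewrite -bI -ge0_integralZl_EFin ?invr_ge0 ?(ltW h0)//; last first.
        by move=> x _; rewrite lee_fin.
      under [leRHS]eq_integral do rewrite -EFinM.
      apply: ge0_subset_integral => //.
      by move=> x _; rewrite lee_fin mulr_ge0// invr_ge0 ltW.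
    apply: (@le_trans _ _ (\int[mu]_(s in I)
        \sum_(0 <= n < N) (phi (s + n%:R * h)%R + phi (s - n.+1%:R * h)%R))%E).
      rewrite le_eqVlt; apply/orP; left; apply/eqP.
      rewrite ge0_integral_sum//; last 2 first.
      - by move=> n; apply: emeasurable_funD; apply: measurable_funTS; exact: mph.
      - by move=> n x _; exact: adde_ge0.
      apply: eq_bigr => n _; rewrite ge0_integralD//; apply: measurable_funTS; exact: mph.
    apply: ge0_le_integral => //.
    - by move=> x _; apply: sume_ge0 => n _; exact: adde_ge0.
    - by apply: emeasurable_sum => n; apply: emeasurable_funD; apply: measurable_funTS; exact: mph.
    - by apply: measurable_funTS; exact: mhb.
    - by move=> s Is; exact: sumle.
  rewrite dd -EFinM lee_fin ler_pdivlMl//.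
  have -> : (h * d ^+ 2 <= al * s0 + d ^+ 2 * (h - s0)) = (s0 * d ^+ 2 <= s0 * al).
    by apply/idP/idP => ?; lra.
  rewrite ler_pM2l// /al ler_pXn2r// nnegrE//.
  apply: addr_ge0 => //; apply: mulr_ge0 => //.
  by apply: mulr_ge0; [apply: mulr_ge0 => //; exact: ltW|exact: ltW].
(* [s0] tends to 0 *)
apply/ler_addgt0Pr => e e00.
have c0 : 0 < 2 * a * d + 1.
  by apply: ltr_wpDl => //; apply: mulr_ge0 => //; apply: mulr_ge0 => //; exact: ltW.
pose s0 := Num.min (h / 2) (e / (2 * a * d + 1)).
have s00 : 0 < s0 by rewrite lt_min !divr_gt0.
have s0h : s0 < h by rewrite gt_min ltr_pdivrMr// ltr_pMr// ltr1n.
apply: (le_trans (main _ s00 s0h)); rewrite lerD2l.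
have s0e : s0 <= e / (2 * a * d + 1) by rewrite ge_min lexx orbT.
apply: (@le_trans _ _ (s0 * (2 * a * d + 1))); last by rewrite -ler_pdivlMr.
have -> : 2 * s0 * a * d = s0 * (2 * a * d) by ring.
by rewrite ler_pM2l// lerDl.
Qed.

End completeness.

(** * Aliasing *)

Section aliasing.
Context {R : realType}.
Local Notation mu := (@lebesgue_measure R).
Local Notation normc := (@Normc.normc R).
Implicit Types (f g D : R -> R[i]) (a h s : R) (V W : int -> R[i]) (n : nat).

Lemma powR_antitone s (x y : R) : 0 <= s -> 0 < x -> x <= y -> y `^ (- s) <= x `^ (- s).
Proof.
move=> s0 x0 xy; have y0 := lt_le_trans x0 xy.
rewrite !powRN lef_pV2 ?posrE ?powR_gt0//.
by apply: ge0_ler_powR => //; rewrite nnegrE ltW.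
Qed.

(** A bound on the sum of the series of general term [k ^ (- s)], for [k >= 1]. *)
Definition tail_sum s : R := 1 + (s - 1)^-1.

(** Comparison with the integral of [x ^ (- s)], one term at a time. *)
Lemma pseries_le s N : 1 < s ->
  \sum_(0 <= k < N) k.+1%:R `^ (- s) <= tail_sum s.
Proof.
rewrite /tail_sum => s1; have s10 : 0 < s - 1 by rewrite subr_gt0.
case: N => [|N]; first by rewrite big_nil addr_ge0// invr_ge0 ltW.
apply: (@le_trans _ _ (1 + (s - 1)^-1 * (1 - N.+1%:R `^ (1 - s)))); last first.
  by rewrite lerD2l ler_piMr ?invr_ge0 ?(ltW s10)// gerBl powR_ge0.
elim: N => [|N IH].
  by rewrite big_nat1 !powR1 subrr mulr0 addr0.
rewrite big_nat_recr//=; apply: (le_trans (lerD IH (lexx _))).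
rewrite -addrA lerD2l.
have x0 : 0 < N.+1%:R :> R by rewrite ltr0n.
have xy : N.+1%:R < N.+2%:R :> R by rewrite ltr_nat.
have dF (x : R) : 0 < x -> is_derive x 1 (fun x => x `^ (1 - s)) ((1 - s) * x `^ (- s)).
  move=> xp; apply: is_derive_eq; first exact: is_derive1_powR.
  by congr (_ * _ `^ _); ring.
have dI (z : R) : z \in `]N.+1%:R, N.+2%:R[ ->
    is_derive z 1 (fun x => x `^ (1 - s)) ((1 - s) * z `^ (- s)).
  by rewrite in_itv/= => /andP[+ _] => /(lt_trans x0)/dF.
have cF : {within `[N.+1%:R, N.+2%:R], continuous (fun x : R => x `^ (1 - s))}.
  apply: derivable_within_continuous => z; rewrite in_itv/= => /andP[zx _].
  by have [] := dF z (lt_le_trans x0 zx).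
have [c cI e] := MVT xy dI cF.
move: cI; rewrite in_itv/= => /andP[c1 c2].
have cs := powR_antitone (ltW (lt_trans ltr01 s1)) (lt_trans x0 c1) (ltW c2).
move: e; rewrite -[X in _ * X](_ : 1 = _); last by rewrite -natr1; ring.
rewrite mulr1 => e.
have -> : N.+2%:R `^ (1 - s) = N.+1%:R `^ (1 - s) + (1 - s) * c `^ (- s) :> R.
  by rewrite -e; ring.
have -> : (s - 1)^-1 * (1 - (N.+1%:R `^ (1 - s) + (1 - s) * c `^ (- s))) =
   (s - 1)^-1 * (1 - N.+1%:R `^ (1 - s)) + c `^ (- s).
  by field; exact: lt0r_neq0.
by rewrite lerD2l.
Qed.

(** Outside of a period the weight [|x| ^ (- s)] makes the contributions of the
    other periods summable. *)
Lemma periodic_tail_le a s (F : R -> R) : 0 < a -> 1 < s -> measurable_fun setT F ->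
  (forall x, 0 <= F x) -> (forall x, F (x + 2 * a) = F x) ->
  (\int[mu]_x (if (a < `|x|)%R then `|x| `^ (- s) * F x else 0)%:E <=
    (2 * tail_sum s * a `^ (- s))%:E * \int[mu]_(x in `[(- a)%R, a]) (F x)%:E)%E.
Proof.
move=> a0 s1 mF F0 Fper.
have s0 : 0 <= s by apply/ltW/(lt_trans _ s1).
have perP n x : F (x + n%:R * (2 * a)) = F x.
  elim: n => [|n IH]; first by rewrite mul0r addr0.
  by rewrite -natr1 mulrDl mul1r addrA Fper.
have perN n x : F (x - n%:R * (2 * a)) = F x.
  by rewrite -(perP n (x - _)) subrK.
pose r x : R := if a < `|x| then `|x| `^ (- s) * F x else 0.
have r0 x : 0 <= r x by rewrite /r; case: ifP => // _; rewrite mulr_ge0 ?powR_ge0.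
have mr : measurable_fun setT r.
  apply: measurable_fun_ifT => //.
    by apply: measurable_fun_ltr => //; exact: normr_measurable.
  apply: measurable_funM => //.
  apply: (@measurableT_comp _ _ _ _ _ _ (fun y : R => y `^ (- s)) _ (fun x : R => `|x|)).
    exact: measurable_powR.
  exact: normr_measurable.
have p0 : 0 < 2 * a by rewrite mulr_gt0.
pose I := (\int[mu]_(x in `[(- a)%R, a]) (F x)%:E)%E.
have I0 : (0 <= I)%E by apply: integral_ge0 => x _; rewrite lee_fin.
have aa : - a + 2 * a = a by ring.
have step (c t : R) : 0 <= c -> (forall x, - a <= x <= a -> r (x + t) <= c * F x) ->
    (\int[mu]_(x in `[(- a)%R, a]) (r (x + t))%:E <= c%:E * I)%E.
  move=> c0 H; rewrite -ge0_integralZl_EFin//; last first.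
    by apply/measurable_EFinP; exact: measurable_funTS.
    by move=> x _; rewrite lee_fin.
  apply: ge0_le_integral => //.
  - by move=> x _; rewrite lee_fin.
  - apply/measurable_EFinP; apply: measurable_funTS.
    by apply: (measurableT_comp mr); exact: measurable_funD.
  - by apply/measurable_EFinP; apply: measurable_funTS; exact: measurable_funM.
pose b n : R := a `^ (- s) * n.+1%:R `^ (- s).
have b0 n : 0 <= b n by rewrite mulr_ge0 ?powR_ge0.
have bE n : b n = (n.+1%:R * a) `^ (- s) by rewrite powRM ?(ltW a0)// mulrC.
have bound n (y z : R) : n.+1%:R * a <= `|y| -> F y = F z -> r y <= b n * F z.
  move=> ny Fyz; rewrite /r; case: ifP => _; last by rewrite mulr_ge0.
  rewrite Fyz ler_wpM2r// bE; apply: powR_antitone => //.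
  by rewrite mulr_gt0// ltr0n.
have na n : 0 <= n%:R * a by rewrite mulr_ge0// ltW.
have right n : (\int[mu]_(x in `[(- a)%R, a]) (r (x + n.+1%:R * (2 * a))%R)%:E <= (b n)%:E * I)%E.
  apply: step => // x /andP[x1 x2]; apply: bound => //.
  apply: le_trans (ler_norm _); have := na n.
  by rewrite -natr1; lra.
have left n : (\int[mu]_(x in `[(- a)%R, a]) (r (x - n.+1%:R * (2 * a))%R)%:E <= (b n)%:E * I)%E.
  apply: step => // x /andP[x1 x2]; apply: bound => //.
  rewrite -normrN; apply: le_trans (ler_norm _); have := na n.
  by rewrite -natr1; lra.
have center : (\int[mu]_(x in `[(- a)%R, a]) (r (x + 0%:R * (2 * a))%R)%:E <= 0)%E.
  have := @step 0 0 (lexx 0) _; rewrite mul0e mul0r; apply => x xa.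
  by rewrite addr0 mul0r /r ltNge ler_norml xa.
have mre : measurable_fun setT (EFin \o r) by exact/measurable_EFinP.
apply: (le_trans (@integral_le_periods _ (2 * a) (- a) (EFin \o r) p0 mre _)).
  by move=> x; rewrite lee_fin.
rewrite aa; apply: lime_le.
  by apply: is_cvg_nneseries => n _ _; apply: adde_ge0; apply: integral_ge0 => x _; rewrite lee_fin.
apply: nearW => N.
pose B := \sum_(0 <= k < N) b k.
have BI : (\sum_(0 <= k < N) (b k)%:E * I = B%:E * I)%E.
  rewrite -ge0_sume_distrl ?sumEFin// => k _; exact: b0.
have B_le : B <= tail_sum s * a `^ (- s).
  by rewrite /B -mulr_sumr mulrC ler_wpM2r ?powR_ge0// pseries_le.
apply: (@le_trans _ _ (B%:E * I + B%:E * I)%E); last first.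
  rewrite -ge0_muleDl ?lee_fin ?sumr_ge0//.
  by apply: lee_wpmul2r => //; rewrite -EFinD lee_fin -mulrA mulr_natl mulr2n lerD.
rewrite big_split/=; apply: leeD; last first.
  by rewrite -BI; apply: lee_sum => n _; exact: left.
rewrite -BI; case: (N) => [|M]; first by rewrite !big_nil.
rewrite big_nat_recl//= -[leRHS]add0e; apply: leeD => //.
rewrite [leRHS]big_nat_recr//= -[leLHS]adde0; apply: leeD; last by rewrite mule_ge0// lee_fin.
by apply: lee_sum => n _; exact: right.
Qed.

End aliasing.

Section sampling_weights.
Context {R : realType}.
Local Notation mu := (@lebesgue_measure R).
Local Notation normc := (@Normc.normc R).
Implicit Types (f g D : R -> R[i]) (a h s : R) (V W : int -> R[i]) (n : nat).

(** For the transform [g] of [v], the L2 norm of [weighted s g] is the norm of [v] in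
    the Sobolev space of order [s]. *)
Definition weighted s g : R -> R[i] := fun xi => ((1 + xi ^+ 2) `^ (s / 2))%:C * g xi.

(** It is square-integrable for [s > 1/2] only: both the integrability of the
    transform of a Sobolev function and the bound on aliasing rest on this. *)
Definition far a s : R -> R := fun xi => if a < `|xi| then `|xi| `^ (- s) else 0.

Lemma measurable_abs_powR s : measurable_fun setT (fun x : R => `|x| `^ s).
Proof.
apply: (@measurableT_comp _ _ _ _ _ _ (fun y : R => y `^ s) _ (fun x : R => `|x|)).
  exact: measurable_powR.
exact: normr_measurable.
Qed.

Lemma cmeas_far a s : cmeas (fun xi => (far a s xi)%:C).
Proof.
apply: cmeas_real; apply: measurable_fun_ifT => //.
  by apply: measurable_fun_ltr => //; exact: normr_measurable.
exact: measurable_abs_powR.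
Qed.

Lemma cmeas_weighted s g : cmeas g -> cmeas (weighted s g).
Proof.
move=> mg; apply: cmeasM => //; apply: cmeas_real.
apply: (@measurableT_comp _ _ _ _ _ _ (fun y : R => y `^ (s / 2)) _ (fun x : R => 1 + x ^+ 2)).
  exact: measurable_powR.
by apply: measurable_funD => //; exact: measurable_funX.
Qed.

Lemma far_weight a s g xi : 0 < a -> (`|xi| <= a -> g xi = 0) ->
  g xi = (far a s xi)%:C * ((`|xi| `^ s)%:C * g xi).
Proof.
move=> a0 gi; rewrite /far; case: ifPn => [ax|]; last first.
  by rewrite -leNgt => /gi ->; rewrite !mulr0.
rewrite mulrA -(rmorphM _ (`|xi| `^ (- s))) powRN mulVf ?mul1r//.
by rewrite gt_eqF// powR_gt0// (lt_trans a0).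
Qed.

Lemma abs_powR_le_weight s (xi : R) : 0 <= s -> `|xi| `^ s <= (1 + xi ^+ 2) `^ (s / 2).
Proof.
move=> s0; have -> : `|xi| `^ s = (xi ^+ 2) `^ (s / 2).
  by rewrite -[xi ^+ 2]real_normK ?num_real// -powR_mulrn// -powRrM; congr (_ `^ _); field.
apply: ge0_ler_powR; rewrite ?nnegrE ?addr_ge0 ?sqr_ge0 ?divr_ge0//.
by rewrite lerDr.
Qed.

Lemma abs_powR_weighted s g xi : 0 <= s ->
  normc ((`|xi| `^ s)%:C * g xi) <= normc (weighted s g xi).
Proof.
move=> s0; rewrite /weighted !Normc.normcM ler_wpM2r ?normc_ge0//.
by rewrite !normc_real !(ger0_norm (powR_ge0 _ _)); exact: abs_powR_le_weight.
Qed.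

Lemma normc_far a s (S : R -> R[i]) xi : normc ((far a s xi)%:C * S xi) ^+ 2 =
  if a < `|xi| then `|xi| `^ (- (2 * s)) * normc (S xi) ^+ 2 else 0.
Proof.
rewrite Normc.normcM normc_real exprMn real_normK ?num_real// /far; case: ifP => _.
  congr (_ * _); rewrite -powR_mulrn ?powR_ge0// -powRrM; congr (_ `^ _); ring.
by rewrite expr0n mul0r.
Qed.

Lemma cis_period (j : int) : cis (2 * pi * j%:~R) = 1 :> R[i].
Proof.
have e : 2 * pi * j%:~R = (pi * j%:~R) *+ 2 :> R by rewrite mulr2n; ring.
apply: complexP; rewrite cisE e [LHS]/=.
- rewrite cos_mulr2n cos2sin2 sin_int expr0n/= subr0 mulr2n; ring.
- by rewrite sin_mulr2n sin_int mulr0 mul0rn.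
Qed.

Lemma dft_sum_periodic h V n xi : 0 < h ->
  dft_sum h V n (xi + 2 * (pi / h)) = dft_sum h V n xi.
Proof.
move=> h0; rewrite !dft_sumE; apply: eq_bigr => k _; congr (_ * _).
rewrite (_ : - (h * (freq k)%:~R * (xi + 2 * (pi / h))) =
  - (h * (freq k)%:~R * xi) + 2 * pi * (- freq k)%:~R).
  by rewrite cisD cis_period mulr1.
by rewrite rmorphN; field; exact: lt0r_neq0.
Qed.

Definition alias_cst h s : R := 2 * tail_sum (2 * s) * (pi / h) `^ (- (2 * s)).

Lemma tail_sum_ge0 s : 1 < s -> 0 <= tail_sum s.
Proof. by move=> s1; rewrite addr_ge0// invr_ge0 subr_ge0 ltW. Qed.

Lemma alias_cst_ge0 h s : 2^-1 < s -> 0 <= alias_cst h s.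
Proof.
move=> s2; rewrite mulr_ge0 ?powR_ge0// mulr_ge0// tail_sum_ge0//.
by rewrite mulrC -ltr_pdivrMr// mul1r.
Qed.

(** The part of the spectrum beyond the Nyquist frequency contributes little to the
    samples: dually, a trigonometric sum is periodic, so the weight makes its
    energy there a small multiple of its energy over a period. *)
Lemma bessel_tail h s g n : 0 < h -> 2^-1 < s -> cintegrable g ->
  (forall xi, `|xi| <= pi / h -> g xi = 0) -> (energy (weighted s g) < +oo)%E ->
  ((denergy h (samples h g) n)%:E <= (alias_cst h s)%:E * energy (weighted s g))%E.
Proof.
move=> h0 s2 gi g0 wy; have mg := gi.1.
have a0 : 0 < pi / h by rewrite divr_gt0// pi_gt0.
have s1 : 1 < 2 * s by rewrite mulrC -ltr_pdivrMr// mul1r.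
have s0 : 0 <= s by apply/ltW/(lt_trans _ s2).
have k0 := alias_cst_ge0 h s2.
pose p xi := (`|xi| `^ s)%:C * g xi.
have mp : cmeas p by apply: cmeasM => //; apply: cmeas_real; exact: measurable_abs_powR.
have pw : (energy p <= energy (weighted s g))%E.
  by apply: energy_le => // [|x]; [exact: cmeas_weighted|exact: abs_powR_weighted].
apply: (@le_trans _ _ ((alias_cst h s)%:E * energy p)%E); last by apply: lee_wpmul2l.
set S := dft_sum h (samples h g) n.
have mS : cmeas S by exact: cmeas_dft_sum.
pose q xi := (far (pi / h) s xi)%:C * conjc (S xi).
have mq : cmeas q by apply: cmeasM; [exact: cmeas_far|exact: cmeas_conj].
have gpq xi : g xi * conjc (S xi) = p xi * q xi.
  rewrite {1}(far_weight s a0 (g0 xi)) /p /q.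
  by move: (far _ _ _)%:C (_ `^ s)%:C (g xi) (conjc _) => u v w z; ring.
have py : (energy p < +oo)%E by exact: le_lt_trans pw _.
apply: (bessel_duality h0 gi mp mq k0 gpq py).
pose F x := normc (S x) ^+ 2.
have -> : (energy q =
    \int[mu]_x (if pi / h < `|x| then `|x| `^ (- (2 * s)) * F x else 0)%:E)%E.
  by apply: eq_integral => x _; rewrite (normc_far _ _ (fun x => conjc (S x)) x) normc_conj.
have mF : measurable_fun setT F by exact: measurable_normc_sqr mS.
have F0 x : 0 <= F x by exact: sqr_ge0.
have Fper x : F (x + 2 * (pi / h)) = F x by rewrite /F /S dft_sum_periodic.
apply: (le_trans (periodic_tail_le a0 s1 mF F0 Fper)).
rewrite -/(alias_cst h s) [leRHS]EFinM; apply: lee_wpmul2l; first by rewrite lee_fin.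
rewrite -energy_dft_sum// integral_mkcond le_eqVlt; apply/orP; left; apply/eqP.
apply: eq_integral => x _; rewrite patchE cutE -/(nyquist h); case: ifP => // _.
by rewrite normc_zero expr0n.
Qed.

(** Cauchy--Schwarz, with a weight which is square-integrable away from the origin. *)
Lemma weighted_cintegrable s g : 2^-1 < s -> cmeas g ->
  (energy g < +oo)%E -> (energy (weighted s g) < +oo)%E -> cintegrable g.
Proof.
move=> s2 mg gy wy.
have s1 : 1 < 2 * s by rewrite mulrC -ltr_pdivrMr// mul1r.
have s0 : 0 <= s by apply/ltW/(lt_trans _ s2).
have mI : measurable (`[-1, 1]%classic : set R) by exact: measurable_itv.
have ic : cintegrable (cut `[-1, 1] g).
  by apply: L2_cut_cintegrable; [lra| split => //; rewrite L2norm_fin].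
pose g2 xi := g xi - cut `[-1, 1] g xi.
have mg2 : cmeas g2 by apply: cmeasB => //; exact: ic.1.
have g2E xi : `|xi| <= 1 -> g2 xi = 0.
  by move=> xi1; rewrite /g2 cut_in ?subrr//= in_itv/= -ler_norml.
have g2le xi : normc (g2 xi) <= normc (g xi).
  by rewrite /g2 cutE; case: ifP => _; rewrite ?subrr ?subr0 ?normc_zero ?normc_ge0.
have -> : g = fun xi => cut `[-1, 1] g xi + g2 xi by apply/funext => xi; rewrite addrC subrK.
apply: cintegrableD => //.
have -> : g2 = fun xi => (far 1 s xi)%:C * ((`|xi| `^ s)%:C * g2 xi).
  by apply/funext => xi; apply: far_weight => //; exact: g2E.
have mp : cmeas (fun xi : R => (`|xi| `^ s)%:C * g2 xi).
  by apply: cmeasM => //; apply: cmeas_real; exact: measurable_abs_powR.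
apply: cintegrableM => //; first exact: cmeas_far; rewrite L2norm_fin.
- have -> : (energy (fun xi => (far 1 s xi)%:C)%R =
     \int[mu]_x (if 1 < `|x| then `|x| `^ (- (2 * s)) * 1 else 0)%:E)%E.
    by apply: eq_integral => x _; have := normc_far 1 s (fun=> 1) x;
      rewrite mulr1 => ->; rewrite normc_real normr1 expr1n.
  apply: (le_lt_trans (@periodic_tail_le _ 1 (2 * s) (fun=> 1) _ _ _ _ _)) => //.
  rewrite integral_cst//= mu_segment; last lra.
  by rewrite mul1e -EFinM ltry.
- apply: le_lt_trans wy; apply: energy_le => //; first exact: cmeas_weighted.
  move=> x; apply: (le_trans (abs_powR_weighted g2 x s0)).
  by rewrite /weighted !Normc.normcM ler_wpM2l ?normc_ge0.
Qed.

End sampling_weights.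

Section sampling_error.
Context {R : realType}.
Local Notation mu := (@lebesgue_measure R).
Local Notation normc := (@Normc.normc R).
Implicit Types (f g w D : R -> R[i]) (a h s : R) (V W : int -> R[i]) (n : nat).

Lemma freq_surj (j : int) n : (`|j| <= n)%N -> exists k : 'I_(n.*2.+1), freq k = j.
Proof.
move=> jn; have H : (`|(j + n%:Z)%R|%N < n.*2.+1)%N by rewrite -addnn; lia.
by exists (Ordinal H); rewrite /freq/=; lia.
Qed.

Lemma is_dft_cut h V w : is_dft h V w ->
  (L2norm setT (cut (nyquist h) (fun xi => w xi - dft_sum h V n xi))
    @[n --> \oo] --> 0%E)%classic.
Proof. by move=> [_]; under [X in X @ _ --> _]eq_fun do rewrite L2norm_cut. Qed.

Lemma dft_unique h V w w' : is_dft h V w -> is_dft h V w' ->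
  L2norm setT (cut (nyquist h) (fun xi => w xi - w' xi)) = 0%E.
Proof.
move=> hw hw'; have mN := @measurable_nyquist R h.
have [[mw _] _] := hw; have [[mw' _] _] := hw'.
have mD : cmeas (cut (nyquist h) (fun xi => w xi - w' xi)) by apply: cmeas_cut => //; exact: cmeasB.
apply/eqP; rewrite eq_le L2norm_ge0 andbT.
apply: (@L2norm_fatou _ (fun=> cut (nyquist h) (fun xi => w xi - w' xi)) _ _
  (fun n => L2norm setT (cut (nyquist h) (fun xi => w xi - dft_sum h V n xi)%R) +
     L2norm setT (cut (nyquist h) (fun xi => w' xi - dft_sum h V n xi)%R))%E) => //.
- apply: aeW => x; rewrite subrr normc_zero; exact: cvg_cst.
- move=> n; have mS := @cmeas_dft_sum R h V n; rewrite adde0.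
  have -> : cut (nyquist h) (fun xi => w xi - w' xi)%R =
     (fun xi => cut (nyquist h) (fun xi => w xi - dft_sum h V n xi)%R xi -
       cut (nyquist h) (fun xi => w' xi - dft_sum h V n xi)%R xi)%R.
    apply/funext => x; rewrite !cutE; case: ifP => // _; first by ring.
    by rewrite subrr.
  by apply: L2normB; apply: cmeas_cut => //; exact: cmeasB.
- by rewrite -[X in _ --> X]adde0; apply: cvgeD => //; exact: is_dft_cut.
Qed.

(** The series converges to [w] in L2 only; but Bessel's inequality bounds each
    coefficient of a remainder by its norm. *)
Lemma dft_coeff h V w j : 0 < h -> is_dft h V w -> samples h (cut (nyquist h) w) j = V j.
Proof.
move=> h0 hw; have mN := @measurable_nyquist R h.
have [[mw wL2] _] := hw; have ab := ltW (nyquistP h0).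
have mS n := @cmeas_dft_sum R h V n.
have wi : cintegrable (cut (nyquist h) w) by exact: cintegrable_nyquist_L2.
have Si n : cintegrable (cut (nyquist h) (dft_sum h V n)).
  by have [M SM] := dft_sum_bounded h V n; apply: cintegrable_nyquist_bounded SM.
set X := samples h _ j; pose c := Num.sqrt (h * normc (X - V j) ^+ 2).
have hX : 0 <= h * normc (X - V j) ^+ 2 by rewrite mulr_ge0 ?sqr_ge0// ltW.
have c0 : 0 <= c by exact: sqrtr_ge0.
have cle n : (`|j| <= n)%N ->
   (c%:E <= L2norm setT (cut (nyquist h) (fun xi => w xi - dft_sum h V n xi)%R))%E.
  move=> jn; have [k kj] := freq_surj jn.
  set Z := fun xi => w xi - dft_sum h V n xi.
  have mZ : cmeas Z by exact: cmeasB.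
  have [Zy|] := ltP (L2norm setT (cut (nyquist h) Z)) +oo%E; last first.
    by rewrite leye_eq => /eqP ->; rewrite leey.
  have e0 := L2norm_ge0 setT (cut (nyquist h) Z).
  rewrite -(@fineK _ (L2norm _ _)) ?ge0_fin_numE//; set e := fine _.
  have eE : L2norm setT (cut (nyquist h) Z) = e%:E by rewrite fineK ?ge0_fin_numE.
  have {}e0 : 0 <= e by rewrite -lee_fin -eE.
  rewrite lee_fin -(ger0_norm e0) -sqrtr_sqr; apply: ler_wsqrtr.
  rewrite -lee_fin EFin_expe -eE L2norm_sqr.
  apply: (@le_trans _ _ (denergy h (samples h (cut (nyquist h) Z)) n)%:E); last first.
    by apply: bessel => //; rewrite -L2norm_fin.
  rewrite lee_fin /denergy ler_pM2l// (bigD1 k)// kj.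
  have -> : samples h (cut (nyquist h) Z) j = X - V j.
    have VE : V j = samples h (cut (nyquist h) (dft_sum h V n)) j.
      by rewrite -kj /samples ft_cut_dft_sum.
    have ZE : cut (nyquist h) Z =
        fun x => cut (nyquist h) w x - cut (nyquist h) (dft_sum h V n) x.
      by apply/funext => x; rewrite !cutE; case: ifP => //; rewrite subrr.
    by rewrite ZE (samplesB h j wi (Si n)) -VE.
  by rewrite lerDl; apply: sumr_ge0 => ? _; exact: sqr_ge0.
have : (c%:E <= 0)%E.
  have cv := is_dft_cut hw; rewrite -(cvg_lim _ cv)//.
  apply: lime_ge; first by apply/cvg_ex; exists 0%E.
  by exists `|j|%N => // n /= jn; exact: cle.
rewrite lee_fin => cle0; have : c == 0 by rewrite eq_le cle0.
rewrite sqrtr_eq0 => hX0; have : h * normc (X - V j) ^+ 2 == 0 by rewrite eq_le hX0.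
rewrite mulf_eq0 gt_eqF//= expf_eq0/= => /eqP/Normc.eq0_normc/eqP.
by rewrite subr_eq0 => /eqP.
Qed.

(** The coefficients of [w - g] on the Nyquist interval are the samples of the part of
    [g] beyond that interval. They are small by [bessel_tail], and completeness of the
    exponentials turns this into a bound on [w - g] itself. *)
Lemma sampling_error h s g V w : 0 < h -> 2^-1 < s -> cmeas g ->
  (energy g < +oo)%E -> (energy (weighted s g) < +oo)%E ->
  (forall j, V j = samples h g j) -> is_dft h V w ->
  (L2norm setT (cut (nyquist h) (fun xi => w xi - g xi)%R) <=
   (Num.sqrt (alias_cst h s))%:E * L2norm setT (weighted s g))%E.
Proof.
move=> h0 s2 mg gy wy VE hw; have mN := @measurable_nyquist R h.
have [[mw wL2] _] := hw; have ab := ltW (nyquistP h0).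
have gi := weighted_cintegrable s2 mg gy wy.
have gNi : cintegrable (cut (nyquist h) g) by exact: cintegrable_cut.
have wi : cintegrable (cut (nyquist h) w) by exact: cintegrable_nyquist_L2.
pose g2 xi := g xi - cut (nyquist h) g xi.
have g2i : cintegrable g2 by exact: cintegrableB.
have g20 xi : `|xi| <= pi / h -> g2 xi = 0.
  by move=> xih; rewrite /g2 cut_in ?subrr// /nyquist/= in_itv/= -ler_norml.
have mW : cmeas (weighted s g) by exact: cmeas_weighted.
have W2 : (energy (weighted s g2) <= energy (weighted s g))%E.
  apply: energy_le => //; first by apply: cmeas_weighted; exact: g2i.1.
  move=> x; rewrite /weighted !Normc.normcM ler_wpM2l ?normc_ge0//.
  by rewrite /g2 cutE; case: ifP => _; rewrite ?subrr ?subr0 ?normc_zero ?normc_ge0.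
have cutB : cut (nyquist h) (fun xi => w xi - g xi) =
    fun xi => cut (nyquist h) w xi - cut (nyquist h) g xi.
  by apply/funext => x; rewrite !cutE; case: ifP => //; rewrite subrr.
have DE j : samples h (cut (nyquist h) (fun xi => w xi - g xi)) j = samples h g2 j.
  by rewrite cutB (samplesB h j wi gNi) (dft_coeff j h0 hw) VE (samplesB h j gi gNi).
pose e := fine (L2norm setT (weighted s g)).
have e0 := L2norm_ge0 setT (weighted s g).
have eE : L2norm setT (weighted s g) = e%:E by rewrite fineK// ge0_fin_numE// L2norm_fin.
have {}e0 : 0 <= e by rewrite -lee_fin -eE.
have k0 := alias_cst_ge0 h s2.
rewrite eE -EFinM; apply: nyquist_parseval => //.
- by rewrite mulr_ge0 ?sqrtr_ge0.
- exact: cmeasB.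
- rewrite cutB; apply: (le_lt_trans (L2normB wi.1 gNi.1)); rewrite lte_add_pinfty//.
    by rewrite -L2norm_cut.
  apply: (@le_lt_trans _ _ (L2norm setT g)); last by rewrite L2norm_fin.
  by apply: L2norm_le => //; [exact: gNi.1|move=> x; exact: normc_cut_le].
move=> n; rewrite (eq_denergy _ _ DE) -lee_fin exprMn sqr_sqrtr//.
apply: (le_trans (bessel_tail n h0 s2 g2i g20 _)); first exact: le_lt_trans W2 _.
by rewrite [leRHS]EFinM; apply: lee_wpmul2l => //; rewrite EFin_expe -eE L2norm_sqr.
Qed.

End sampling_error.

(** * The symbols *)

Section symbols.
Context {R : realType}.
Local Notation mu := (@lebesgue_measure R).
Local Notation Re := (@complex.Re R).
Local Notation Im := (@complex.Im R).
Local Notation normc := (@Normc.normc R).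
Implicit Types (h s t xi : R) (J : R -> R) (z w : R[i]) (n : nat).

Lemma normc_cexp z : normc (cexp z) = expR (Re z).
Proof.
rewrite /cexp Normc.normcM normc_real ger0_norm ?expR_ge0//.
by rewrite -[X in normc X]cisE normc_cis mulr1.
Qed.

Lemma expR_lipschitz (x y : R) : x <= 0 -> y <= 0 -> `|expR x - expR y| <= `|x - y|.
Proof.
move=> x0 y0; wlog xy : x y x0 y0 / x <= y.
  move=> H; have [xy|/ltW yx] := leP x y; first exact: H.
  by rewrite distrC [leRHS]distrC; exact: H.
have exy : expR x = expR y * expR (x - y) by rewrite -expRD; congr expR; ring.
rewrite distrC [leRHS]distrC !ger0_norm ?subr_ge0 ?ler_expR// exy.
have ey1 : expR y <= 1 by rewrite -expR0 ler_expR.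
have e1 := expR_ge1Dx (x - y).
have -> : expR y - expR y * expR (x - y) = expR y * (1 - expR (x - y)) by ring.
apply: (@le_trans _ _ (1 - expR (x - y))); last by lra.
by rewrite ler_piMl// subr_ge0 -expR0 ler_expR subr_le0.
Qed.

(** On the left half-plane the modulus and the phase are compared separately. *)
Lemma cexp_lipschitz z w : Re z <= 0 -> Re w <= 0 ->
  normc (cexp z - cexp w) <= 3 * normc (z - w).
Proof.
move=> z0 w0.
have E v : cexp v = (expR (Re v))%:C * cis (Im v) by rewrite /cexp cisE.
have -> : cexp z - cexp w = (expR (Re z) - expR (Re w))%:C * cis (Im z) +
    (expR (Re w))%:C * (cis (Im z) - cis (Im w)) by rewrite !E rmorphB; ring.
apply: (le_trans (normcD_le _ _)).
rewrite [normc (_ * cis _)]Normc.normcM normc_cis mulr1 [normc (_ * (_ - _))]Normc.normcM.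
rewrite !normc_real (ger0_norm (expR_ge0 _)).
have -> : 3 * normc (z - w) = normc (z - w) + 2 * normc (z - w) by ring.
apply: lerD.
  by apply: (le_trans (expR_lipschitz z0 w0)); rewrite -ReN -ReD; exact: Re_le_normc.
apply: (@le_trans _ _ (normc (cis (Im z) - cis (Im w)))).
  by rewrite ler_piMl ?normc_ge0// -expR0 ler_expR.
apply: (le_trans (cis_lipschitz _ _)); rewrite ler_pM2l// -ImN -ImD; exact: Im_le_normc.
Qed.

Lemma sqrt2pi_gt0 : 0 < Num.sqrt (2 * pi) :> R.
Proof. by rewrite sqrtr_gt0 mulr_gt0// pi_gt0. Qed.

Lemma cintegrable_kernel J : kernel_hypotheses J -> cintegrable (fun x => (J x)%:C).
Proof.
move=> hJ; have mJ : measurable_fun setT J.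
  by apply: continuous_measurable_fun; exact: kernel_continuous hJ.
split; first exact: cmeas_real.
have -> : (\int[mu]_x (normc (J x)%:C)%:E = \int[mu]_x (J x)%:E)%E.
  by apply: eq_integral => x _; rewrite normc_real ger0_norm// (kernel_ge0 hJ).
by rewrite (kernel_int1 hJ) ltry.
Qed.

Lemma sqrt2pi_J_hat J xi : kernel_hypotheses J ->
  normc ((Num.sqrt (2 * pi))%:C * J_hat J xi) <= 1.
Proof.
move=> hJ; have ci := cintegrable_kernel hJ.
rewrite Normc.normcM normc_real gtr0_norm ?sqrt2pi_gt0// mulrC -ler_pdivlMr ?sqrt2pi_gt0// mul1r.
have -> : (Num.sqrt (2 * pi))^-1 = ft_cst * fine (\int[mu]_x (normc (J x)%:C)%:E)%E.
  have -> : (\int[mu]_x (normc (J x)%:C)%:E = \int[mu]_x (J x)%:E)%E.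
    by apply: eq_integral => x _; rewrite normc_real ger0_norm// (kernel_ge0 hJ).
  by rewrite (kernel_int1 hJ) mulr1.
exact: ft_dominated.
Qed.

Lemma sqrt2pi_J_hat0 J : kernel_hypotheses J -> (Num.sqrt (2 * pi))%:C * J_hat J 0 = 1.
Proof.
move=> hJ; rewrite /J_hat -/(ft (fun x => (J x)%:C)) ftE mulrA -rmorphM mulfV; last first.
  exact: lt0r_neq0 sqrt2pi_gt0.
rewrite mul1r (eq_cint (g := fun x => (J x)%:C)); last by move=> x; rewrite mulr0 oppr0 cis0 mul1r.
rewrite cint_real /Rintegral.
by rewrite (kernel_int1 hJ).
Qed.

Lemma q_hatE J xi : kernel_hypotheses J -> q_hat J xi =
  (Num.sqrt (2 * pi))%:C * J_hat J xi - 1 - 1 - (xi ^+ 2)%:C + 'i%C * xi%:C.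
Proof.
move=> hJ; rewrite /q_hat (mulrBr _ (J_hat J xi) (J_hat J 0)).
by rewrite (sqrt2pi_J_hat0 hJ).
Qed.

Lemma Re_q_hat_le0 J xi : kernel_hypotheses J -> Re (q_hat J xi) <= 0.
Proof.
move=> hJ; rewrite (q_hatE _ hJ).
have := le_trans (ler_norm _) (le_trans (Re_le_normc _) (sqrt2pi_J_hat xi hJ)).
move: (_ * J_hat J xi) => [a b] /= a1; have := sqr_ge0 xi; lra.
Qed.

Lemma normc_q_hat J xi : kernel_hypotheses J -> normc (q_hat J xi) <= 4 + xi ^+ 2 + `|xi|.
Proof.
move=> hJ; rewrite (q_hatE _ hJ).
apply: (le_trans (normc_le_ReIm _)).
have := le_trans (Re_le_normc _) (sqrt2pi_J_hat xi hJ).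
have := le_trans (Im_le_normc _) (sqrt2pi_J_hat xi hJ).
move: (_ * J_hat J xi) => [a b]; rewrite /complex.Re /complex.Im => b1 a1.
rewrite [X in `|X| + _](_ : _ = a - 2 - xi ^+ 2); last by rewrite /=; ring.
rewrite [X in _ + `|X|](_ : _ = b + xi); last by rewrite /=; ring.
have := sqr_ge0 xi; have := ler_normD b xi.
have := ler_normB (a - 2) (xi ^+ 2); have := ler_normB a 2.
rewrite (ger0_norm (sqr_ge0 xi)) (ger0_norm (ler0n _ 2)); lra.
Qed.

(** A Riemann sum at right endpoints of a decreasing function lies below its integral. *)
Lemma kernel_grid_sum J h n : kernel_hypotheses J -> 0 < h ->
  \sum_(0 <= k < n) h * J (k.+1%:R * h) <= 1.
Proof.
move=> hJ h0; have J0 x : (0 <= (J x)%:E)%E by rewrite lee_fin (kernel_ge0 hJ).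
have mJ : measurable_fun setT (EFin \o J).
  by apply/measurable_EFinP; apply: continuous_measurable_fun; exact: kernel_continuous hJ.
have mI (a b : R) : measurable (`]a, b]%classic : set R) by exact: measurable_itv.
have step m : ((h * J (m.+1%:R * h))%:E <=
    \int[mu]_(x in `](m%:R * h)%R, (m.+1%:R * h)%R]) (J x)%:E)%E.
  have mm : m%:R * h < m.+1%:R * h by rewrite ltr_pM2r// ltr_nat.
  have -> : (h * J (m.+1%:R * h))%:E =
      (\int[mu]_(x in `](m%:R * h)%R, (m.+1%:R * h)%R]) (J (m.+1%:R * h)%R)%:E)%E.
    rewrite integral_cst//= lebesgue_measure_itv/= lte_fin mm -EFinB -EFinM; congr (_%:E).
    by rewrite -natr1; ring.
  apply: ge0_le_integral => //; first exact: measurable_funTS.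
  move=> x; rewrite /= in_itv/= => /andP[mx xm]; rewrite lee_fin.
  apply: (kernel_decreasing hJ) => //; apply: le_lt_trans mx.
  by rewrite mulr_ge0// ltW.
rewrite -lee_fin -(kernel_int1 hJ).
apply: (@le_trans _ _ (\int[mu]_(x in `]0%R, (n%:R * h)%R]) (J x)%:E)%E); last first.
  by apply: ge0_subset_integral.
elim: n => [|n IH]; first by rewrite big_nil integral_ge0.
rewrite big_nat_recr//= EFinD.
have -> : `]0%R, (n.+1%:R * h)%R]%classic =
    `]0%R, (n%:R * h)%R]%classic `|` `](n%:R * h)%R, (n.+1%:R * h)%R]%classic :> set R.
  by rewrite -itv_bndbnd_setU// bnd_simp ?mulr_ge0 ?(ltW h0)// ler_pM2r// ler_nat.
rewrite ge0_integral_setU//; first exact: leeD.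
  exact: measurable_funTS.
apply/disj_setPS => x [/=]; rewrite !in_itv/= => /andP[_ a] /andP[b _].
by move: (lt_le_trans b a); rewrite ltxx.
Qed.

End symbols.

Section discrete_symbol.
Context {R : realType}.
Local Notation mu := (@lebesgue_measure R).
Local Notation Re := (@complex.Re R).
Local Notation Im := (@complex.Im R).
Local Notation normc := (@Normc.normc R).
Implicit Types (h s t xi : R) (J : R -> R) (z w : R[i]) (n : nat).

Definition cosine_terms h J xi : R^nat :=
  fun k => 2 * cos (h * k.+1%:R * xi) * J (k.+1%:R * h).

(** The grid values of an even function are even, so the sines cancel. *)
Lemma dft_sum_kernel J h xi n : kernel_hypotheses J ->
  dft_sum h (grid_values h (fun x => (J x)%:C)) n xi =
  (h * ft_cst * (J 0 + series (cosine_terms h J xi) n))%:C.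
Proof.
move=> hJ; rewrite dft_sumE.
pose F (j : int) := (h * ft_cst)%:C * (J (j%:~R * h))%:C * cis (- (h * j%:~R * xi)).
transitivity (\sum_(k < n.*2.+1) F (freq k)); first by apply: eq_bigr.
rewrite sum_freqE mulrDr rmorphD; congr (_ + _).
  by rewrite /F mulr0z mulr0 !mul0r oppr0 cis0 mulr1 (rmorphM _ (h * ft_cst)).
rewrite /series/= mulr_sumr rmorph_sum; apply: eq_bigr => k _.
rewrite /F (_ : (- (k.+1%:Z))%:~R * h = - (k.+1%:R * h)); last by rewrite mulrNz mulNr.
rewrite -(kernel_even hJ) -mulrDr -(rmorphM _ (h * ft_cst)) mulrNz -pmulrn.
rewrite (_ : - (h * - k.+1%:R * xi) = h * k.+1%:R * xi); last by ring.
rewrite /cosine_terms !cisE cosN sinN; apply: complexP; rewrite /=; ring.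
Qed.

Lemma cosine_terms_le J h xi k : kernel_hypotheses J ->
  `|cosine_terms h J xi k| <= cosine_terms h J 0 k.
Proof.
move=> hJ; rewrite /cosine_terms mulr0 cos0 mulr1 normrM (ger0_norm (kernel_ge0 hJ _)).
apply: ler_wpM2r; first exact: kernel_ge0 hJ _.
by rewrite normrM ger0_norm// ler_piMr// ler_norml cos_geN1 cos_le1.
Qed.

Lemma cvg_cosine_series J h xi : kernel_hypotheses J -> 0 < h ->
  cvgn (series (cosine_terms h J xi)).
Proof.
move=> hJ h0; have v0 k : 0 <= cosine_terms h J 0 k.
  by apply: le_trans (cosine_terms_le h 0 k hJ).
apply: normed_cvg; apply: (@series_le_cvg _ _ (cosine_terms h J 0)) => //.
- by move=> k; exact: normr_ge0.
- by move=> k; exact: cosine_terms_le.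
apply: nondecreasing_is_cvgn.
  by apply/nondecreasing_series => k _ _; exact: v0.
exists (2 / h) => _ [n _ <-]; rewrite ler_pdivlMr// mulrC /series/= mulr_sumr.
have -> : \sum_(0 <= k < n) h * cosine_terms h J 0 k = 2 * \sum_(0 <= k < n) h * J (k.+1%:R * h).
  rewrite mulr_sumr; apply: eq_bigr => k _.
  by rewrite /cosine_terms mulr0 cos0; ring.
by rewrite -[leRHS]mulr1 ler_pM2l// kernel_grid_sum.
Qed.

Lemma J_tildeE J h xi : kernel_hypotheses J -> 0 < h ->
  J_tilde h J xi = (h * ft_cst * (J 0 + limn (series (cosine_terms h J xi))))%:C.
Proof.
move=> hJ h0; rewrite /J_tilde /dft_series.
under [X in (limn X) +i* _]eq_fun do rewrite dft_sum_kernel//.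
under [X in _ +i* (limn X)]eq_fun do rewrite dft_sum_kernel//.
apply: complexP; rewrite [LHS]/= [RHS]/=; last exact: lim_cst.
apply: cvg_lim => //; apply: cvgMl_tmp; apply: cvgD; first exact: cvg_cst.
exact: cvg_cosine_series.
Qed.

Lemma J_tilde_le J h xi : kernel_hypotheses J -> 0 < h ->
  `|Re (J_tilde h J xi)| <= Re (J_tilde h J 0).
Proof.
move=> hJ h0; rewrite !J_tildeE//.
set L := limn _; set L0 := limn (series (cosine_terms h J 0)).
have c := @cvg_cosine_series J h xi hJ h0; have c0 := @cvg_cosine_series J h 0 hJ h0.
have cn : cvgn [normed series (cosine_terms h J xi)].
  apply: series_le_cvg c0 => k; [exact: normr_ge0| |exact: cosine_terms_le].
  by apply: le_trans (cosine_terms_le h 0 k hJ).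
have LL : `|L| <= L0.
  apply: (@le_trans _ _ (limn [normed series (cosine_terms h J xi)])).
    exact: lim_series_norm.
  by apply: lim_series_le => // k; exact: cosine_terms_le.
have hc : 0 < h * ft_cst by rewrite mulr_gt0// ft_cst_gt0.
rewrite [Re _]/= [Re _]/= normrM gtr0_norm// ler_pM2l//.
apply: (le_trans (ler_normD _ _)); rewrite ger0_norm ?lerD//.
exact: kernel_ge0 hJ _.
Qed.

Lemma Im_J_tilde J h xi : kernel_hypotheses J -> 0 < h -> Im (J_tilde h J xi) = 0.
Proof. by move=> hJ h0; rewrite J_tildeE. Qed.

Definition symbol_bound h J : R :=
  2 * Num.sqrt (2 * pi) * Re (J_tilde h J 0) + 4 / h ^+ 2 + h^-1 + 1.

Lemma q_tilde_bounds J h xi : kernel_hypotheses J -> 0 < h ->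
  Re (q_tilde h J xi) <= 0 /\ normc (q_tilde h J xi) <= symbol_bound h J.
Proof.
move=> hJ h0; have jle := J_tilde_le xi hJ h0.
have i1 := Im_J_tilde xi hJ h0; have i0 := Im_J_tilde 0 hJ h0.
have c0 := @sqrt2pi_gt0 R.
rewrite /symbol_bound /q_tilde.
move: (J_tilde h J xi) (J_tilde h J 0) jle i1 i0 => [a a'] [b b'].
rewrite /complex.Re /complex.Im => ab -> ->; move: (Num.sqrt _) c0 => c c0.
set S := sin (h * xi / 2) ^+ 2; set T := sin (h * xi).
have S0 : 0 <= S by exact: sqr_ge0.
have S1 : S <= 1 by rewrite /S sin2cos2 gerBl sqr_ge0.
have T1 : `|T| <= 1 by rewrite ler_norml sin_geN1 sin_le1.
have h2 : 0 < 4 / h ^+ 2 by rewrite divr_gt0// exprn_gt0.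
set z := _ - 1.
have zR : Re z = c * (a - b) - 4 / h ^+ 2 * S - 1 by rewrite /z /=; ring.
have zI : Im z = T / h by rewrite /z /=; ring.
move: ab; rewrite ler_norml => /andP[ab1 ab2].
have p1 : c * (a - b) <= 0 by rewrite mulr_ge0_le0 ?(ltW c0)// subr_le0.
have p2 : - (2 * c * b) <= c * (a - b).
  by rewrite -subr_ge0 (_ : _ - _ = c * (b + a)); [rewrite mulr_ge0 ?(ltW c0)//; lra|ring].
have p3 : 4 / h ^+ 2 * S <= 4 / h ^+ 2 by rewrite ger_pMr.
have p4 : 0 <= 4 / h ^+ 2 * S by rewrite mulr_ge0// ltW.
have hV : 0 < h^-1 by rewrite invr_gt0.
split; first by rewrite -[X in X <= _]/(Re z) zR; lra.
apply: (le_trans (normc_le_ReIm z)); rewrite zR zI normrM (gtr0_norm hV).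
have p5 : `|T| * h^-1 <= h^-1 by rewrite ger_pMl.
have : `|c * (a - b) - 4 / h ^+ 2 * S - 1| <= 2 * c * b + 4 / h ^+ 2 + 1.
  by rewrite ler_norml; apply/andP; split; lra.
lra.
Qed.

End discrete_symbol.

(** * The error estimate *)

Section error_estimate.
Context {R : realType}.
Local Notation mu := (@lebesgue_measure R).
Local Notation Re := (@complex.Re R).
Local Notation Im := (@complex.Im R).
Local Notation normc := (@Normc.normc R).
Implicit Types (f g v w : R -> R[i]) (h s t xi : R) (J : R -> R) (V : int -> R[i]).

(** Nonempty open sets have positive measure. *)
Lemma continuous_ae_eq (f g : R -> R) : continuous f -> continuous g ->
  {ae mu, forall x, f x = g x} -> f = g.
Proof.
move=> cf cg [N [mN N0 fgN]]; apply/funext => x; apply/eqP/negP => /negP fgx.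
have cfg : continuous (fun x => f x - g x) by move=> y; apply: cvgB; [exact: cf|exact: cg].
have : \forall y \near x, f y - g y != 0.
  by apply: (@cvgr_neq0 R R _ (nbhs x) _ _ _ (cfg x)); rewrite subr_eq0.
move=> /nbhs_ballP[e /= e0 He].
have : (mu (ball x e) <= mu N)%E.
  apply: le_measure; rewrite ?inE//; first exact: measurable_ball.
  by move=> y /He; rewrite subr_eq0 => /eqP fgy; exact: fgN.
rewrite lebesgue_measure_ball ?(ltW e0)// N0 lee_fin mulr2n => e1.
by have := lt_le_trans (addr_gt0 e0 e0) e1; rewrite ltxx.
Qed.

Lemma ccontinuous_ae_eq f g : ccontinuous f -> ccontinuous g ->
  {ae mu, forall x, f x = g x} -> f = g.
Proof.
move=> [cf cf'] [cg cg'] fg; apply/funext => x; apply: complexP.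
  suff /(congr1 (fun k => k x)) : Re \o f = Re \o g by [].
  by apply: continuous_ae_eq => //; apply: ae_imply fg => y /= ->.
suff /(congr1 (fun k => k x)) : Im \o f = Im \o g by [].
by apply: continuous_ae_eq => //; apply: ae_imply fg => y /= ->.
Qed.

Lemma ccontinuous_opp f : ccontinuous f -> ccontinuous (fun x => f (- x)).
Proof.
move=> [cf cf']; split => x.
  by apply: (@continuous_comp _ _ _ (-%R) (Re \o f)); [exact: opp_continuous|exact: cf].
by apply: (@continuous_comp _ _ _ (-%R) (Im \o f)); [exact: opp_continuous|exact: cf'].
Qed.

(** The two sides agree almost everywhere by [plancherel_inversion], hence at every grid
    point, as they are continuous. *)
Lemma fourier_inversion v g : ccontinuous v -> is_fourier v g -> cintegrable g ->
  forall x, v x = ft g (- x).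
Proof.
move=> cv vg gi x.
have cft : ccontinuous (fun x => ft g (- x)) by apply: ccontinuous_opp; exact: ccontinuous_ft.
suff : v = fun x => ft g (- x) by move=> /(congr1 (fun k => k x)).
apply: ccontinuous_ae_eq => //.
have mD : cmeas (fun x => v x - ft g (- x)).
  by apply: cmeasB; exact: ccontinuous_cmeas.
have : L2norm setT (fun x => v x - ft g (- x)) = 0%E.
  apply/eqP; rewrite eq_le L2norm_ge0 andbT.
  apply: (le_trans (plancherel_inversion vg gi)).
  under [X in (L2norm _ X <= _)%E]eq_fun do rewrite subrr.
  by rewrite L2norm_leP// expr0n /energy integral0_eq// => y _; rewrite normc_zero expr0n.
move/(energy_eq0 mD); apply: ae_imply => y /eqP; by rewrite subr_eq0 => /eqP.
Qed.

Lemma normc_weighted s g xi :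
  normc (weighted s g xi) ^+ 2 = (1 + xi ^+ 2) `^ s * normc (g xi) ^+ 2.
Proof.
rewrite /weighted Normc.normcM normc_real exprMn ger0_norm ?powR_ge0//; congr (_ * _).
by rewrite -(powR_mulrn 2 (powR_ge0 _ _)) -powRrM; congr (_ `^ _); field.
Qed.

(** The Sobolev norm is defined from one chosen transform of [v], which agrees with any
    other one almost everywhere. *)
Lemma sobolev_normE s v g : is_fourier v g ->
  sobolev_norm s v = L2norm setT (weighted s g).
Proof.
move=> vg; have vG : is_fourier v (fourier v).
  by rewrite /fourier; exact: (xgetPex _ (ex_intro _ g vg)).
have [_ [mg _] _] := vg; have [_ [mG _] _] := vG.
have Gg : {ae mu, forall x, fourier v x - g x = 0}.
  by apply: energy_eq0; [exact: cmeasB|exact: (fourier_unique vG vg)].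
have le1 g1 g2 : cmeas g1 -> cmeas g2 -> {ae mu, forall x, g1 x = g2 x} ->
    (L2norm setT (weighted s g1) <= L2norm setT (weighted s g2))%E.
  move=> m1 m2 e12; apply: L2norm_le_ae; [exact: cmeas_weighted|exact: cmeas_weighted|].
  by apply: ae_imply e12 => x e; rewrite /weighted e.
have -> : sobolev_norm s v = L2norm setT (weighted s (fourier v)).
  rewrite L2normE -poweR12_sqrt ?energy_ge0// /sobolev_norm; congr (_ `^ _)%E.
  by apply: eq_integral => x _; rewrite normc_weighted.
apply/eqP; rewrite eq_le; apply/andP; split; apply: le1 => //; apply: ae_imply Gg => x /eqP;
  by rewrite subr_eq0 => /eqP ->.
Qed.

Lemma fourier_interpolantE h V x :
  fourier_interpolant h V x = ft (cut (nyquist h) (dft h V)) (- x).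
Proof.
rewrite ft_cut /fourier_interpolant /fourier_integral; congr (_ * cint _ _).
by apply/funext => xi; rewrite mulrN opprK mulrC [xi * x]mulrC mulrC.
Qed.

Lemma nyquist_powR_le h s : 0 < h -> 0 <= s -> (pi / h) `^ (- s) <= h `^ s.
Proof.
move=> h0 s0; have a0 : 0 < pi / h by rewrite divr_gt0// pi_gt0.
rewrite powRN -[leLHS]mul1r ler_pdivrMr ?powR_gt0// -powRM ?(ltW h0) ?(ltW a0)//.
have -> : h * (pi / h) = pi by field; exact: lt0r_neq0.
have pi1 : 1 <= pi :> R by apply: le_trans (pi_ge2 R); rewrite ler1n.
have <- : 1 `^ s = 1 :> R by rewrite powR1.
by apply: ge0_ler_powR; rewrite ?nnegrE// (le_trans ler01).
Qed.

Lemma alias_cst_le h s : 0 < h -> 2^-1 < s ->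
  Num.sqrt (alias_cst h s) <= Num.sqrt (2 * tail_sum (2 * s)) * h `^ s.
Proof.
move=> h0 s2; have s1 : 1 < 2 * s by rewrite mulrC -ltr_pdivrMr// mul1r.
have s0 : 0 <= s by apply/ltW/(lt_trans _ s2).
rewrite /alias_cst sqrtrM; last by rewrite mulr_ge0// tail_sum_ge0.
apply: ler_wpM2l; first exact: sqrtr_ge0.
have -> : (pi / h) `^ (- (2 * s)) = ((pi / h) `^ (- s)) ^+ 2.
  by rewrite -(powR_mulrn 2 (powR_ge0 _ _)) -powRrM; congr (_ `^ _); ring.
by rewrite sqrtr_sqr ger0_norm ?powR_ge0// nyquist_powR_le.
Qed.

Definition consistency_cst J h : R :=
  3 * (4 + (pi / h) ^+ 2 + pi / h + symbol_bound h J).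

(** On the Nyquist interval both symbols have nonpositive real part and are bounded,
    so that the two evolutions drift apart at most linearly in time; what remains
    there is the sampling error of the initial value. *)
Lemma evolution_nyquist J h t xi (z w : R[i]) : kernel_hypotheses J -> 0 < h -> 0 <= t ->
  `|xi| <= pi / h ->
  normc (cexp (q_hat J xi * t%:C) * z - cexp (q_tilde h J xi * t%:C) * w) <=
  t * consistency_cst J h * normc z + normc (w - z).
Proof.
move=> hJ h0 t0 xia; have [qR qB] := q_tilde_bounds xi hJ h0.
have pR := Re_q_hat_le0 xi hJ; have pB := normc_q_hat xi hJ.
move: (q_hat J xi) (q_tilde h J xi) qR qB pR pB => p q qR qB pR pB.
have ReMt (v : R[i]) : Re (v * t%:C) = Re v * t by rewrite ReM mulr0 subr0.
have ptR : Re (p * t%:C) <= 0 by rewrite ReMt mulr_le0_ge0.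
have qtR : Re (q * t%:C) <= 0 by rewrite ReMt mulr_le0_ge0.
have -> : cexp (p * t%:C) * z - cexp (q * t%:C) * w =
   (cexp (p * t%:C) - cexp (q * t%:C)) * z - cexp (q * t%:C) * (w - z).
  by move: (cexp _) (cexp _) => e1 e2; ring.
apply: (le_trans (normcB_le _ _)).
rewrite [normc (_ * z)]Normc.normcM [normc (_ * (w - z))]Normc.normcM; apply: lerD; last first.
  by rewrite ler_piMl ?normc_ge0// normc_cexp -expR0 ler_expR.
apply: ler_wpM2r; first exact: normc_ge0.
apply: (le_trans (cexp_lipschitz ptR qtR)).
rewrite -mulrBl Normc.normcM normc_real (ger0_norm t0) /consistency_cst.
rewrite [leRHS]mulrC mulrA ler_wpM2r// ler_pM2l//.
apply: (le_trans (normcB_le _ _)); apply: lerD => //; apply: (le_trans pB).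
rewrite -lerBrDr; have xi2 : xi ^+ 2 <= (pi / h) ^+ 2.
  rewrite -[xi ^+ 2]real_normK ?num_real// ler_pXn2r ?nnegrE//.
  by rewrite (le_trans _ xia).
lra.
Qed.

(** Beyond the Nyquist frequency the interpolant has no spectrum, and the weight is
    large. *)
Lemma evolution_far J a s t xi g : kernel_hypotheses J -> 0 < a -> 0 <= s -> 0 <= t ->
  a <= `|xi| ->
  normc (cexp (q_hat J xi * t%:C) * g xi) <= a `^ (- s) * normc (weighted s g xi).
Proof.
move=> hJ a0 s0 t0 axi.
have xi0 : 0 < `|xi| by exact: lt_le_trans axi.
apply: (@le_trans _ _ (normc (g xi))).
  rewrite Normc.normcM ler_piMl ?normc_ge0// normc_cexp -expR0 ler_expR.
  by rewrite ReM mulr0 subr0 mulr_le0_ge0// Re_q_hat_le0.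
have -> : normc (g xi) = `|xi| `^ (- s) * normc ((`|xi| `^ s)%:C * g xi).
  rewrite [normc (_ * g xi)]Normc.normcM normc_real (ger0_norm (powR_ge0 _ _)) mulrA.
  by rewrite powRN mulVf ?mul1r// gt_eqF// powR_gt0.
apply: ler_pM; rewrite ?powR_ge0 ?normc_ge0//; first exact: powR_antitone.
exact: abs_powR_weighted.
Qed.

(** By [plancherel_inversion] the error is estimated on the frequency side, where it
    splits into the difference of the symbols and the sampling error on the Nyquist
    interval, and the remainder of the exact solution beyond it. *)
Lemma error_bound J h s t u0 v V g w : kernel_hypotheses J -> 0 < h -> 2^-1 < s -> 0 <= t ->
  ccontinuous u0 -> is_fourier u0 g -> (L2norm setT (weighted s g) < +oo)%E ->
  is_fourier v (fun xi => cexp (q_hat J xi * t%:C) * g xi) ->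
  is_dft h (grid_values h u0) w ->
  is_dft h V (fun xi => cexp (q_tilde h J xi * t%:C) * w xi) ->
  (L2norm setT (fun x => v x - fourier_interpolant h V x)%R <=
   (t * consistency_cst J h)%:E * L2norm setT u0 +
   ((Num.sqrt (2 * tail_sum (2 * s)) + 1) * h `^ s)%:E * L2norm setT (weighted s g))%E.
Proof.
move=> hJ h0 s2 t0 cu0 hg wy hv hw hV.
have mN := @measurable_nyquist R h; have ab := ltW (nyquistP h0).
have a0 : 0 < pi / h by rewrite divr_gt0// pi_gt0.
have s0 : 0 <= s by apply/ltW/(lt_trans _ s2).
have [_ [mg gy] _] := hg; have [_ [mqg _] _] := hv.
have [[mw wL2] _] := hw; have [[mqw _] _] := hV.
have mWg := cmeas_weighted s mg.
rewrite L2norm_fin in gy; rewrite L2norm_fin in wy.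
have gi := weighted_cintegrable s2 mg gy wy.
have hd : is_dft h V (dft h V).
  by rewrite /dft; exact: (xgetPex _ (ex_intro _ _ hV)).
have [[md dL2] _] := hd.
set d := dft h V in hd md dL2.
have di : cintegrable (cut (nyquist h) d) by exact: cintegrable_nyquist_L2.
have grid j : grid_values h u0 j = samples h g j.
  by rewrite /grid_values (fourier_inversion cu0 hg gi) /samples mulrC.
have sE := sampling_error h0 s2 mg gy wy grid hw.
have dE : {ae mu, forall x, cut (nyquist h)
    (fun xi => d xi - cexp (q_tilde h J xi * t%:C) * w xi) x = 0}.
  apply: energy_eq0; last exact: (dft_unique hd hV).
  by apply: cmeas_cut => //; exact: cmeasB.
have -> : (fun x => v x - fourier_interpolant h V x) =
    (fun x => v x - ft (cut (nyquist h) d) (- x)).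
  by apply/funext => x; rewrite fourier_interpolantE.
apply: (le_trans (plancherel_inversion hv di)).
(* The symbols are not known to be measurable, so the three parts of the error are
   replaced by measurable bounds. *)
pose k1 xi : R[i] := (t * consistency_cst J h)%:C * g xi.
pose k2 := cut (nyquist h) (fun xi => w xi - g xi).
pose k3 xi : R[i] := ((pi / h) `^ (- s))%:C * weighted s g xi.
have mk1 : cmeas k1 by apply: cmeasM => //; exact: cmeas_cst.
have mk2 : cmeas k2 by apply: cmeas_cut => //; exact: cmeasB.
have mk3 : cmeas k3 by apply: cmeasM => //; exact: cmeas_cst.
have mabs k : cmeas k -> cmeas (fun xi => (normc (k xi))%:C).
  by move=> mk; apply: cmeas_real; exact: measurable_normc.
have L2abs k : L2norm setT (fun xi => (normc (k xi))%:C) = L2norm setT k.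
  by apply: eq_L2norm => x; rewrite normc_real ger0_norm ?normc_ge0.
have C0 : 0 <= t * consistency_cst J h.
  apply: mulr_ge0 => //; apply: mulr_ge0 => //.
  have := sqr_ge0 (pi / h); have := ltW a0.
  by have := le_trans (normc_ge0 _) (q_tilde_bounds 0 hJ h0).2; lra.
apply: (@le_trans _ _ (L2norm setT (fun xi =>
    (normc (k1 xi))%:C + (normc (k2 xi))%:C + (normc (k3 xi))%:C)%R)).
  apply: L2norm_le_ae.
  - by apply: cmeasB => //; exact: cmeas_cut.
  - by apply: cmeasD; [apply: cmeasD|]; exact: mabs.
  apply: ae_imply dE => xi.
  rewrite -!rmorphD normc_real ger0_norm ?addr_ge0 ?normc_ge0// !cutE /k2 cutE.
  case: ifPn => [|xiN _].
    rewrite inE /nyquist/= in_itv/= -ler_norml => xia /eqP; rewrite subr_eq0 => /eqP ->.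
    apply: (le_trans (evolution_nyquist _ _ hJ h0 t0 xia)).
    rewrite /k1 Normc.normcM normc_real (ger0_norm C0).
    by rewrite -[leLHS]addr0 lerD2l normc_ge0.
  rewrite subr0 normc_zero addr0.
  have axi : pi / h <= `|xi|.
    rewrite leNgt; apply: contra xiN => /ltW; rewrite ler_norml => xia.
    by rewrite inE /nyquist/= in_itv.
  apply: (le_trans (evolution_far g hJ a0 s0 t0 axi)).
  rewrite [normc (k3 xi)]Normc.normcM normc_real (ger0_norm (powR_ge0 _ _)).
  by rewrite -[leLHS]add0r lerD2r normc_ge0.
apply: (le_trans (L2normD _ _)); [by apply: cmeasD; exact: mabs|exact: mabs|].
apply: (@le_trans _ _ (L2norm setT k1 + L2norm setT k2 + L2norm setT k3)%E).
  apply: leeD; last by rewrite L2abs.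
  by apply: (le_trans (L2normD (mabs _ mk1) (mabs _ mk2))); rewrite !L2abs.
rewrite -addeA; apply: leeD.
  rewrite L2normZ// normc_real (ger0_norm C0).
  by apply: lee_wpmul2l; [rewrite lee_fin|exact: plancherel_le hg].
rewrite mulrDl mul1r EFinD ge0_muleDl ?lee_fin ?mulr_ge0 ?sqrtr_ge0 ?powR_ge0//.
apply: leeD.
  apply: (le_trans sE); apply: lee_wpmul2r; first exact: L2norm_ge0.
  by rewrite lee_fin; exact: alias_cst_le.
rewrite L2normZ// normc_real (ger0_norm (powR_ge0 _ _)).
by apply: lee_wpmul2r; [exact: L2norm_ge0|rewrite lee_fin; exact: nyquist_powR_le].
Qed.

End error_estimate.

Theorem theorem5 (R : realType) (J : R -> R) (hJ : kernel_hypotheses J) :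
  exists (C1 : R -> R) (C2 : R) (C3 : R -> R),
    0 < C2 /\
    forall (h sigma : R) (u0 : R -> R[i]%C),
      0 < h -> 2^-1 < sigma -> sobolev sigma u0 -> ccontinuous u0 ->
    forall (u : R -> R -> R[i]%C) (U : R -> int -> R[i]%C),
      exact_solution J u0 u -> semidiscrete_solution h J u0 U ->
    forall t : R, 0 <= t ->
      (L2norm setT (u t \- fourier_interpolant h (U t))%R
       <= (t * C1 h)%:E * L2norm setT u0
          + (C2 * h)%:E * sobolev_norm 2 u0
          + (C3 sigma * h `^ sigma)%:E * sobolev_norm sigma u0)%E.
Proof.
exists (consistency_cst J), 1, (fun s => Num.sqrt (2 * tail_sum (2 * s)) + 1).
split=> // h s u0 h0 s2 [_ u0s] cu0 u U [g hg hu] [w hw hU] t t0.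
rewrite (sobolev_normE s hg) in u0s *.
apply: le_trans (error_bound hJ h0 s2 t0 cu0 hg u0s (hu t t0) hw (hU t t0)) _.
apply: leeD => //; rewrite -[leLHS]adde0; apply: leeD => //.
by rewrite mule_ge0// ?lee_fin ?mul1r ?(ltW h0)// poweR_ge0.
Qed.
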